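(* Let $\mathbb P(T_7)\subset\mathbb P^6$ be the Stanley-Reisner scheme over $\mathbb C$ of the $7$-vertex triangulation $T_7$ of the torus. The versal base space $\mathrm{Def}^a_{\mathbb P(T_7)}$ is reduced. It is the union of $29$ irreducible components. The $28$ non-smoothing components are isomorphic to the germ of the product of the affine cone over $\mathbb P^1\times\mathbb P^2\subset\mathbb P^5$ (Segre embedding) and $\mathbb C^3$ or $\mathbb C^4$.
   Context: $T_7$ is the unique triangulation of the torus with $7$ vertices: $\mathrm{vert}\,T_7=\mathbb Z/7$, with the $14$ triangles $\{p,p+1,p+5\}$, $\{p,p+1,p+3\}$, $p\in\mathbb Z/7$; every pair of vertices is an edge. $X=\mathbb P(T_7)=\mathrm{Proj}\,\mathbb C[x_0,\dots,x_6]/I_{T_7}$, with $I_{T_7}$ generated by the squarefree monomials of non-faces. $\mathrm{Def}^a_X$ is the functor of deformations of $(X,\mathcal O_X(1))$, and also denotes its versal base space; by a known theorem this is the germ at $0\in\mathbb C^{21}$, with coordinates $t_{p,q}=t_{q,p}$ ($p\neq q\in\mathbb Z/7$), defined by the $21$ binomials which are the $2\times2$ minors of the seven matrices $$\begin{bmatrix}t_{p,p+1}&t_{p,p+4}&t_{p,p+2}\\t_{p,p-1}&t_{p,p-4}&t_{p,p-2}\end{bmatrix},\quad p\in\mathbb Z/7.$$ There is exactly one smoothing component (component over which the general fibre of the versal family is smooth), namely the germ of the $9$-dimensional toric variety defined by the prime ideal $\langle t^{v_+}-t^{v_-}:v\in\mathrm{Sat}\,L\rangle$, where $L\subset\mathbb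 Z^{21}$ is the lattice spanned by the exponent vectors of the $21$ binomials and $\mathrm{Sat}\,L$ is its saturation in $\mathbb Z^{21}$. *)

(* Defs.v *)
From HB Require Import structures.
From mathcomp Require Import all_boot all_order all_algebra.
From mathcomp Require Import mpoly complex ring_quotient.
From mathcomp Require Import boolp classical_sets functions cardinality reals.

Set Implicit Arguments.
Unset Strict Implicit.
Unset Printing Implicit Defensive.

Import Order.TTheory GRing.Theory Num.Theory.

Local Open Scope ring_scope.

(* Formal power series in n variables, as families of coefficients. *)
Definition mfps (C : Type) (n : nat) : Type := 'X_{1..n} -> C.

Section FormalPowerSeries.
Variables (C : comNzRingType) (n : nat).
Implicit Types (f g h : mfps C n) (m k : 'X_{1..n}) (p q : {mpoly C[n]}).

HB.instance Definition _ := gen_eqMixin (mfps C n).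
HB.instance Definition _ := gen_choiceMixin (mfps C n).

Definition mfps0 : mfps C n := fun=> 0.
Definition mfps1 : mfps C n := fun m => (m == 0%MM)%:R.
Definition mfps_opp f : mfps C n := fun m => - f m.
Definition mfps_add f g : mfps C n := fun m => f m + g m.
Definition mfps_mul f g : mfps C n := fun m =>
  \sum_(k : 'X_{1..n < (mdeg m).+1} | (k <= m)%MM) f k * g (m - k)%MM.

Definition mfps_trunc d f : {mpoly C[n]} :=
  \sum_(m : 'X_{1..n < d}) f m *: 'X_[m].

Lemma mcoeff_trunc d f m :
  (mfps_trunc d f)@_m = if (mdeg m < d)%N then f m else 0.
Proof.
case: ltnP => md; first exact: mcoeff_mpoly.
rewrite /mfps_trunc raddf_sum big1 //= => k _.
rewrite mcoeffZ mcoeffX; case: eqP => [km|_]; last by rewrite mulr0.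
by move: (bmdeg k); rewrite km ltnNge md.
Qed.

Lemma mfps_mulE f g p q m :
    (forall k, (mdeg k <= mdeg m)%N -> p@_k = f k) ->
    (forall k, (mdeg k <= mdeg m)%N -> q@_k = g k) ->
  mfps_mul f g m = (p * q)@_m.
Proof.
move=> pf qg.
have -> : (p * q)@_m =
    \sum_(k : 'X_{1..n < (mdeg m).+1} | (k <= m)%MM) p@_k * q@_(m - k).
  exact: mcoeff_poly_mul_lin.
apply: eq_bigr => k _; rewrite pf ?qg //; first exact: mdegB.
by rewrite -ltnS bmdeg.
Qed.

Lemma mfps_mul_trunc f g d m : (mdeg m < d)%N ->
  mfps_mul f g m = (mfps_trunc d f * mfps_trunc d g)@_m.
Proof.
by move=> md; apply: mfps_mulE => k km; rewrite mcoeff_trunc (leq_ltn_trans km).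
Qed.

Lemma mfps_addA : associative mfps_add.
Proof. by move=> f g h; apply/funext => m; rewrite /mfps_add addrA. Qed.

Lemma mfps_addC : commutative mfps_add.
Proof. by move=> f g; apply/funext => m; rewrite /mfps_add addrC. Qed.

Lemma mfps_add0 : left_id mfps0 mfps_add.
Proof. by move=> f; apply/funext => m; rewrite /mfps_add add0r. Qed.

Lemma mfps_addN : left_inverse mfps0 mfps_opp mfps_add.
Proof. by move=> f; apply/funext => m; rewrite /mfps_add addNr. Qed.

Lemma mfps_mulC : commutative mfps_mul.
Proof.
move=> f g; apply/funext => m.
by rewrite !(mfps_mul_trunc _ _ (ltnSn (mdeg m))) mulrC.
Qed.

Lemma mfps_mulA : associative mfps_mul.
Proof.
move=> f g h; apply/funext => m; pose T := mfps_trunc (mdeg m).+1.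
have TE f' k : (mdeg k <= mdeg m)%N -> (T f')@_k = f' k.
  by move=> km; rewrite mcoeff_trunc ltnS km.
rewrite (@mfps_mulE _ _ (T f) (T g * T h)); [|exact: TE|]; last first.
  by move=> k km; rewrite -mfps_mul_trunc.
rewrite (@mfps_mulE _ _ (T f * T g) (T h)) ?mulrA //; last exact: TE.
by move=> k km; rewrite -mfps_mul_trunc.
Qed.

Lemma mfps_mul1 : left_id mfps1 mfps_mul.
Proof.
move=> f; apply/funext => m.
rewrite (@mfps_mulE _ _ 1 (mfps_trunc (mdeg m).+1 f)).
- by rewrite mul1r mcoeff_trunc ltnSn.
- by move=> k _; rewrite mcoeff1.
- by move=> k km; rewrite mcoeff_trunc ltnS km.
Qed.

Lemma mfps_mulDl : left_distributive mfps_mul mfps_add.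
Proof.
move=> f g h; apply/funext => m; rewrite /mfps_mul /mfps_add -big_split /=.
by apply: eq_bigr => k _; rewrite mulrDl.
Qed.

Lemma mfps_1neq0 : mfps1 != mfps0.
Proof.
apply/eqP => /(congr1 (fun f => f 0%MM)) /eqP.
by rewrite /mfps1 /mfps0 eqxx oner_eq0.
Qed.

HB.instance Definition _ := GRing.isZmodule.Build (mfps C n)
  mfps_addA mfps_addC mfps_add0 mfps_addN.
HB.instance Definition _ := GRing.Zmodule_isComNzRing.Build (mfps C n)
  mfps_mulA mfps_mulC mfps_mul1 mfps_mulDl mfps_1neq0.

Definition mfps_of_mpoly p : mfps C n := fun m => p@_m.

End FormalPowerSeries.

Section ConvergentPowerSeries.
Variables (C : numFieldType) (n : nat).
Implicit Types (f g : mfps C n) (p : {mpoly C[n]}).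

(* Absolute convergence on some polydisc of positive radius r. *)
Definition mfps_cvg f : Prop := exists r M : C, 0 < r /\
  forall d, \sum_(m : 'X_{1..n < d}) `|f m| * r ^+ mdeg m <= M.

Definition cvg_series : {pred mfps C n} := fun f => `[< mfps_cvg f >].

Lemma mfps_cvg_shrink f (r s M : C) : 0 < s -> s <= r ->
    (forall d, \sum_(m : 'X_{1..n < d}) `|f m| * r ^+ mdeg m <= M) ->
  forall d, \sum_(m : 'X_{1..n < d}) `|f m| * s ^+ mdeg m <= M.
Proof.
move=> s0 sr fM d; apply: le_trans (fM d); apply: ler_sum => m _.
by rewrite ler_wpM2l // lerXn2r ?nnegrE ?(le_trans _ sr) // ltW.
Qed.

Lemma mfps_cvg2 f g : mfps_cvg f -> mfps_cvg g -> exists r M N : C, [/\ 0 < r,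
  forall d, \sum_(m : 'X_{1..n < d}) `|f m| * r ^+ mdeg m <= M &
  forall d, \sum_(m : 'X_{1..n < d}) `|g m| * r ^+ mdeg m <= N].
Proof.
move=> [r [M [r0 fM]]] [s [N [s0 gN]]].
have /orP[rs|sr] : (r <= s) || (s <= r).
  by apply: real_leVge; rewrite realE ltW.
- by exists r, M, N; split=> //; exact: mfps_cvg_shrink gN.
- by exists s, M, N; split=> //; exact: mfps_cvg_shrink fM.
Qed.

Lemma mfps_cvg_poly p : mfps_cvg (mfps_of_mpoly p).
Proof.
exists 1, (\sum_(m <- msupp p) `|p@_m|); split=> // d.
rewrite (eq_bigr (fun m : 'X_{1..n < d} => `|p@_m|)); last first.
  by move=> m _; rewrite expr1n mulr1.
rewrite (bigID (fun m : 'X_{1..n < d} => (m : 'X_{1..n}) \in msupp p)) /=.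
rewrite [X in _ + X]big1 ?addr0; last first.
  by move=> m /memN_msupp_eq0 ->; rewrite normr0.
rewrite -(big_map (fun m : 'X_{1..n < d} => (m : 'X_{1..n}))
  (fun m => m \in msupp p) (fun m => `|p@_m|)) -big_filter.
set s := filter _ _.
have us : uniq s.
  by rewrite filter_uniq // map_inj_uniq ?index_enum_uniq //; exact: val_inj.
have sub : {subset s <= msupp p} by move=> m; rewrite mem_filter => /andP[].
rewrite [leRHS](bigID (mem s)) /= -[leLHS]addr0 lerD ?sumr_ge0 //.
rewrite -[X in _ <= X]big_filter (perm_big (filter (mem s) (msupp p))) //.
apply: uniq_perm => //; first by rewrite filter_uniq // msupp_uniq.
by move=> m; rewrite mem_filter /=; case: (boolP (m \in s)) => // /sub.
Qed.

Lemma mfps_cvg_sub f g : mfps_cvg f -> mfps_cvg g -> mfps_cvg (f - g).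
Proof.
move=> cf cg; have [r [M [N [r0 fM gN]]]] := mfps_cvg2 cf cg.
exists r, (M + N); split=> // d; apply: le_trans (lerD (fM d) (gN d)).
rewrite -big_split /=; apply: ler_sum => m _; rewrite -mulrDl.
by rewrite ler_wpM2r ?exprn_ge0 ?(ltW r0) // ler_normB.
Qed.

Lemma meval_trunc (v : 'I_n -> C) d f : (mfps_trunc d f).@[v] =
  \sum_(m : 'X_{1..n < d}) f m * \prod_i v i ^+ m i.
Proof.
rewrite /mfps_trunc raddf_sum; apply: eq_bigr => m _ /=.
by rewrite mevalZ mevalX.
Qed.

Lemma mfps_cvg_mul f g : mfps_cvg f -> mfps_cvg g -> mfps_cvg (f * g).
Proof.
move=> cf cg; have [r [M [N [r0 fM gN]]]] := mfps_cvg2 cf cg.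
have rE (m : 'X_{1..n}) : \prod_(i < n) r ^+ m i = r ^+ mdeg m.
  by rewrite mdegE expr_sum.
exists r, (M * N); split=> // d.
pose P := mfps_trunc d (fun m => `|f m|); pose Q := mfps_trunc d (fun m => `|g m|).
have P0 m : 0 <= P@_m by rewrite mcoeff_trunc; case: ifP.
have Q0 m : 0 <= Q@_m by rewrite mcoeff_trunc; case: ifP.
have PQ0 m : 0 <= (P * Q)@_m.
  have -> : (P * Q)@_m =
      \sum_(k : 'X_{1..n < (mdeg m).+1} | (k <= m)%MM) P@_k * Q@_(m - k).
    exact: mcoeff_poly_mul_lin.
  by apply: sumr_ge0 => k _; rewrite mulr_ge0.
have PM : P.@[fun=> r] <= M.
  by rewrite /P meval_trunc; under eq_bigr do rewrite rE; exact: fM.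
have QN : Q.@[fun=> r] <= N.
  by rewrite /Q meval_trunc; under eq_bigr do rewrite rE; exact: gN.
have ev0 (h : mfps C n) : 0 <= (mfps_trunc d (fun m => `|h m|)).@[fun=> r].
  rewrite meval_trunc; apply: sumr_ge0 => m _.
  by rewrite rE mulr_ge0 ?exprn_ge0 ?(ltW r0).
have PQMN : (P * Q).@[fun=> r] <= M * N by rewrite mevalM ler_pM // ev0.
apply: le_trans PQMN; set e := maxn d (msize (P * Q)).
have -> : (P * Q).@[fun=> r] = \sum_(m : 'X_{1..n < e}) (P * Q)@_m * r ^+ mdeg m.
  rewrite [in LHS](@mpolywE _ _ e (P * Q)) ?leq_maxr // raddf_sum.
  by apply: eq_bigr => m _ /=; rewrite mevalZ mevalX rE.
apply: (@le_trans _ _ (\sum_(m : 'X_{1..n < d}) (P * Q)@_m * r ^+ mdeg m)).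
  apply: ler_sum => m _; rewrite ler_wpM2r ?exprn_ge0 ?(ltW r0) //.
  rewrite -(mfps_mulE (f := fun m => `|f m|) (g := fun m => `|g m|)).
  - apply: le_trans (ler_norm_sum _ _ _) _; apply: ler_sum => k _.
    by rewrite normrM.
  - by move=> k km; rewrite mcoeff_trunc (leq_ltn_trans km) ?bmdeg.
  - by move=> k km; rewrite mcoeff_trunc (leq_ltn_trans km) ?bmdeg.
have de : (d <= e)%N by rewrite leq_maxl.
pose w (m : 'X_{1..n < d}) : 'X_{1..n < e} :=
  BMultinom (leq_trans (bmdeg m) de : (mdeg m < e)%N).
have winj : injective w by move=> a b /(congr1 val) /= /val_inj.
rewrite [leRHS](bigID (mem (codom w))) /= -[leLHS]addr0 lerD //; last first.
  by apply: sumr_ge0 => m _; rewrite mulr_ge0 ?exprn_ge0 ?(ltW r0).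
have pe : perm_eq [seq m <- index_enum 'X_{1..n < e} | m \in codom w] (codom w).
  apply: uniq_perm; rewrite ?filter_uniq ?index_enum_uniq ?map_inj_uniq //.
    by rewrite -enumT enum_uniq.
  by move=> m; rewrite mem_filter mem_index_enum andbT.
by rewrite -[leRHS]big_filter (perm_big _ pe) big_map big_enum.
Qed.

Lemma cvg_series_subring : subring_closed cvg_series.
Proof.
split=> [|f g|f g]; rewrite ?unfold_in.
- apply/asboolP; suff -> : (1 : mfps C n) = mfps_of_mpoly 1 by exact: mfps_cvg_poly.
  by apply/funext => m; rewrite /mfps_of_mpoly mcoeff1.
- by move=> /asboolP cf /asboolP cg; apply/asboolP; exact: mfps_cvg_sub.
- by move=> /asboolP cf /asboolP cg; apply/asboolP; exact: mfps_cvg_mul.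
Qed.

HB.instance Definition _ := GRing.isSubringClosed.Build (mfps C n) cvg_series
  cvg_series_subring.

(* The local ring of the germ of C^n at 0, i.e. the ring of convergent power *)
(* series in n variables.                                                    *)
Record local_ring := LocalRing {
  series_of :> mfps C n; series_of_cvg : series_of \in cvg_series }.

HB.instance Definition _ := [isSub for series_of].
HB.instance Definition _ := [Choice of local_ring by <:].
HB.instance Definition _ := [SubChoice_isSubComNzRing of local_ring by <:].

Lemma mpoly_cvg p : mfps_of_mpoly p \in cvg_series.
Proof. by rewrite unfold_in; apply/asboolP; exact: mfps_cvg_poly. Qed.

Definition of_mpoly p : local_ring := LocalRing (mpoly_cvg p).

End ConvergentPowerSeries.

Local Open Scope classical_set_scope.

Section Ideals.
Variable A : comNzRingType.
Implicit Types (G : set A) (I : {pred A}) (P : prime_idealr A).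

Definition ideal_span G : set A := [set x | exists s : seq (A * A),
  (forall c, c \in s -> G c.2) /\ x = \sum_(c <- s) c.1 * c.2].

(* The irreducible components of the germ defined by I correspond to the *)
(* minimal primes over I.                                                *)
Definition minimal_prime_over I P : Prop :=
  {subset I <= P} /\
  forall P', {subset I <= P'} -> {subset P' <= P} -> {subset P <= P'}.

Definition components I : set (set A) :=
  [set Z | exists2 P, minimal_prime_over I P & Z = [set x | x \in P]].

Lemma ideal_span_closed G : ~ ideal_span G 1 ->
  idealr_closed (fun x => `[< ideal_span G x >]).
Proof.
move=> G1; split.
- by apply/asboolP; exists [::]; split=> [c|]; rewrite ?big_nil ?in_nil.
- by apply/negP => /asboolP.
move=> a x y /asboolP[s [sG ->]] /asboolP[t [tG ->]]; apply/asboolP.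
exists ([seq (a * c.1, c.2) | c <- s] ++ t); split=> [c|].
  by rewrite mem_cat => /orP[/mapP[e /sG Ge ->]|/tG].
rewrite big_cat big_map mulr_sumr /=.
by congr (_ + _); apply: eq_bigr => c _; rewrite mulrA.
Qed.

End Ideals.

Definition reduced (A : comNzRingType) : Prop :=
  forall (x : A) (k : nat), x ^+ k = 0 -> x = 0.

Section Germs.
Variables (C : numFieldType) (n : nat).
Implicit Types (G : set {mpoly C[n]}) (g : {mpoly C[n]}).

(* The ideal of the germ at 0 of the subscheme of C^n defined by G. *)
Definition extended_ideal G : set (local_ring C n) :=
  ideal_span (@of_mpoly C n @` G).

Definition through_origin G : Prop := forall g, G g -> g.@[fun=> 0] = 0.

Definition germ G (G0 : through_origin G) : {pred local_ring C n} :=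
  fun x => `[< extended_ideal G x >].

Lemma meval_origin g : g.@[fun=> 0] = g@_0%MM.
Proof.
rewrite [in RHS](mpolyE g) raddf_sum mevalE; apply: eq_bigr => m _ /=.
rewrite mcoeffZ mcoeffX; congr (_ * _); case: eqP => [->|/eqP m0].
  by rewrite big1 // => i _; rewrite mnm0E expr0.
have [i mi] : exists i, m i != 0%N.
  by apply/existsP; apply: contraNT m0 => /existsPn h; apply/eqP/mnmP => i;
     rewrite mnm0E; apply/eqP; rewrite -[_ == _]negbK h.
by rewrite (bigD1 i) //= expr0n (negbTE mi) mul0r.
Qed.

Lemma germ_closed G (G0 : through_origin G) : idealr_closed (germ G0).
Proof.
apply: ideal_span_closed => -[s [sG]].
move=> /(congr1 (fun x : local_ring C n => series_of x 0%MM)).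
have sumE (t : seq (local_ring C n * local_ring C n)) :
    (forall c, c \in t -> series_of c.2 0%MM = 0) ->
  series_of (\sum_(c <- t) c.1 * c.2) 0%MM = 0.
  elim: t => [|c t IH] ct; first by rewrite big_nil.
  rewrite big_cons.
  rewrite -[LHS]/(mfps_mul c.1 c.2 0%MM
                  + series_of (\sum_(e <- t) e.1 * e.2) 0%MM).
  rewrite IH ?addr0 => [|e et]; last by apply: ct; rewrite inE et orbT.
  rewrite (@mfps_mul_trunc _ _ _ _ 1%N) ?mdeg0 //.
  rewrite (rmorphM (mcoeff 0%MM : {rmorphism {mpoly C[n]} -> C})) /=.
  by rewrite !mcoeff_trunc mdeg0 /= ct ?mulr0 // inE eqxx.
rewrite sumE => [|c /sG[g Gg <-]].
  rewrite -[LHS]/((0%MM == 0%MM :> 'X_{1..n})%:R : C) eqxx.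
  by apply/eqP; rewrite oner_eq0.
by rewrite -[RHS](G0 g Gg) meval_origin.
Qed.

HB.instance Definition _ G (G0 : through_origin G) :=
  isIdealr.Build (local_ring C n) (germ G0) (germ_closed G0).

End Germs.

(* Isomorphism of germs: an isomorphism of C-algebras between their local *)
(* rings, i.e. a bijective ring morphism that is the identity on the      *)
(* constants.                                                             *)
Definition germ_iso (C : numFieldType) (m n : nat)
    (I : idealr (local_ring C m)) (J : idealr (local_ring C n)) : Prop :=
  exists f : {rmorphism {ideal_quot I} -> {ideal_quot J}},
    bijective f /\
    forall c : C, f (\pi_{ideal_quot I} (of_mpoly c%:MP))%qT
                  = (\pi_{ideal_quot J} (of_mpoly c%:MP))%qT.

Section VersalBase.
Variable C : numFieldType.

(* The coordinate t_{p,q} = t_{q,p} of C^21, p <> q: the pairs p < q are *)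
(* numbered 0..20 by 'C(q, 2) + p.                                       *)
Definition tvar (p q : 'Z_7) : 'I_21 := inord ('C(maxn p q, 2) + minn p q).

Lemma tvarC p q : tvar p q = tvar q p.
Proof. by rewrite /tvar maxnC minnC. Qed.

Definition shift (j : 'I_3) : 'Z_7 := tnth [tuple 1; 4; 2] j.

Definition tmatrix (p : 'Z_7) : 'M['I_21]_(2, 3) :=
  \matrix_(i, j) tvar p (if i == 0 then p + shift j else p - shift j).

Definition minor2 (A : comNzRingType) (M : 'M[A]_(2, 3)) (j k : 'I_3) : A :=
  M 0 j * M 1 k - M 0 k * M 1 j.

Definition versal_eqns : set {mpoly C[21]} :=
  [set g | exists p : 'Z_7, exists j k : 'I_3, (j < k)%N /\
     g = minor2 (map_mx (fun e : 'I_21 => 'X_e) (tmatrix p)) j k].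

Lemma versal_eqns_origin : through_origin versal_eqns.
Proof.
move=> _ [p [j [k [_ ->]]]].
by rewrite /minor2 !mxE mevalB !mevalM !mevalXU !mulr0 subr0.
Qed.

(* The versal base space Def^a of P(T_7), through its known equations: the *)
(* pairs {p, q} are the edges of T_7 (every pair of vertices is an edge).  *)
Definition versal_base : idealr (local_ring C 21) := germ versal_eqns_origin.

Definition exponent (p : 'Z_7) (j k : 'I_3) : 'rV[int]_21 :=
  delta_mx 0 (tmatrix p 0 j) + delta_mx 0 (tmatrix p 1 k)
  - (delta_mx 0 (tmatrix p 0 k) + delta_mx 0 (tmatrix p 1 j)).

(* The lattice spanned by the exponent vectors of the binomials above, and *)
(* its saturation in Z^21.                                                 *)
Definition lattice : set 'rV[int]_21 :=
  [set v | exists c : 'Z_7 -> 'I_3 -> 'I_3 -> int,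
     v = \sum_p \sum_(j < 3) \sum_(k < 3 | (j < k)%N) c p j k *: exponent p j k].

Definition lattice_sat : set 'rV[int]_21 :=
  [set v | exists2 d : int, d != 0 & lattice (d *: v)].

Definition pos_part (v : 'rV[int]_21) : 'X_{1..21} :=
  [multinom `|Num.max (v 0%R i) 0%R|%N | i < 21].

Definition smoothing_eqns : set {mpoly C[21]} :=
  [set 'X_[pos_part v] - 'X_[pos_part (- v)] | v in lattice_sat].

(* Given as a bare ideal: its primality is part of being a component. *)
Definition smoothing_component : set (local_ring C 21) :=
  extended_ideal smoothing_eqns.

End VersalBase.

Arguments smoothing_component C x : clear implicits.

Section SegreCone.
Variables (C : numFieldType) (d : nat).

(* (affine cone over P^1 x P^2 in C^6) x C^d; the cone consists of the *)
(* points with coordinates z_{ij} = x_i y_j.                           *)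
Definition segre_cone : set ('I_(2 * 3 + d) -> C) :=
  [set v | exists (x : 'I_2 -> C) (y : 'I_3 -> C),
     forall i j, v (lshift d (mxvec_index i j)) = x i * y j].

Definition segre_eqns : set {mpoly C[2 * 3 + d]} :=
  [set g | forall v, segre_cone v -> g.@[v] = 0].

Lemma segre_eqns_origin : through_origin segre_eqns.
Proof.
by move=> g; apply; exists (fun=> 0), (fun=> 0) => i j; rewrite mulr0.
Qed.

Definition segre_germ : idealr (local_ring C (2 * 3 + d)) :=
  germ segre_eqns_origin.

End SegreCone.

(* Main.v *)
Require Import Defs.
From HB Require Import structures.
From mathcomp Require Import all_boot all_order all_algebra.
From mathcomp Require Import ssrcomplements mpoly complex ring_quotient.
From mathcomp Require Import zify ring.
From mathcomp Require Import boolp classical_sets functions cardinality reals.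

(* The ideals involved are spanned by binomials and monomials, i.e. given by a
   graded congruence on monomials in which one class may be sent to 0. A
   convergent series is in the extension of such an ideal exactly when, in each
   degree, its coefficients on each nonzero class add up to 0: by Dickson's lemma
   finitely many reductions reach the least monomials of the classes, and the
   quotients of the division of the series by them converge. Everything is thus
   reduced to monomials.

   Reducedness: the minors generate an ideal I with a Groebner basis whose leading
   monomials are squarefree, up to some divisible by one of two variables y, and
   (I : y) has a squarefree Groebner basis. So f^2 in I implies y f in I, and
   multiplication by a suitable y preserves the leading standard monomial of f.

   Components: besides the toric ideal there are 28 sets of edges, the star of a
   vertex p with 3 or 4 more edges; each gives the prime ideal of the minors at p
   and the variables off the set. A prime containing I gives a multiplicative map
   from monomials to a domain. The variables with nonzero image are either in one
   of the 28 sets, and then the map kills the corresponding ideal, or the zeros of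
   a nonnegative weight for which the minors are homogeneous. In the latter case,
   two monomials with the same toric image and weight 0 differ by a flow along the
   edges which only uses minors in variables with nonzero image, so that they have
   the same image in the domain. Hence every prime over I contains one of the 29
   primes, which are pairwise incomparable, and I is their intersection since it
   is a radical ideal.

   The same flows show that the exponents of the toric binomials already lie in
   the lattice L. *)

Set Implicit Arguments.
Unset Strict Implicit.
Unset Printing Implicit Defensive.

Import Order.TTheory GRing.Theory Num.Theory.

Local Open Scope ring_scope.
Local Open Scope classical_set_scope.
Local Open Scope card_scope.

(** * Convergent series and congruences on monomials *)

(** The steps 1, 4, 2 are the squares modulo 7 and -1 is not a square, so every edge has exactly one
    species and one orientation, and the edges of a species form an oriented 7-cycle. Where nothing
    vanishes, the minors at [p] say that the quotient of the outgoing by the incoming edge is the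
    same [z_p] for all three species. Going once around a cycle shows that the product of the seven
    [z_p] is 1, so a starting edge [y_a] for each species and [z_1], ..., [z_6] are the 9 toric
    parameters. Dually, a vector of L is a flow [c p a] whose three values at each vertex add up to
    0: an edge gets the flow at its start minus the flow at its end. The obstacle is that a prime
    over the minors may contain variables, and these cannot be cancelled: a toric binomial is
    available modulo the prime only if its flow avoids them. A flow is determined up to one constant
    per species, the constants adding up to 0, and these two degrees of freedom steer it away from
    the vanishing variables. Whether this succeeds depends only on the set of nonzero variables,
    which makes it a finite problem, settled by computation; the affine symmetries of [Z/7] shorten
    the list of weights. *)

Section HomogeneousParts.
Variables (C : comNzRingType) (n : nat).
Implicit Types (f g : mfps C n) (m : 'X_{1..n}).

Definition hpart d f : {mpoly C[n]} := mfps_trunc d.+1 f - mfps_trunc d f.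

Lemma mcoeff_hpart d f m : (hpart d f)@_m = if mdeg m == d then f m else 0.
Proof.
rewrite mcoeffB !mcoeff_trunc ltnS.
by case: ltngtP; rewrite ?subrr ?subr0.
Qed.

Lemma hpart_is_zmod_morphism d : zmod_morphism (hpart d).
Proof.
move=> f g; apply/mpolyP => m; rewrite [in RHS]mcoeffB !mcoeff_hpart.
by case: eqP => //; rewrite subr0.
Qed.

HB.instance Definition _ d :=
  GRing.isZmodMorphism.Build (mfps C n) {mpoly C[n]} (hpart d)
    (hpart_is_zmod_morphism d).

Lemma hpartM d f g :
  hpart d (f * g) = \sum_(i < d.+1) hpart i f * hpart (d - i) g.
Proof.
apply/mpolyP => m; rewrite mcoeff_hpart raddf_sum /=.
have BE (k : 'X_{1..n}) : (k <= m)%MM -> mdeg m = (mdeg (m - k) + mdeg k)%N.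
  by move=> km; rewrite -mdegD submK.
under eq_bigr => i _ do rewrite (@mcoeff_poly_mul_lin _ _ _ _ _ _ (ltnSn (mdeg m))).
rewrite exchange_big /=; case: eqP => [md|md]; last first.
  apply/esym/big1 => k km; apply: big1 => i _; rewrite !mcoeff_hpart.
  case: eqP => [ki|_]; last by rewrite mul0r.
  case: eqP => [kj|_]; last by rewrite mulr0.
  by case: md; rewrite (BE _ km) ki kj subnK // -ltnS.
apply: eq_bigr => k km.
have kd : (mdeg (val k) < d.+1)%N by rewrite -md bmdeg.
rewrite (bigD1 (Ordinal kd)) //= big1 ?addr0 => [|i].
  rewrite !mcoeff_hpart eqxx; case: eqP => // -[].
  by have := BE _ km; rewrite [LHS]md => ->; rewrite addnK.
rewrite -val_eqE /= eq_sym !mcoeff_hpart => /negbTE ->.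
by rewrite mul0r.
Qed.

End HomogeneousParts.

Section Collapse.
Variables (C : comNzRingType) (n k : nat) (kap : 'X_{1..n} -> option 'X_{1..k}).
Implicit Types (p q : {mpoly C[n]}) (m : 'X_{1..n}).

Definition oX (o : option 'X_{1..k}) : {mpoly C[k]} :=
  if o is Some w then 'X_[w] else 0.

Lemma mcoeff_oX o w : (oX o)@_w = (o == Some w)%:R.
Proof.
case: o => [v|]; last by rewrite mcoeff0.
by rewrite mcoeffX (inj_eq (fun a b => @Some_inj _ a b)).
Qed.

(** The kernel of this linear map is spanned by the relations of [kap]; it is an ideal as soon as
    [kap] is a congruence. *)
Definition collapse p : {mpoly C[k]} :=
  \sum_(m <- msupp p) p@_m *: oX (kap m).

Lemma collapsewE d p : (msize p <= d)%N ->
  collapse p = \sum_(m : 'X_{1..n < d}) p@_m *: oX (kap m).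
Proof.
move=> pd; pose I : subFinType _ := 'X_{1..n < d}.
rewrite /collapse (big_mksub I) //=; first last.
- by move=> x /msize_mdeg_lt /leq_trans; apply.
- by rewrite msupp_uniq.
by rewrite big_rmcond //= => i; move/memN_msupp_eq0 ->; rewrite scale0r.
Qed.

Lemma collapse_is_linear : linear collapse.
Proof.
move=> c p q; pose d := maxn (msize (c *: p + q)) (maxn (msize p) (msize q)).
rewrite !(@collapsewE d) ?leq_max ?leqnn ?orbT // scaler_sumr -big_split /=.
by apply: eq_bigr => m _; rewrite mcoeffD mcoeffZ scalerDl scalerA.
Qed.

HB.instance Definition _ :=
  GRing.isLinear.Build C {mpoly C[n]} {mpoly C[k]} _ collapse collapse_is_linear.

Lemma collapseX m : collapse 'X_[m] = oX (kap m).
Proof. by rewrite /collapse msuppX big_seq1 mcoeffX eqxx scale1r. Qed.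

Lemma mcoeff_collapse d p w : (msize p <= d)%N ->
  (collapse p)@_w = \sum_(m : 'X_{1..n < d} | kap m == Some w) p@_m.
Proof.
move=> pd; rewrite (collapsewE pd) raddf_sum /= [RHS]big_mkcond.
apply: eq_bigr => m _; rewrite mcoeffZ mcoeff_oX.
by case: eqP; rewrite ?mulr1 ?mulr0.
Qed.

End Collapse.

Section GradedIdeal.
Variables (C : comNzRingType) (n k : nat) (kap : 'X_{1..n} -> option 'X_{1..k}).

(** Collapsing makes sense only for polynomials, hence for each homogeneous part separately. *)
Definition graded_kernel (f : mfps C n) := forall d, collapse kap (hpart d f) = 0.

Lemma mcoeff_collapse_hpart d (f : mfps C n) w :
  (collapse kap (hpart d f))@_w =
  \sum_(m : 'X_{1..n < d.+1} | (kap m == Some w) && (mdeg m == d)) f m.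
Proof.
rewrite (@mcoeff_collapse _ _ _ _ d.+1); last first.
  rewrite msizeE; apply/bigmax_leqP_seq => m; rewrite mcoeff_msupp => + _.
  by rewrite mcoeff_hpart ltnS; case: ltngtP => //; rewrite eqxx.
rewrite [LHS]big_mkcond [RHS]big_mkcond; apply: eq_bigr => m _.
by rewrite mcoeff_hpart; case: eqP; case: eqP.
Qed.


(* The monomials with [kap m = None] are those in the ideal. *)
Definition graded_congruence : Prop := [/\
  forall u m m', kap m = kap m' -> kap (u + m)%MM = kap (u + m')%MM,
  forall u m, kap m = None -> kap (u + m)%MM = None &
  forall m m', kap m = kap m' -> kap m <> None -> mdeg m = mdeg m'].

Hypothesis kapP : graded_congruence.

Lemma collapse_mulXl u (q : {mpoly C[n]}) :
  collapse kap q = 0 -> collapse kap ('X_[u] * q) = 0.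
Proof.
case: kapP => kapD kapN _ q0.
(* Multiplication by [u] on classes: well defined on the image of [kap] since this is a congruence,
   and [None] elsewhere. *)
have [theta thetaP] : exists theta : 'X_{1..k} -> option 'X_{1..k},
    forall m w, kap m = Some w -> theta w = kap (u + m)%MM.
  have h w : exists o, forall m, kap m = Some w -> o = kap (u + m)%MM.
    have [[m mw]|no] := pselect (exists m, kap m = Some w).
      by exists (kap (u + m)%MM) => m' m'w; apply: kapD; rewrite mw m'w.
    by exists None => m mw; case: no; exists m.
  by have [theta thetaP] := choice h; exists theta => m w /thetaP.
suff -> : collapse kap ('X_[u] * q) = collapse theta (collapse kap q).
  by rewrite q0 raddf0.
rewrite [q]mpolyE mulr_sumr [LHS]linear_sum.
rewrite [X in _ = collapse theta X]linear_sum [RHS]linear_sum /=.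
apply: eq_bigr => m _.
rewrite -scalerAr -mpolyXD !linearZ /= !collapseX; congr (_ *: _).
case E: (kap m) => [w|]; last by rewrite kapN //= raddf0.
by rewrite collapseX (thetaP _ _ E).
Qed.

Lemma collapse_mull (p q : {mpoly C[n]}) :
  collapse kap q = 0 -> collapse kap (p * q) = 0.
Proof.
move=> q0; rewrite [p]mpolyE mulr_suml linear_sum big1 // => m _.
by rewrite -scalerAl linearZ /= collapse_mulXl // scaler0.
Qed.

Lemma graded_kernelD f g : graded_kernel f -> graded_kernel g ->
  graded_kernel (f + g).
Proof.
move=> kf kg d; rewrite -[RHS]addr0 -{1}(kf d) -(kg d).
by rewrite (raddfD (hpart d)) [LHS]raddfD.
Qed.

Lemma graded_kernel_mull f g : graded_kernel g -> graded_kernel (f * g).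
Proof.
move=> kg d; rewrite hpartM raddf_sum big1 // => i _.
exact: collapse_mull.
Qed.

End GradedIdeal.

Section MonomialMap.
Variables (C : idomainType) (n k : nat) (kap : 'X_{1..n} -> option 'X_{1..k}).

Definition add_option (o o' : option 'X_{1..k}) :=
  if o is Some w then omap (mnm_add w) o' else None.

Hypothesis kapD : forall m m', kap (m + m')%MM = add_option (kap m) (kap m').

Lemma oX_add o o' : oX C (add_option o o') = oX C o * oX C o'.
Proof. by case: o o' => [w|] [w'|] //=; rewrite ?mpolyXD ?mul0r ?mulr0. Qed.

Lemma collapseM (p q : {mpoly C[n]}) :
  collapse kap (p * q) = collapse kap p * collapse kap q.
Proof.
rewrite [p in LHS]mpolyE [q in LHS]mpolyE mulr_suml [LHS]linear_sum.
rewrite [X in _ = X * _]/collapse mulr_suml; apply: eq_bigr => m _.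
rewrite mulr_sumr [LHS]linear_sum /collapse mulr_sumr; apply: eq_bigr => m' _.
rewrite -scalerAl -scalerAr -mpolyXD [LHS]linearZ /= linearZ /= collapseX.
by rewrite kapD oX_add -scalerAl -scalerAr.
Qed.

(* The lowest homogeneous parts not killed by [collapse] multiply to such a part. *)
Lemma graded_kernel_prime (f g : mfps C n) :
  graded_kernel kap (f * g) -> graded_kernel kap f \/ graded_kernel kap g.
Proof.
move=> kfg; have [|nkf] := pselect (graded_kernel kap f); [by left|].
have [|nkg] := pselect (graded_kernel kap g); [by right|].
have low (h : mfps C n) : ~ graded_kernel kap h -> exists d,
    collapse kap (hpart d h) != 0 /\
    forall i, (i < d)%N -> collapse kap (hpart i h) = 0.
  move=> /existsNP[d /eqP hd].
  have ex : exists d, collapse kap (hpart d h) != 0 by exists d.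
  have [e he emin] := ex_minnP ex; exists e; split=> // i ie.
  by apply/eqP; apply: contraTT ie => /emin; rewrite -leqNgt.
have [d [fd fmin]] := low _ nkf; have [e [ge gmin]] := low _ nkg.
have /eqP := kfg (d + e)%N; rewrite hpartM [X in X == _]linear_sum /=.
have de : (d < (d + e).+1)%N by rewrite ltnS leq_addr.
rewrite (bigD1 (Ordinal de)) //= big1 ?addr0 => [|i].
  by rewrite addKn [X in X == _]collapseM mulf_eq0 (negbTE fd) (negbTE ge).
rewrite -val_eqE /= => /negbTE id; rewrite [LHS]collapseM.
case: (ltngtP i d) => [/fmin ->|di|/eqP]; [by rewrite mul0r| |by rewrite id].
by rewrite gmin ?mulr0 // ltn_subLR ?ltn_add2r // -ltnS.
Qed.

End MonomialMap.

(** * Dickson's lemma *)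

Section Dickson.

(** By induction on the length, [s] is a basis of the possible tails. With [b] the largest head
    chosen for the members of [s], a list with head at least [b] lies above some [hd t :: t]; each
    of the finitely many smaller heads has a basis of its own. *)
Lemma dickson_seq n (P : seq nat -> Prop) : exists s : seq (seq nat),
  (forall h, h \in s -> P h /\ size h = n) /\
  forall m, P m -> size m = n -> exists2 h, h \in s & all2 leq h m.
Proof.
elim: n P => [|n IH] P.
  have [P0|nP0] := pselect (P [::]); [exists [:: [::]]|exists [::]]; split=> //.
  - by move=> h; rewrite inE => /eqP ->.
  - by move=> m _ /size0nil ->; exists [::]; rewrite ?inE.
  - by move=> m Pm /size0nil m0; rewrite m0 in Pm.
have [s [sP sB]] := IH (fun t => exists a, P (a :: t)).
have hdP t : exists a, t \in s -> P (a :: t).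
  by have [ts|_] := boolP (t \in s); [have [[a Pa] _] := sP _ ts; exists a|exists 0%N].
have [hd hdE] := choice hdP.
have [slice sliceP] := choice (fun a => IH (fun t => P (a :: t))).
pose b := \max_(t <- s) hd t.
exists ([seq hd t :: t | t <- s] ++ [seq a :: t | a <- iota 0 b, t <- slice a]).
split=> [h|[//|a t] Pat /= [st]].
  rewrite mem_cat => /orP[/mapP[t ts ->]|/allpairsPdep[a [t [_ ta ->]]]] /=.
    by split; [exact: hdE|have [_ ->] := sP _ ts].
  by have [/(_ _ ta)[Pat <-]] := sliceP a.
case: (ltnP a b) => [ab|ba].
  have [_ /(_ _ Pat st)[h hs ht]] := sliceP a; exists (a :: h).
    rewrite mem_cat; apply/orP; right; apply/allpairsPdep.
    by exists a, h; rewrite mem_iota.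
  by rewrite /= leqnn.
have [|h hs ht] := sB t _ st; first by exists a.
exists (hd h :: h); first by rewrite mem_cat map_f.
rewrite /= ht andbT; apply: leq_trans ba; by rewrite /b; apply: (@leq_bigmax_seq _ s xpredT hd).
Qed.

Lemma dickson n (P : 'X_{1..n} -> Prop) : exists s : seq 'X_{1..n},
  (forall h, h \in s -> P h) /\
  forall m, P m -> exists2 h, h \in s & (h <= m)%MM.
Proof.
pose tm (m : 'X_{1..n}) : seq nat := multinom_val m.
have tmK (t : seq nat) : size t = n -> exists m, tm m = t.
  by move=> /eqP st; exists (Multinom (Tuple st)).
have [s [sP sB]] := dickson_seq n (fun t => exists2 m, P m & tm m = t).
have [g gP] : exists g : seq nat -> 'X_{1..n}, forall t, size t = n -> tm (g t) = t.
  have h t : exists m, size t = n -> tm m = t.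
    have [/tmK[m <-]|nt] := pselect (size t = n); first by exists m.
    by exists 0%MM => /nt.
  by have [g gP] := choice h; exists g.
have tm_inj : injective tm by move=> a b /val_inj/val_inj.
exists (map g s); split=> [_ /mapP[t ts ->]|m Pm].
  have [[m Pm <-] sm] := sP _ ts.
  by have /tm_inj -> := gP _ sm.
have [||t ts tm_le] := sB (tm m); [by exists m|by rewrite size_tuple|].
exists (g t); first by rewrite map_f.
have [_ st] := sP _ ts; apply/mnm_lepP => i.
rewrite !(mnm_nth 0%N) -/(tm _) gP //.
move: tm_le; rewrite all2E size_tuple st eqxx /= => /(all_nthP (0, 0)%N).
move=> /(_ i); rewrite size_zip size_tuple st minnn => /(_ (ltn_ord i)).
by rewrite nth_zip /= ?size_tuple.
Qed.

End Dickson.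

Section Convergence.
Variables (C : numFieldType) (n : nat).
Implicit Types (f : mfps C n).

Lemma geometric_sum_le2 d : \sum_(j < d) 2^-1 ^+ j <= 2 :> C.
Proof.
suff -> : \sum_(j < d) 2^-1 ^+ j = 2 - 2 * 2^-1 ^+ d :> C.
  by rewrite gerBl mulr_ge0 // exprn_ge0 // invr_ge0.
elim: d => [|d IH]; first by rewrite big_ord0 expr0 mulr1 subrr.
rewrite big_ord_recr /= IH exprS mulrA divff ?pnatr_eq0 // mul1r.
by rewrite -addrA; congr (_ + _); rewrite mulr_natl mulr2n opprD addrNK.
Qed.

(** The monomials of bounded degree are among the exponent vectors with bounded entries, over which
    the sum factors into [n] geometric sums. *)
Lemma mnm_geometric_sum d :
  \sum_(m : 'X_{1..n < d}) 2^-1 ^+ mdeg m <= 2 ^+ n :> C.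
Proof.
have h0 : 0 <= 2^-1 :> C by rewrite invr_ge0.
case: d => [|d].
  rewrite big1 ?exprn_ge0 // => m _; by have := bmdeg m; rewrite ltn0.
pose phi (m : 'X_{1..n < d.+1}) : {ffun 'I_n -> 'I_d.+1} := [ffun i => inord (m i)].
have phiE m i : phi m i = m i :> nat.
  rewrite ffunE inordK // (leq_ltn_trans _ (bmdeg m)) // mdegE.
  by rewrite (bigD1 i) //= leq_addr.
have phi_inj : injective phi.
  move=> a b ab; apply/val_inj/mnmP => i /=.
  by rewrite -!phiE ab.
have -> : \sum_(m : 'X_{1..n < d.+1}) 2^-1 ^+ mdeg m =
    \sum_(g in phi @: setT) \prod_i 2^-1 ^+ g i :> C.
  rewrite big_imset /= => [|a b _ _]; last exact: phi_inj.
  rewrite [RHS]big_mkcond /=; apply: eq_bigr => m _; rewrite in_setT mdegE expr_sum.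
  by apply: eq_bigr => i _; rewrite phiE.
apply: (@le_trans _ _ (\sum_(g : {ffun 'I_n -> 'I_d.+1}) \prod_i 2^-1 ^+ g i)).
  rewrite [leRHS](bigID (mem (phi @: setT))) /= lerDl sumr_ge0 // => g _.
  by apply: prodr_ge0 => i _; rewrite exprn_ge0.
rewrite -(bigA_distr_bigA (fun (i : 'I_n) (j : 'I_d.+1) => 2^-1 ^+ j : C)) /=.
rewrite prodr_const card_ord lerXn2r ?nnegrE ?sumr_ge0 //.
  by move=> i _; rewrite exprn_ge0.
exact: geometric_sum_le2.
Qed.

(** Bounded terms become summable when the radius is halved, by [mnm_geometric_sum]. *)
Lemma mfps_cvgP f : mfps_cvg f <->
  exists r M : C, 0 < r /\ forall m, `|f m| * r ^+ mdeg m <= M.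
Proof.
split=> [[r [M [r0 fM]]]|[r [M [r0 fM]]]].
  exists r, M; split=> // m; apply: le_trans (fM (mdeg m).+1).
  rewrite (bigD1 (BMultinom (ltnSn (mdeg m)))) //= lerDl sumr_ge0 // => k _.
  by rewrite mulr_ge0 // exprn_ge0 // ltW.
have M0 : 0 <= M by apply: le_trans (fM 0%MM); rewrite mdeg0 mulr_ge0.
exists (r / 2), (M * 2 ^+ n); split=> [|d]; first by rewrite divr_gt0.
apply: (@le_trans _ _ (\sum_(m : 'X_{1..n < d}) M * 2^-1 ^+ mdeg m)).
  apply: ler_sum => m _; rewrite exprMn mulrA ler_wpM2r //.
  by rewrite exprn_ge0 // invr_ge0.
by rewrite -mulr_sumr ler_wpM2l // mnm_geometric_sum.
Qed.

End Convergence.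

(** * Division of a convergent series by the relations of a congruence *)

Section Division.
Variables (C : numFieldType) (n k : nat) (kap : 'X_{1..n} -> option 'X_{1..k}).
Hypothesis kapP : graded_congruence kap.

(** The irreducible monomials are the least ones of the nonzero classes. *)
Definition reducible (m : 'X_{1..n}) : Prop :=
  kap m = None \/ exists2 m', (m' < m)%O & kap m' = kap m.

Lemma target_exists (h : 'X_{1..n}) : exists o : option 'X_{1..n},
  reducible h -> if o is Some h' then
    [/\ (h' < h)%O, kap h' = kap h & kap h <> None] else kap h = None.
Proof.
have [kh|kh] := pselect (kap h = None); first by exists None.
have [[//|[h' h'h e]]|nr] := pselect (reducible h); first by exists (Some h').
by exists None => /nr.
Qed.

Variables (s : seq 'X_{1..n}) (tgt : 'X_{1..n} -> option 'X_{1..n}).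
Hypothesis s_red : forall h, h \in s -> reducible h.
Hypothesis s_basis : forall m, reducible m -> exists2 h, h \in s & (h <= m)%MM.
Hypothesis tgtP : forall h, reducible h -> if tgt h is Some h' then
  [/\ (h' < h)%O, kap h' = kap h & kap h <> None] else kap h = None.

(** Choosing the first divisor in [s] makes reduction deterministic, so that each monomial follows a
    single path. *)
Definition leading (m : 'X_{1..n}) : option 'X_{1..n} :=
  ohead [seq h <- s | (h <= m)%MM].

(** [None] is the result both for an irreducible monomial and for one that is sent to 0. *)
Definition reduce (m : 'X_{1..n}) : option 'X_{1..n} :=
  if leading m is Some h then omap (fun h' => (m - h + h')%MM) (tgt h) else None.

Lemma leadingP m h : leading m = Some h -> h \in s /\ (h <= m)%MM.
Proof.
rewrite /leading; case E: [seq _ <- _ | _] => [//|h' s'] [<-].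
have : h' \in [seq h <- s | (h <= m)%MM] by rewrite E inE eqxx.
by rewrite mem_filter => /andP[].
Qed.

Lemma leadingN m : leading m = None -> ~ reducible m.
Proof.
rewrite /leading; case E: [seq _ <- _ | _] => [|//] _ /s_basis[h hs hm].
have : h \in [seq h <- s | (h <= m)%MM] by rewrite mem_filter hm hs.
by rewrite E.
Qed.

Lemma reduceP v w : reduce v = Some w ->
  [/\ (w < v)%O, mdeg w = mdeg v & kap w = kap v].
Proof.
case: kapP => kapD kapN kapdeg.
rewrite /reduce; case L: (leading v) => [h|//]; have [hs hv] := leadingP L.
have := tgtP (s_red hs); case: (tgt h) => [h'|//] [h'h e kh] [<-].
have vE : v = (v - h + h)%MM by rewrite submK.
have de : mdeg h' = mdeg h by apply: kapdeg => //; rewrite e.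
split; first by rewrite [ltRHS]vE ltmc_add2r.
  by rewrite [in RHS]vE !mdegD de.
by rewrite [in RHS]vE; apply: kapD.
Qed.

Lemma reduceN v h : leading v = Some h -> reduce v = None -> kap v = None.
Proof.
case: kapP => kapD kapN kapdeg L; have [hs hv] := leadingP L.
rewrite /reduce L; have := tgtP (s_red hs); case: (tgt h) => [//|] kh _.
by rewrite -(submK hv) kapN.
Qed.

Definition reaches m w := exists j, iter j (obind reduce) (Some m) = Some w.

Lemma reaches0 m : reaches m m. Proof. by exists 0%N. Qed.

Lemma reaches_step m v w : reaches m v -> reduce v = Some w -> reaches m w.
Proof. by move=> [j jE] vw; exists j.+1; rewrite iterS jE. Qed.

Lemma step_reaches m v w : reduce m = Some v -> reaches v w -> reaches m w.
Proof. by move=> mv [j jE]; exists j.+1; rewrite iterSr /= mv. Qed.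

Lemma iter_reduce_lt j m w :
  iter j.+1 (obind reduce) (Some m) = Some w -> (w < m)%O.
Proof.
elim: j w => [|j IH] w; first by move=> /reduceP[].
rewrite iterS; case: (iter _ _ _) IH => [v|//] IH /= /reduceP[wv _ _].
exact: lt_trans wv (IH _ _).
Qed.

Lemma reachesP m w : reaches m w ->
  [/\ (w <= m)%O, mdeg w = mdeg m & kap w = kap m].
Proof.
move=> [j]; elim: j w => [|j IH] w; first by case=> ->.
rewrite iterS; case: (iter _ _ _) IH => [v|//] /(_ _ erefl)[vm vd vk] /=.
by move=> /reduceP[wv wd wk]; split; rewrite ?wd ?wk // ltW // (lt_le_trans wv).
Qed.

Lemma reaches_last m w : reaches m w -> m <> w ->
  exists2 v, reaches m v & reduce v = Some w.
Proof.
move=> [[|j]]; first by case.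
rewrite iterS; case E: (iter _ _ _) => [v|//] /= vw _.
by exists v => //; exists j.
Qed.

Lemma reaches_pred_inj m v v' w : reaches m v -> reaches m v' ->
  reduce v = Some w -> reduce v' = Some w -> v = v'.
Proof.
move=> [i iE] [j jE] vw v'w; wlog ij : i j v v' iE jE vw v'w / (i <= j)%N.
  move=> h; have [ij|/ltnW ji] := leqP i j; first exact: (h i j).
  by apply/esym; apply: (h j i).
move: jE; rewrite -(subnK ij) iterD iE; case: (j - i)%N => [|d]; first by case.
rewrite iterSr /= vw; case: d => [[wv']|d /iter_reduce_lt v'w'].
  by move: v'w; rewrite wv' => /reduceP[]; rewrite ltxx.
by have [/lt_trans /(_ v'w')] := reduceP v'w; rewrite ltxx.
Qed.

Variable f : mfps C n.

(** All coefficients are pushed along the reduction paths of their monomials, and this much passes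
    through [w]. Reduction preserves the degree, so every [d] above the degree of [w] gives the same
    value. *)
Definition flow d w := \sum_(m : 'X_{1..n < d} | `[< reaches m w >]) f m.

Lemma flowE d w : (mdeg w < d)%N ->
  flow d w = f w + \sum_(v : 'X_{1..n < d} | reduce v == Some w) flow d v.
Proof.
move=> wd; pose w' := BMultinom wd.
rewrite /flow (bigD1 w') /=; last by apply/asboolP; exact: reaches0.
congr (_ + _); rewrite (exchange_big_dep xpredT) //=.
rewrite big_mkcond; apply: eq_bigr => m _.
case: ifP => [/andP[/asboolP mw mw']|nmw].
  have [|v mv vw] := reaches_last mw.
    by move=> e; case/eqP: mw'; apply/val_inj.
  have vd : (mdeg v < d)%N.
    by have [_ <- _] := reduceP vw.
  rewrite (big_pred1 (BMultinom vd)) // => u /=; apply/andP/eqP => [[]|->].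
    move=> /eqP uw /asboolP mu; apply/val_inj => /=.
    exact: reaches_pred_inj mu mv uw vw.
  by rewrite vw eqxx; split=> //; apply/asboolP.
rewrite big_pred0 // => u /=; apply/negbTE/negP => /andP[/eqP uw /asboolP mu].
move/negP: nmw; apply; apply/andP; split; first exact/asboolP/(reaches_step mu).
apply/eqP => mw; have [um _ _] := reachesP mu; have [wu _ _] := reduceP uw.
by move: (lt_le_trans wu um); rewrite mw /= ltxx.
Qed.

Hypothesis kf : graded_kernel kap f.

(** The paths of a nonzero class all end at its least monomial, where the flow is therefore the sum
    of the coefficients of [f] on the class. *)
Lemma flow_irreducible d w : leading w = None -> (mdeg w < d)%N -> flow d w = 0.
Proof.
case: kapP => kapD kapN kapdeg lw wd; have nw := leadingN lw.
have kw : kap w <> None by move=> kw; apply: nw; left.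
case E: (kap w) kw => [w0|//] _.
have reachesE m : kap m = kap w -> reaches m w.
  elim/(@ltmwf n): m => m IH kmw; case L: (leading m) => [h|].
    case R: (reduce m) => [v|].
      have [vm _ vk] := reduceP R; apply: step_reaches R _.
      by apply: IH => //; rewrite vk.
    by have := reduceN L R; rewrite kmw E.
  have := leadingN L; case: (ltgtP m w) => [mw|wm|->] nm; last exact: reaches0.
    by case: nw; right; exists m.
  by case: nm; right; exists w.
have := congr1 (fun p => p@_w0) (kf (mdeg w)).
rewrite mcoeff_collapse_hpart mcoeff0 => <-.
rewrite /flow; pose I := 'X_{1..n < d} : subFinType _.
pose J := 'X_{1..n < (mdeg w).+1} : subFinType _.
rewrite [RHS](big_sub_widen J I
  (fun m => (kap m == Some w0) && (mdeg m == mdeg w)) f) /=; last first.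
  by move=> m; rewrite /= => /leq_trans; apply.
apply: eq_big => // m; apply/asboolP/idP => [/reachesP[_ <- <-]|].
  by rewrite E !eqxx ltnS leqnn.
by move=> /andP[/andP[/eqP km _] _]; apply: reachesE; rewrite km E.
Qed.

(** What passes through [u + h] leaves it by the relation of [h], multiplied by the monomial [u],
    provided that [h] is the divisor chosen there. *)
Definition quotient_by (h : 'X_{1..n}) : mfps C n := fun u =>
  if leading (u + h)%MM == Some h then flow (mdeg (u + h)).+1 (u + h)%MM else 0.

Lemma mfps_sumE (I : Type) (r : seq I) (P : pred I) (F : I -> mfps C n) w :
  (\sum_(i <- r | P i) F i) w = \sum_(i <- r | P i) F i w.
Proof. exact: (big_morph (fun g : mfps C n => g w)). Qed.

Lemma mfps_mulX (g : mfps C n) h w :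
  (g * mfps_of_mpoly 'X_[h]) w = if (h <= w)%MM then g (w - h)%MM else 0.
Proof.
rewrite -[LHS]/(mfps_mul g (mfps_of_mpoly 'X_[h]) w) /mfps_mul /mfps_of_mpoly.
case: ifP => hw; last first.
  apply: big1 => m mw; rewrite mcoeffX; case: eqP => [e|_]; last by rewrite mulr0.
  by move: hw; rewrite e lem_subr.
have wd : (mdeg (w - h)%MM < (mdeg w).+1)%N by rewrite ltnS mdegB.
rewrite (bigD1 (BMultinom wd)) /= ?lem_subr // big1 ?addr0 => [|m].
  by rewrite mcoeffX submBA // addmC addmK eqxx mulr1.
move=> /andP[mw mh]; rewrite mcoeffX; case: eqP => [e|_]; last by rewrite mulr0.
case/eqP: mh; apply/val_inj => /=.
by rewrite e submBA // addmC addmK.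
Qed.

Lemma mfps_of_mpolyB (p q : {mpoly C[n]}) :
  mfps_of_mpoly (p - q) = mfps_of_mpoly p - mfps_of_mpoly q.
Proof. by apply/funext => m; rewrite /mfps_of_mpoly mcoeffB. Qed.

Lemma quotient_by_targetE h w : h \in s ->
  (quotient_by h * mfps_of_mpoly (oX C (tgt h))) w =
  \sum_(v : 'X_{1..n < (mdeg w).+1} |
      (leading v == Some h) && (reduce v == Some w)) flow (mdeg w).+1 v.
Proof.
move=> hs; case T: (tgt h) => [h'|]; last first.
  rewrite big_pred0 => [|v].
    have -> : mfps_of_mpoly (oX C None) = 0 :> mfps C n.
      by apply/funext => m; rewrite /mfps_of_mpoly mcoeff0.
    by rewrite mulr0.
  by apply/negbTE/negP => /andP[/eqP L]; rewrite /reduce L T.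
rewrite mfps_mulX.
have redE (v : 'X_{1..n}) : leading v = Some h ->
    reduce v = Some w -> (h' <= w)%MM /\ v = (w - h' + h)%MM.
  move=> L; rewrite /reduce L T => -[<-]; have [_ hv] := leadingP L.
  by rewrite lem_addl addmK submK.
case: ifP => hw; last first.
  rewrite big_pred0 // => v; apply/negbTE/negP => /andP[/eqP L /eqP R].
  by have [] := redE _ L R; rewrite hw.
rewrite /quotient_by; case: eqP => L; last first.
  rewrite big_pred0 // => v; apply/negbTE/negP => /andP[/eqP L' /eqP R].
  by have [_ e] := redE _ L' R; apply: L; rewrite -e.
have R : reduce (w - h' + h)%MM = Some w.
  by rewrite /reduce L T /= addmK submK.
have [_ dw _] := reduceP R; rewrite -dw.
have vd : (mdeg (w - h' + h)%MM < (mdeg w).+1)%N by rewrite dw.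
rewrite (big_pred1 (BMultinom vd)) // => v /=; apply/andP/eqP => [[/eqP L' /eqP R']|->].
  by apply/val_inj => /=; have [] := redE _ L' R'.
by rewrite /= L R !eqxx.
Qed.

(** At each monomial the right-hand side is the outgoing minus the incoming flow, which is the
    coefficient of [f] by [flowE]. Nothing leaves an irreducible monomial, but there the flow is
    0. *)
Lemma division_identity :
  f = \sum_(h <- undup s)
    quotient_by h * mfps_of_mpoly ('X_[h] - oX C (tgt h)).
Proof.
apply/funext => w; rewrite mfps_sumE.
under eq_bigr => h _ do rewrite mfps_of_mpolyB mulrBr.
rewrite [RHS](eq_bigr (fun h => (quotient_by h * mfps_of_mpoly 'X_[h]) w -
  (quotient_by h * mfps_of_mpoly (oX C (tgt h))) w)) // sumrB.
set D := (mdeg w).+1.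
have -> : \sum_(h <- undup s) (quotient_by h * mfps_of_mpoly 'X_[h]) w = flow D w.
  under eq_bigr => h _ do rewrite mfps_mulX /quotient_by.
  case L: (leading w) => [h|]; last first.
    rewrite flow_irreducible //; apply: big1 => h _; case: ifP => // hw.
    by rewrite submK // L.
  have [hs hw] := leadingP L; rewrite (bigD1_seq h) ?mem_undup ?undup_uniq //=.
  rewrite hw submK // L eqxx big1 ?addr0 // => h1 h1h; case: ifP => // h1w.
  by rewrite submK // L; case: eqP => // -[e]; rewrite e eqxx in h1h.
rewrite flowE ?ltnSn // -addrA -[LHS]addr0; congr (_ + _).
apply/esym/eqP; rewrite subr_eq0; apply/eqP.
transitivity (\sum_(v : 'X_{1..n < D} | reduce v == Some w)
    \sum_(h <- undup s | leading v == Some h) flow D v).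
  apply: eq_bigr => v /eqP R.
  have [h L] : exists h, leading v = Some h.
    by move: R; rewrite /reduce; case: (leading v) => [h|//] _; exists h.
  have [hs _] := leadingP L; rewrite big_mkcond (bigD1_seq h) ?mem_undup ?undup_uniq //=.
  rewrite L eqxx big1 ?addr0 // => h1 h1h; case: eqP => // -[e].
  by rewrite e eqxx in h1h.
rewrite (exchange_big_dep xpredT) //=; apply: eq_big_seq => h.
rewrite mem_undup => hs; rewrite quotient_by_targetE //.
by apply: eq_bigl => v; rewrite andbC.
Qed.

Lemma flow_norm_le d w : `|flow d w| <=
  \sum_(m : 'X_{1..n < d} | mdeg m == mdeg w) `|f m|.
Proof.
apply: le_trans (ler_norm_sum _ _ _) _.
rewrite [leLHS]big_mkcond [leRHS]big_mkcond; apply: ler_sum => m _.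
case: asboolP => [/reachesP[_ -> _]|_]; first by rewrite eqxx.
by case: ifP.
Qed.

Hypothesis f_cvg : mfps_cvg f.

(** A flow is at most the sum of the absolute values of the coefficients of [f] in its degree, so
    the radius of [f] still works: the bound is just divided by [r ^+ mdeg h]. *)
Lemma quotient_by_cvg h : mfps_cvg (quotient_by h).
Proof.
have [r [M [r0 fM]]] := f_cvg.
have M0 : 0 <= M by apply: le_trans (fM 0%N); rewrite big1 // => m _; case: m.
have flowM d w : `|flow d w| * r ^+ mdeg w <= M.
  apply: le_trans (fM d).
  apply: (@le_trans _ _ (\sum_(m : 'X_{1..n < d} | mdeg m == mdeg w)
      `|f m| * r ^+ mdeg m)).
    rewrite (eq_bigr (fun m : 'X_{1..n < d} => `|f m| * r ^+ mdeg w)).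
      by rewrite -mulr_suml ler_wpM2r ?exprn_ge0 ?(ltW r0) // flow_norm_le.
    by move=> m /eqP ->.
  rewrite [leLHS]big_mkcond; apply: ler_sum => m _; case: ifP => // _.
  by rewrite mulr_ge0 // exprn_ge0 // ltW.
apply/mfps_cvgP; exists r, (M / r ^+ mdeg h); split=> // u.
rewrite ler_pdivlMr ?exprn_gt0 // -mulrA -exprD -mdegD /quotient_by.
by case: eqP => // _; rewrite normr0 mul0r.
Qed.

End Division.

Definition congruence_relations (C : comNzRingType) n k
    (kap : 'X_{1..n} -> option 'X_{1..k}) : set {mpoly C[n]} :=
  [set g | exists m o, (if o is Some m' then kap m' = kap m else kap m = None)
     /\ g = 'X_[m] - oX C o].

Theorem graded_kernel_extended (C : numFieldType) n k
    (kap : 'X_{1..n} -> option 'X_{1..k}) (x : local_ring C n) :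
  graded_congruence kap -> graded_kernel kap x ->
  extended_ideal (congruence_relations kap) x.
Proof.
move=> kapP kx; have [s [s_red s_basis]] := dickson (reducible kap).
have [tgt tgtP] := choice (target_exists kap).
have xcvg : mfps_cvg x by have := series_of_cvg x; rewrite unfold_in => /asboolP.
have qcvg h : quotient_by s tgt x h \in @cvg_series C n.
  rewrite unfold_in; apply/asboolP.
  exact: (quotient_by_cvg kapP s_red tgtP xcvg).
pose q h := LocalRing (qcvg h).
exists [seq (q h, of_mpoly ('X_[h] - oX C (tgt h))) | h <- undup s]; split.
  move=> c /mapP[h]; rewrite mem_undup => hs ->; exists ('X_[h] - oX C (tgt h)) => //.
  exists h, (tgt h); split=> //; have := tgtP _ (s_red _ hs).
  by case: (tgt h) => [h'[]|].
rewrite big_map; apply/val_inj => /=.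
rewrite [LHS](division_identity kapP s_red s_basis tgtP kx).
by rewrite (big_morph (@series_of C n) (id1 := 0) (op1 := +%R)).
Qed.

(** * Primes avoiding the powers of an element *)

Section PrimeAvoidance.
Variables (A : comNzRingType) (I : idealr A) (x : A).

Let avoiding (X : set A) : Prop := [/\ [set u | u \in I] `<=` X,
  forall a u v, X u -> X v -> X (a * u + v) & forall k, ~ X (x ^+ k)].

Lemma prime_avoidance : (forall k, x ^+ k \notin I) ->
  exists P : prime_idealr A, {subset I <= P} /\ x \notin P.
Proof.
move=> xI; have [X [[X0|XP] Xmax]] : exists X, (X = set0 \/ avoiding X) /\
    forall Y, X `<` Y -> ~ (Y = set0 \/ avoiding Y).
- apply: Zorn_bigcup => F FP Ftot.
  have [[Y FY Y0]|F0] := pselect (exists2 Y, F Y & Y !=set0); last first.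
    left; apply/seteqP; split=> // u [Y FY Yu].
    by case: F0; exists Y => //; exists u.
  have good Z u : F Z -> Z u -> avoiding Z.
    by move=> FZ Zu; have [Z0|//] := FP _ FZ; rewrite Z0 in Zu.
  right; split.
  + by move=> u Iu; have [w Yw] := Y0; have [IY _ _] := good _ _ FY Yw; exists Y => //; apply: IY.
  + move=> a u v [U FU Uu] [V FV Vv].
    have [UV|VU] := Ftot _ _ FU FV.
      have [_ h _] := good _ _ FV Vv; exists V => //; apply: h => //; exact: UV.
    have [_ h _] := good _ _ FU Uu; exists U => //; apply: h => //; exact: VU.
  + move=> k [Z FZ Zx]; have [_ _ h] := good _ _ FZ Zx; exact: h Zx.
- case: (Xmax [set u | u \in I]); first rewrite X0.
    split=> // /(_ 0); apply; exact: idealr0.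
  right; split=> //= [a u v uI vI|k]; first by rewrite rpredD // idealMr.
  by apply/negP.
have [IX XD Xx] := XP.
pose S : {pred A} := fun u => `[< X u >].
have X0 : X 0 by apply: IX; exact: idealr0.
have XM a u : X u -> X (a * u) by move=> Xu; rewrite -[_ * _]addr0; apply: XD.
(* By maximality, the ideal generated by [X] and [u] contains a power of [x]. *)
have extend u : ~ X u -> exists k, exists2 a, X (x ^+ k - a * u) & True.
  move=> Xu; apply: contrapT => no.
  apply: (Xmax [set w | exists a, X (w - a * u)]).
    split=> [w Xw|sub]; first by exists 0; rewrite mul0r subr0.
    by apply: Xu; apply: sub; exists 1; rewrite mul1r subrr.
  right; split=> [w /IX Xw|a v w [b Xv] [c Xw]|k [a Xa]].
  - by exists 0; rewrite mul0r subr0.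
  - exists (a * b + c).
    by rewrite mulrDl opprD addrACA -mulrA -mulrBr; apply: XD.
  - by apply: no; exists k, a.
have Sclosed : idealr_closed S.
  split=> [||a u v /asboolP Xu /asboolP Xv]; apply/asboolP => //.
    by rewrite -(expr0 x); exact: Xx.
  exact: XD.
have Sprime : prime_idealr_closed S.
  move=> u v /asboolP Xuv; apply: contraT; rewrite negb_or => /andP[/asboolPn Xu /asboolPn Xv].
  exfalso.
  have [k [a Xa _]] := extend _ Xu; have [l [b Xb _]] := extend _ Xv.
  apply: (Xx (k + l)%N); rewrite exprD.
  have -> : x ^+ k * x ^+ l = x ^+ l * (x ^+ k - a * u) + (a * u * (x ^+ l - b * v)
      + a * b * (u * v)).
    by rewrite !mulrBr [x ^+ l * x ^+ k]mulrC [a * u * (b * v)]mulrACA addrNK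
       [x ^+ l * (a * u)]mulrC addrNK.
  by apply: (XD _ _ _ Xa); apply: (XD _ _ _ Xb); exact: XM.
pose P : prime_idealr A := HB.pack S (isIdealr.Build A S Sclosed)
  (isPrimeIdealrClosed.Build A S Sprime).
exists P; split=> [u uI|]; first by apply/asboolP; exact: IX.
by apply/asboolPn; rewrite -(expr1 x); exact: Xx.
Qed.

End PrimeAvoidance.

Lemma quot_eq0 (A : comNzRingType) (I : idealr A) (x : A) :
  ((\pi_{ideal_quot I} x)%qT == 0) = (x \in I).
Proof.
rewrite -[0 in LHS](@rmorph0 _ _ (\pi_{ideal_quot I})%qT).
by rewrite -Quotient.idealrBE subr0.
Qed.

(** * Generators of ideals in the local ring *)

Section IdealSpan.
Variables (A : comNzRingType) (G : set A).

Lemma ideal_span_gen g : G g -> ideal_span G g.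
Proof.
move=> Gg; exists [:: (1, g)]; split=> [c|]; first by rewrite inE => /eqP ->.
by rewrite big_seq1 mul1r.
Qed.

Lemma ideal_spanD x y : ideal_span G x -> ideal_span G y -> ideal_span G (x + y).
Proof.
move=> [s [sG ->]] [t [tG ->]]; exists (s ++ t); split=> [c|].
  by rewrite mem_cat => /orP[/sG|/tG].
by rewrite big_cat.
Qed.

Lemma ideal_span_mull a x : ideal_span G x -> ideal_span G (a * x).
Proof.
move=> [s [sG ->]]; exists [seq (a * c.1, c.2) | c <- s]; split=> [c|].
  by move=> /mapP[e /sG Ge ->].
by rewrite big_map mulr_sumr; apply: eq_bigr => c _; rewrite mulrA.
Qed.

Lemma ideal_span0 : ideal_span G 0.
Proof. by exists [::]; split=> //; rewrite big_nil. Qed.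

Lemma ideal_spanN x : ideal_span G x -> ideal_span G (- x).
Proof. by rewrite -mulN1r; exact: ideal_span_mull. Qed.

Lemma ideal_span_le (J : set A) : J 0 -> (forall x y, J x -> J y -> J (x + y)) ->
  (forall a x, J x -> J (a * x)) -> G `<=` J -> ideal_span G `<=` J.
Proof.
move=> J0 JD JM GJ _ [s [sG ->]].
elim: s sG => [|c s IH] sG; first by rewrite big_nil.
rewrite big_cons; apply: JD; first by apply/JM/GJ/sG; rewrite inE eqxx.
by apply: IH => e es; apply: sG; rewrite inE es orbT.
Qed.

End IdealSpan.

Section OfMpoly.
Variables (C : numFieldType) (n : nat).

Lemma of_mpoly_is_zmod_morphism : zmod_morphism (@of_mpoly C n).
Proof. by move=> p q; apply/val_inj/funext => m; rewrite /= /mfps_of_mpoly mcoeffB. Qed.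

Lemma of_mpoly_is_monoid_morphism : monoid_morphism (@of_mpoly C n).
Proof.
split=> [|p q]; apply/val_inj/funext => m; first by rewrite /= /mfps_of_mpoly mcoeff1.
by apply/esym; apply: mfps_mulE.
Qed.

HB.instance Definition _ := GRing.isZmodMorphism.Build _ _ (@of_mpoly C n)
  of_mpoly_is_zmod_morphism.
HB.instance Definition _ := GRing.isMonoidMorphism.Build _ _ (@of_mpoly C n)
  of_mpoly_is_monoid_morphism.

Lemma extended_ideal_gen (G : set {mpoly C[n]}) g :
  G g -> extended_ideal G (of_mpoly g).
Proof. by move=> Gg; apply: ideal_span_gen; exists g. Qed.

Lemma extended_ideal_le (G : set {mpoly C[n]}) (J : set (local_ring C n)) :
  J 0 -> (forall x y, J x -> J y -> J (x + y)) ->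
  (forall a x, J x -> J (a * x)) -> (forall g, G g -> J (of_mpoly g)) ->
  extended_ideal G `<=` J.
Proof. by move=> J0 JD JM GJ; apply: ideal_span_le => // _ [g /GJ ? <-]. Qed.

Variables (k : nat) (kap : 'X_{1..n} -> option 'X_{1..k}).
Hypothesis kapP : graded_congruence kap.

Lemma hpart_mpolyX d (m : 'X_{1..n}) :
  hpart d (mfps_of_mpoly 'X_[m]) = if mdeg m == d then 'X_[m] else 0 :> {mpoly C[n]}.
Proof.
apply/mpolyP => u; rewrite mcoeff_hpart /mfps_of_mpoly mcoeffX.
have [->|mu] := eqVneq m u; first by case: ifP; rewrite ?mcoeff0 // mcoeffX eqxx.
by case: ifP; case: ifP; rewrite ?mcoeff0 // mcoeffX (negbTE mu).
Qed.

Lemma graded_kernel_relation g : congruence_relations kap g ->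
  graded_kernel kap (mfps_of_mpoly g : mfps C n).
Proof.
move=> [m [o [mo ->]]] d; rewrite mfps_of_mpolyB.
rewrite (raddfB (hpart d)) [LHS](raddfB (collapse kap)) /= hpart_mpolyX.
have kX u : collapse kap (if mdeg u == d then 'X_[u] else 0 : {mpoly C[n]}) =
    if mdeg u == d then oX C (kap u) else 0.
  by case: ifP => _; [rewrite collapseX|exact: raddf0].
case: o mo => [m'|] mo /=.
  rewrite hpart_mpolyX !kX mo; case E: (kap m) => [w|]; last by rewrite !if_same subrr.
  by case: kapP => _ _ kd; rewrite (kd m' m) ?mo ?E // subrr.
rewrite kX mo if_same; have -> : mfps_of_mpoly 0 = 0 :> mfps C n.
  by apply/funext => u; rewrite /mfps_of_mpoly mcoeff0.
by rewrite raddf0 raddf0 subrr.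
Qed.

Lemma graded_kernelP (x : local_ring C n) :
  graded_kernel kap x <-> extended_ideal (congruence_relations kap) x.
Proof.
split; first exact: graded_kernel_extended.
move: x; apply: (@extended_ideal_le _ (fun x : local_ring C n => graded_kernel kap x)).
- by move=> d; rewrite /= raddf0 [LHS]raddf0.
- by move=> x y; exact: graded_kernelD.
- by move=> a x; exact: graded_kernel_mull.
- exact: graded_kernel_relation.
Qed.

End OfMpoly.

Section ToricPrime.
Variables (C : numFieldType) (n k : nat) (kap : 'X_{1..n} -> option 'X_{1..k}).
Hypothesis kapP : graded_congruence kap.
Hypothesis kapD : forall m m', kap (m + m')%MM = add_option (kap m) (kap m').
Hypothesis kap0 : kap 0%MM = Some 0%MM.

Lemma graded_kernel_prime_ideal : exists P : prime_idealr (local_ring C n),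
  forall x : local_ring C n, x \in P <-> graded_kernel kap x.
Proof.
pose S : {pred local_ring C n} := fun x => `[< graded_kernel kap x >].
have Sclosed : idealr_closed S.
  split=> [||a u v /asboolP Xu /asboolP Xv]; apply/asboolP.
  - by move=> d; rewrite /= raddf0 [LHS]raddf0.
  - move=> /(_ 0%N); have -> : hpart 0 (1 : local_ring C n) = 'X_[0%MM].
      have e : (1 : mfps C n) = mfps_of_mpoly 'X_[0%MM].
        by apply/funext => m; rewrite /mfps_of_mpoly mpolyX0 mcoeff1.
      by rewrite -[LHS]/(hpart 0 (1 : mfps C n)) e hpart_mpolyX mdeg0 eqxx.
    rewrite collapseX kap0 => /(congr1 (fun p => p@_0%MM)) /eqP.
    by rewrite mcoeffX mcoeff0 eqxx oner_eq0.
  - by apply: graded_kernelD => //; exact: graded_kernel_mull.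
have Sprime : prime_idealr_closed S.
  move=> u v /asboolP /(graded_kernel_prime kapD)[h|h]; apply/orP.
    by left; apply/asboolP.
  by right; apply/asboolP.
pose P : prime_idealr (local_ring C n) := HB.pack S (isIdealr.Build _ S Sclosed)
  (isPrimeIdealrClosed.Build _ S Sprime).
by exists P => x; split=> [/asboolP|h] //; apply/asboolP.
Qed.

End ToricPrime.

(** * Rewriting of monomials and radical binomial ideals *)

Section Rewriting.
Variable n : nat.
Variables (R : seq ('X_{1..n} * 'X_{1..n})) (wt : 'X_{1..n} -> nat).
Implicit Types (m u z : 'X_{1..n}).

Definition rewrite_step m m' := exists r u,
  [/\ r \in R, m = (u + r.1)%MM & m' = (u + r.2)%MM].

Inductive rewrites m : 'X_{1..n} -> Prop :=
| rewrites_refl : rewrites m m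
| rewrites_trans m1 m2 : rewrite_step m m1 -> rewrites m1 m2 -> rewrites m m2.

Definition normal m := forall r, r \in R -> ~~ (r.1 <= m)%MM.

(** The two monomials come from [mlcm r1.1 r2.1] by applying one rule or the other. *)
Definition critical_pairs_join := forall r1 r2, r1 \in R -> r2 \in R -> exists z,
  rewrites (r2.1 - r1.1 + r1.2)%MM z /\ rewrites (r1.1 - r2.1 + r2.2)%MM z.

Hypothesis wtD : forall m m', wt (m + m')%MM = (wt m + wt m')%N.
Hypothesis R_wt : forall r, r \in R -> (wt r.2 < wt r.1)%N.
Hypothesis R_deg : forall r, r \in R -> mdeg r.2 = mdeg r.1.
Hypothesis R_join : critical_pairs_join.

Lemma rewrites_addl u m m' : rewrites m m' -> rewrites (u + m)%MM (u + m')%MM.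
Proof.
elim=> [m1|m1 m2 m3 [r [v [rR -> ->]]] _ IH]; first exact: rewrites_refl.
by apply: rewrites_trans IH; exists r, (u + v)%MM; rewrite !addmA.
Qed.

Lemma rewrites_cat m1 m2 m3 : rewrites m1 m2 -> rewrites m2 m3 -> rewrites m1 m3.
Proof. by elim=> // m m' m'' mm' _ IH /IH; exact: rewrites_trans. Qed.

Lemma rewrite_step_wt m m' : rewrite_step m m' -> (wt m' < wt m)%N.
Proof. by move=> [r [u [rR -> ->]]]; rewrite !wtD ltn_add2l R_wt. Qed.

Lemma rewrites_wt m m' : rewrites m m' -> m = m' \/ (wt m' < wt m)%N.
Proof.
elim=> [|m1 m2 m3 /rewrite_step_wt lt _ [<-|lt']]; [by left|by right|].
by right; apply: ltn_trans lt.
Qed.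

Lemma rewrites_deg m m' : rewrites m m' -> mdeg m' = mdeg m.
Proof.
by elim=> // m1 m2 m3 [r [u [rR -> ->]]] _ ->; rewrite !mdegD R_deg.
Qed.

Lemma normalP m : normal m <-> forall m', ~ rewrite_step m m'.
Proof.
split=> [nm m' [r [u [rR e _]]]|nm r rR].
  by move: (nm _ rR); rewrite e lem_addl.
by apply/negP => rm; apply: (nm (m - r.1 + r.2)%MM); exists r, (m - r.1)%MM; rewrite submK.
Qed.

Lemma normal_exists m : exists z, rewrites m z /\ normal z.
Proof.
have [k] := ubnP (wt m); elim: k m => // k IH m mk.
have [nm|nm] := pselect (normal m); first by exists m; split=> //; exact: rewrites_refl.
have [m' mm'] : exists m', rewrite_step m m'.
  by apply: contrapT => no; apply: nm; apply/normalP => m' mm'; apply: no; exists m'.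
have [|z [m'z nz]] := IH m'; first exact: leq_trans (rewrite_step_wt mm') mk.
by exists z; split=> //; exact: rewrites_trans m'z.
Qed.

Lemma mnm_lcm_split m u1 u2 h1 h2 : m = (u1 + h1)%MM -> m = (u2 + h2)%MM ->
  exists v, u1 = (v + (h2 - h1))%MM /\ u2 = (v + (h1 - h2))%MM.
Proof.
move=> e1 e2; exists (m - mlcm h1 h2)%MM.
have le1 : (h1 <= m)%MM by rewrite e1 lem_addl.
have le2 : (h2 <= m)%MM by rewrite e2 lem_addl.
have -> : u1 = (m - h1)%MM by rewrite e1 addmK.
have -> : u2 = (m - h2)%MM by rewrite e2 addmK.
by split; apply/mnmP => i; rewrite !(mnmDE, mnmBE, mnmE);
  have := mnm_lepP le1 i; have := mnm_lepP le2 i; lia.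
Qed.

(** Newman's lemma, by induction on the weight: two diverging steps are a multiple of a critical
    pair, and the multiple of its common reduct has a normal form [z0] to which both sides are
    compared. *)
Lemma normal_unique m z z' : rewrites m z -> normal z -> rewrites m z' ->
  normal z' -> z = z'.
Proof.
have [k] := ubnP (wt m); elim: k m z z' => // k IH m z z' mk.
case=> [|m1 {}z s1 m1z] nz; case=> [|m2 {}z' s2 m2z'] nz' //.
- by have /normalP/(_ _ s2) := nz.
- by have /normalP/(_ _ s1) := nz'.
have wk m' : rewrite_step m m' -> (wt m' < k)%N.
  by move=> /rewrite_step_wt h; apply: leq_trans h mk.
have := (wk _ s1, wk _ s2).
case: s1 s2 m1z m2z' => [r1 [u1 [R1 e1 ->]]] [r2 [u2 [R2 e2 ->]]] m1z m2z' [w1 w2].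
have [v [v1 v2]] := mnm_lcm_split e1 e2.
have [t [t1 t2]] := R_join R1 R2.
have [z0 [tz0 nz0]] := normal_exists (v + t)%MM.
transitivity z0.
  apply: (IH _ _ _ w1 m1z nz) => //; rewrite v1 -addmA.
  exact: rewrites_cat (rewrites_addl v t1) tz0.
apply: (IH _ _ _ w2 _ nz0 m2z' nz'); rewrite v2 -addmA.
exact: rewrites_cat (rewrites_addl v t2) tz0.
Qed.

Definition nf m : 'X_{1..n} := projT1 (cid (normal_exists m)).

Lemma nf_rewrites m : rewrites m (nf m).
Proof. by rewrite /nf; case: cid => z []. Qed.

Lemma nf_normal m : normal (nf m).
Proof. by rewrite /nf; case: cid => z []. Qed.

Lemma rewrites_nf m m' : rewrites m m' -> nf m = nf m'.
Proof.
move=> mm'; apply: (normal_unique (nf_rewrites m) (@nf_normal m)) (@nf_normal m').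
exact: rewrites_cat mm' (nf_rewrites m').
Qed.

Lemma join_nf m m' z : rewrites m z -> rewrites m' z -> nf m = nf m'.
Proof. by move=> /rewrites_nf -> /rewrites_nf ->. Qed.

Lemma nf_id m : normal m -> nf m = m.
Proof.
move=> nm; apply/esym.
exact: (normal_unique (rewrites_refl m) nm (nf_rewrites m) (@nf_normal m)).
Qed.

Lemma nf_nf m : nf (nf m) = nf m.
Proof. by rewrite nf_id //; exact: nf_normal. Qed.

Lemma nf_addr u m : nf (u + nf m)%MM = nf (u + m)%MM.
Proof. by apply/esym/rewrites_nf/rewrites_addl/nf_rewrites. Qed.

Lemma nf_wt m : (wt (nf m) <= wt m)%N.
Proof. by case: (rewrites_wt (nf_rewrites m)) => [<-|/ltnW]. Qed.

Lemma nf_wt_eq m : wt (nf m) = wt m -> nf m = m.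
Proof. by case: (rewrites_wt (nf_rewrites m)) => [<-|] // + e; rewrite e ltnn. Qed.

Definition nf_class m := Some (nf m).

Lemma nf_graded_congruence : graded_congruence nf_class.
Proof.
split=> // [u m m' [e]|m m' [e] _].
  by rewrite /nf_class -nf_addr e nf_addr.
by rewrite -(rewrites_deg (nf_rewrites m)) e (rewrites_deg (nf_rewrites m')).
Qed.

Section NormalPolynomials.
Variable C : numFieldType.
Implicit Types (p q : {mpoly C[n]}).
Local Notation Lam := (@collapse C n n nf_class).

Lemma collapse_normal p m : m \in msupp (Lam p) -> normal m.
Proof.
move=> mp; apply: contrapT => nm; move: mp; rewrite mcoeff_msupp.
rewrite (mcoeff_collapse _ _ (leqnn _)) big_pred0 ?eqxx // => m'.
by apply/negbTE/negP => /eqP[e]; apply: nm; rewrite -e; exact: nf_normal.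
Qed.

Lemma collapse_comp k (kap' : 'X_{1..n} -> option 'X_{1..k}) p :
  (forall m, kap' (nf m) = kap' m) -> collapse kap' (Lam p) = collapse kap' p.
Proof.
move=> kapE; rewrite [p]mpolyE [X in collapse _ X = _]linear_sum.
rewrite [LHS]linear_sum [RHS]linear_sum; apply: eq_bigr => m _.
rewrite /= [X in collapse _ X = _]linearZ [LHS]linearZ [RHS]linearZ /= !collapseX.
by rewrite kapE.
Qed.

Lemma collapse_sq p : Lam (p * p) = 0 -> Lam (Lam p * Lam p) = 0.
Proof.
have kP := nf_graded_congruence.
have d0 : Lam (Lam p - p) = 0.
  rewrite [LHS]raddfB /= collapse_comp ?subrr // => m.
  by rewrite /nf_class nf_nf.
move=> pp0; have -> : Lam p * Lam p =
    (Lam p) * (Lam p - p) + (p * (Lam p - p) + p * p).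
  by rewrite !mulrBr addrNK [p * _]mulrC addrNK.
rewrite [LHS]raddfD /= collapse_mull // add0r [LHS]raddfD /=.
by rewrite collapse_mull // add0r.
Qed.

Lemma leading_monomial q : q != 0 -> exists2 l, l \in msupp q &
  forall m, m \in msupp q ->
    (wt m <= wt l)%N /\ (wt m = wt l -> (m <= l)%O).
Proof.
move=> q0; have : msupp q != [::] by rewrite msupp_eq0.
elim: (msupp q) => // a s IH _; have [->|/IH[l ls lmax]] := eqVneq s [::].
  by exists a; rewrite ?inE // => m; rewrite inE => /eqP ->.
case: (ltngtP (wt a) (wt l)) => [al|la|e].
- exists l => [|m]; rewrite inE ?ls ?orbT // => /orP[/eqP ->|/lmax //].
  by split; [exact: ltnW|move=> e; rewrite e ltnn in al].
- exists a => [|m]; rewrite inE ?eqxx // => /orP[/eqP -> //|/lmax[ml _]].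
  have ma := leq_ltn_trans ml la; split; first exact: ltnW.
  by move=> e; rewrite e ltnn in ma.
case: (leP a l) => [al|/ltW la].
  by exists l => [|m]; rewrite inE ?ls ?orbT // => /orP[/eqP ->|/lmax //]; rewrite e.
exists a => [|m]; rewrite inE ?eqxx // => /orP[/eqP -> //|/lmax[ml mle]].
by rewrite e; split=> // /mle h; exact: le_trans la.
Qed.

Section Leading.
Variables (q : {mpoly C[n]}) (l : 'X_{1..n}).
Hypothesis lq : l \in msupp q.
Hypothesis lmax : forall m, m \in msupp q ->
    (wt m <= wt l)%N /\ (wt m = wt l -> (m <= l)%O).

(** Reduction lowers the weight of everything it changes. Hence another monomial [m] of [q] cannot
    contribute to [u + l]: its weight would have to be that of [l], and then [u + m] would be its
    own normal form. *)
Lemma leading_shift u : normal (u + l)%MM -> Lam ('X_[u] * q) != 0.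
Proof.
move=> nul; apply/eqP => /(congr1 (fun p => p@_(u + l)%MM)) /eqP.
rewrite [q in X in X == _]mpolyE mulr_sumr [Lam _]linear_sum raddf_sum mcoeff0 /=.
rewrite (bigD1_seq l) ?msupp_uniq //= big_seq_cond big1 ?addr0 => [|m].
  rewrite -scalerAr -mpolyXD linearZ /= collapseX /= nf_id //.
  by rewrite mcoeffZ mcoeffX eqxx mulr1 mcoeff_eq0 lq.
move=> /andP[/lmax[ml _] ml'].
rewrite -scalerAr -mpolyXD linearZ /= collapseX /= mcoeffZ mcoeffX.
case: eqP => [e|_]; last by rewrite mulr0.
have := nf_wt (u + m)%MM; rewrite e !wtD leq_add2l => lm.
have wE : wt m = wt l by apply/eqP; rewrite eqn_leq ml lm.
have wE' : wt (nf (u + m)%MM) = wt (u + m)%MM by rewrite e !wtD wE.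
move: e; rewrite (nf_wt_eq wE') => /addmI e.
by rewrite e eqxx in ml'.
Qed.

Lemma leading_sq : normal (l + l)%MM -> Lam (q * q) != 0.
Proof.
move=> nul; apply/eqP => /(congr1 (fun p => p@_(l + l)%MM)) /eqP.
rewrite [q]mpolyE mulr_suml [Lam _]linear_sum raddf_sum mcoeff0 /= -mpolyE.
have termE a b : a \in msupp q -> b \in msupp q ->
    (Lam ((q@_a *: 'X_[a]) * (q@_b *: 'X_[b])))@_(l + l)%MM =
    if (a == l) && (b == l) then q@_l ^+ 2 else 0.
  move=> /lmax[al al'] /lmax[bl bl'].
  rewrite -scalerAl -scalerAr scalerA -mpolyXD linearZ /= collapseX /=.
  rewrite mcoeffZ mcoeffX; case: ifP => [/andP[/eqP -> /eqP ->]|ab].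
    by rewrite nf_id // eqxx mulr1 expr2.
  case: eqP => [e|_]; last by rewrite mulr0.
  have := nf_wt (a + b)%MM; rewrite e !wtD => lab.
  have [wa wb] : wt a = wt l /\ wt b = wt l.
    by move: al bl lab; lia.
  have wE : wt (nf (a + b)%MM) = wt (a + b)%MM by rewrite e !wtD wa wb.
  move: e; rewrite (nf_wt_eq wE) => e.
  (* With equal weights the monomial order decides: [a = l] forces [b = l], and [a < l] gives
     [a + b < l + l]. *)
  move: (al' wa) (bl' wb); rewrite le_eqVlt => /predU1P[aE|lt] ble.
    by move: e ab; rewrite aE eqxx => /addmI ->; rewrite eqxx.
  by have := ltmc_le_add lt ble; rewrite e ltxx.
rewrite big_seq (eq_bigr (fun a => if a == l then q@_l ^+ 2 else 0)).
  rewrite -big_seq (bigD1_seq l) ?msupp_uniq //= eqxx big1 ?addr0.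
    by rewrite expf_eq0 /= mcoeff_eq0 lq.
  by move=> a /negbTE ->.
move=> a aq; rewrite [q in X in X = _]mpolyE mulr_sumr [Lam _]linear_sum raddf_sum /=.
rewrite -mpolyE (bigD1_seq l) ?msupp_uniq //= big_seq_cond big1 ?addr0.
  by rewrite termE // eqxx andbT.
by move=> b /andP[bq bl]; rewrite termE // (negbTE bl) andbF.
Qed.

End Leading.

(* With squarefree rules, the square of a normal monomial is again normal. *)
Lemma squarefree_radical p :
  (forall r, r \in R -> forall i, (r.1 i <= 1)%N) -> Lam (p * p) = 0 -> Lam p = 0.
Proof.
move=> sqf pp0; apply/eqP; apply: contraT => /leading_monomial[l lq lmax].
have nl := collapse_normal lq.
suff n2 : normal (l + l)%MM.
  by have := leading_sq lq lmax n2; rewrite collapse_sq // eqxx.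
move=> r rR; apply: contra (nl r rR) => /mnm_lepP rl; apply/mnm_lepP => i.
move: (rl i) (sqf r rR i); rewrite mnmDE; case: (l i) => [//|k] _ h.
exact: leq_trans h _.
Qed.

End NormalPolynomials.
End Rewriting.

Section Radical.
Variables (n : nat) (C : numFieldType).
Variables (R : seq ('X_{1..n} * 'X_{1..n})) (wt : 'X_{1..n} -> nat).
Hypothesis wtD : forall m m', wt (m + m')%MM = (wt m + wt m')%N.
Hypothesis R_wt : forall r, r \in R -> (wt r.2 < wt r.1)%N.
Hypothesis R_deg : forall r, r \in R -> mdeg r.2 = mdeg r.1.
Hypothesis R_join : critical_pairs_join R.
Local Notation nf1 := (nf wtD R_wt).

Variable Y : seq 'I_n.
Variables (S : 'I_n -> seq ('X_{1..n} * 'X_{1..n})) (wt' : 'I_n -> 'X_{1..n} -> nat).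
Hypothesis wtD' : forall y m m', wt' y (m + m')%MM = (wt' y m + wt' y m')%N.
Hypothesis S_wt : forall y r, y \in Y -> r \in S y -> (wt' y r.2 < wt' y r.1)%N.
Hypothesis S_deg : forall y r, y \in Y -> r \in S y -> mdeg r.2 = mdeg r.1.
Hypothesis S_join : forall y, y \in Y -> critical_pairs_join (S y).

Hypothesis S_sqf : forall y r, y \in Y -> r \in S y -> forall i, (r.1 i <= 1)%N.
Hypothesis R_sqf : forall r, r \in R ->
  (forall i, (r.1 i <= 1)%N) \/ (exists2 y, y \in Y & (0 < r.1 y)%N).
Hypothesis R_Y : forall r y, r \in R -> y \in Y -> (r.1 y <= 1)%N.
Hypothesis S_colon : forall y r, y \in Y -> r \in S y ->
  nf1 (U_(y) + r.1)%MM = nf1 (U_(y) + r.2)%MM.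
Hypothesis S_R : forall y r, y \in Y -> r \in R -> exists z,
  rewrites (S y) r.1 z /\ rewrites (S y) r.2 z.

(* [S y] presents the colon ideal [(I : x_y)], which is radical since its
   initial ideal is squarefree. If [p ^ 2] is in [I] then [x_y p] is in [I]; but
   [x_y] times the leading normal monomial of [p] stays normal for some [y]. *)
Lemma colon_radical p : collapse (nf_class wtD R_wt) (p * p) = 0 ->
  collapse (nf_class wtD R_wt) p = 0 :> {mpoly C[n]}.
Proof.
move=> pp0; apply/eqP; apply: contraT => q0.
have [l lq lmax] := leading_monomial wt q0.
have nl := collapse_normal lq.
(* If no [y] divides [l], a left-hand side dividing [l + l] is squarefree, hence divides [l], and
   the squarefree argument applies directly. *)
have [[y yY ly]|noY] := pselect (exists2 y, y \in Y & (0 < l y)%N); last first.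
  suff n2 : normal R (l + l)%MM.
    have := leading_sq wtD R_wt R_join lq lmax n2.
    by rewrite (collapse_sq R_deg R_join) // eqxx.
  move=> r rR; apply: contra (nl r rR) => /mnm_lepP rl; apply/mnm_lepP => i.
  have [sqf|[y yY ry]] := R_sqf rR; last first.
    by case: noY; exists y => //; have := rl y; rewrite mnmDE; lia.
  by move: (rl i) (sqf i); rewrite mnmDE; lia.
(* [y] divides [l] already and has exponent at most 1 in the left-hand sides, so one more factor [y]
   creates no new divisor. *)
have nyl : normal R (U_(y) + l)%MM.
  move=> r rR; apply: contra (nl r rR) => /mnm_lepP rl; apply/mnm_lepP => i.
  have := rl i; rewrite mnmDE mnm1E; case: eqP => [<-|_]; last by lia.
  by have := R_Y rR yY; lia.
have := leading_shift wtD R_wt R_join lq lmax nyl; case/negP.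
pose S_wt' r (rS : r \in S y) := S_wt yY rS.
pose nf2 := nf (wtD' y) S_wt'.
have nf2_step r u : r \in R -> nf2 (u + r.1)%MM = nf2 (u + r.2)%MM.
  move=> rR; have [z [z1 z2]] := S_R yY rR.
  exact: (join_nf (wtD' y) S_wt' (S_join yY) (rewrites_addl u z1) (rewrites_addl u z2)).
have nf2_rewrites m m' : rewrites R m m' -> nf2 m' = nf2 m.
  by elim=> // m1 m2 m3 [r [u [rR -> ->]]] _ ->; rewrite nf2_step.
have nf2_nf1 m : nf2 (nf1 m) = nf2 m by apply/nf2_rewrites/nf_rewrites.
have nf1_rewrites m m' : rewrites (S y) m m' ->
    nf1 (U_(y) + m')%MM = nf1 (U_(y) + m)%MM.
  elim=> // m1 m2 m3 [r [u [rS -> ->]]] _ ->.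
  have swap a : (U_(y) + (u + a) = u + (U_(y) + a))%MM by rewrite !addmA [(_ + u)%MM]addmC.
  by rewrite !swap -(nf_addr wtD R_wt R_join) -S_colon // (nf_addr wtD R_wt R_join).
have nf1_nf2 m : nf1 (U_(y) + nf2 m)%MM = nf1 (U_(y) + m)%MM.
  by apply/nf1_rewrites/nf_rewrites.
have Lam2 q : collapse (nf_class (wtD' y) S_wt')
    (collapse (nf_class wtD R_wt) q : {mpoly C[n]}) = collapse (nf_class (wtD' y) S_wt') q.
  by apply: collapse_comp => m; rewrite /nf_class -/nf2 nf2_nf1.
have p2 : collapse (nf_class (wtD' y) S_wt') p = 0.
  apply: (squarefree_radical _ (S_join yY)).
  - by move=> r; exact: S_deg.
  - by move=> r rS; exact: (S_sqf yY).
  - by rewrite -Lam2 pp0 [LHS]raddf0.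
have shiftE q : collapse (fun m => Some (nf1 (U_(y) + m)%MM)) q =
    collapse (nf_class wtD R_wt) ('X_[U_(y)] * q) :> {mpoly C[n]}.
  rewrite [q]mpolyE mulr_sumr [LHS]linear_sum [RHS]linear_sum.
  apply: eq_bigr => m _; rewrite -scalerAr -mpolyXD.
  by rewrite [LHS]linearZ [RHS]linearZ /= !collapseX.
rewrite -shiftE.
rewrite -(collapse_comp (wtD := wtD' y) (R_wt := S_wt')); last first.
  by move=> m; rewrite -/nf2 nf1_nf2.
by rewrite Lam2 p2 [collapse _ 0]raddf0 eqxx.
Qed.

(** By induction on the degree: the part of degree [d + d] of [f * f] is the square of the part of
    degree [d], up to products with a factor of lower degree, which is already in the ideal. *)
Lemma graded_radical (f : mfps C n) : graded_kernel (nf_class wtD R_wt) (f * f) ->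
  graded_kernel (nf_class wtD R_wt) f.
Proof.
have kP := nf_graded_congruence wtD R_wt R_deg R_join.
move=> kff d; have [k] := ubnP d; elim: k d => // k IH d dk.
apply: colon_radical; have := kff (d + d)%N; rewrite hpartM [X in X = _]linear_sum /=.
have dd : (d < (d + d).+1)%N by rewrite ltnS leq_addr.
rewrite (bigD1 (Ordinal dd)) //= addnK big1 ?addr0 // => i.
rewrite -val_eqE /= => id; case: (ltnP i d) => di.
  rewrite mulrC; apply: collapse_mull => //; apply: IH; exact: leq_trans di _.
apply: collapse_mull => //; apply: IH; have := ltn_ord i.
move: id di dk => /eqP; lia.
Qed.

End Radical.

(** * The ideal of the minors *)

Section MonomialLists.
Local Open Scope nat_scope.

(* A monomial is computed with as the sorted list of its variables, with repetition. *)
Definition mon n (s : seq nat) : 'X_{1..n} := [multinom count_mem (val i) s | i < n].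

Fixpoint insert (x : nat) (s : seq nat) : seq nat :=
  if s is y :: s' then if Nat.leb x y then x :: s else y :: insert x s' else [:: x].

Definition mmul (s t : seq nat) : seq nat := foldr insert t s.

(** Exact division of monomials. The early exit supposes sorted lists; on other lists a success is
    still correct, and only failures may be spurious. *)
Fixpoint take_out (t s : seq nat) {struct t} : option (seq nat) :=
  if t is x :: t' then
    (fix scan s := if s is y :: s' then
       match Nat.compare x y with
       | Eq => take_out t' s'
       | Lt => None
       | Gt => omap (cons y) (scan s')
       end else None) s
  else Some s.

Fixpoint remove1 (x : nat) (s : seq nat) : seq nat :=
  if s is y :: s' then if Nat.eqb x y then s' else y :: remove1 x s' else [::].

Definition div_out (s t : seq nat) : seq nat := foldl (fun s x => remove1 x s) s t.

Definition rule : Type := (seq nat * seq nat)%type.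

Fixpoint try_rules (rs : seq rule) (s : seq nat) : option (seq nat) :=
  if rs is r :: rs' then
    if take_out r.1 s is Some u then Some (mmul r.2 u) else try_rules rs' s
  else None.

(* The [x]-th bucket contains the rules whose smallest variable is [x]. *)
Fixpoint reduce_once (bs : seq (seq rule)) (s : seq nat) : option (seq nat) :=
  if s is x :: s' then
    if try_rules (nth [::] bs x) s is Some u then Some u
    else omap (insert x) (reduce_once bs s')
  else None.

Fixpoint reduce_all (fuel : nat) (bs : seq (seq rule)) (s : seq nat) : seq nat :=
  if fuel is k.+1 then
    if reduce_once bs s is Some u then reduce_all k bs u else s
  else s.

Fixpoint same_seq (s t : seq nat) : bool :=
  match s, t with
  | [::], [::] => true
  | x :: s', y :: t' => Nat.eqb x y && same_seq s' t'
  | _, _ => false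
  end.

(** The fuel 100 only bounds the computation: any common reduct, normal or not, joins the pair. *)
Definition joinable bs s t := same_seq (reduce_all 100 bs s) (reduce_all 100 bs t).

(** Buchberger's first criterion: if the left-hand sides are coprime, which means that [d] is all of
    [r2.1], both reducts rewrite to the product of the right-hand sides. *)
Definition pair_joins bs (r1 r2 : rule) : bool :=
  let d := div_out r2.1 r1.1 in
  same_seq d r2.1 || joinable bs (mmul d r1.2) (mmul (div_out r1.1 r2.1) r2.2).

Fixpoint all_pairs_join bs (rs : seq rule) : bool :=
  if rs is r :: rs' then all (pair_joins bs r) rs' && all_pairs_join bs rs' else true.

Definition buckets (rs : seq rule) : seq (seq rule) :=
  [seq [seq r <- rs | Nat.eqb (head 0 r.1) x] | x <- iota 0 21].

Definition confluent (rs : seq rule) : bool := all_pairs_join (buckets rs) rs.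

Fixpoint follow (ms : seq rule) (path : seq nat) (s : seq nat) : option (seq nat) :=
  if path is c :: path' then
    let r := nth ([::], [::]) ms c in
    obind (fun u => follow ms path' (mmul r.2 u)) (take_out r.1 s)
  else Some s.

Definition monr (r : rule) : 'X_{1..21} * 'X_{1..21} := (mon 21 r.1, mon 21 r.2).

Section Soundness.
Implicit Types (s t u : seq nat) (r : rule).

Lemma monE n s (i : 'I_n) : mon n s i = count_mem (val i) s.
Proof. by rewrite mnmE. Qed.

Lemma mon_cat n s t : mon n (s ++ t) = (mon n s + mon n t)%MM.
Proof. by apply/mnmP => i; rewrite mnmDE !monE count_cat. Qed.

Lemma mon_cons n x s : mon n (x :: s) = (mon n [:: x] + mon n s)%MM.
Proof. by rewrite -cat1s mon_cat. Qed.

Lemma mon_nil n : mon n [::] = 0%MM.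
Proof. by apply/mnmP => i; rewrite [RHS]mnm0E monE. Qed.

Lemma mon1 n (i : 'I_n) : mon n [:: val i] = U_(i)%MM.
Proof. by apply/mnmP => j; rewrite monE mnm1E /= addn0 val_eqE. Qed.

Lemma mon_insert n x s : mon n (insert x s) = mon n (x :: s).
Proof.
elim: s => //= y s IH; case: ifP => // _.
by rewrite mon_cons IH !(mon_cons _ _ (_ :: _)) !(mon_cons _ _ s) !addmA
   [(mon n [:: y] + _)%MM]addmC.
Qed.

Lemma mon_mul n s t : mon n (mmul s t) = (mon n s + mon n t)%MM.
Proof.
elim: s => [|x s IH] /=; first by rewrite mon_nil add0m.
by rewrite mon_insert mon_cons IH [in RHS]mon_cons addmA.
Qed.

Lemma mon_take_out n t s u : take_out t s = Some u ->
  mon n s = (mon n t + mon n u)%MM.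
Proof.
elim: t s u => [|x t IHt] s u /=; first by case=> ->; rewrite mon_nil add0m.
elim: s u => //= y s IHs u; case: (PeanoNat.Nat.compare_spec x y) => [->||] //.
  by move=> /IHt e; rewrite mon_cons e [mon n (y :: t)]mon_cons addmA.
move=> _; move: IHs; case: (_ s) => // v /(_ _ erefl) e [<-].
rewrite mon_cons e [mon n (y :: v)]mon_cons !addmA.
by rewrite [(mon n [:: y] + _)%MM]addmC.
Qed.

Lemma mon_div_out n s t : mon n (div_out s t) = (mon n s - mon n t)%MM.
Proof.
have rem1 x v : mon n (remove1 x v) = (mon n v - mon n [:: x])%MM.
  elim: v => [|y v IH] /=; first by rewrite mon_nil sub0m.
  case: (PeanoNat.Nat.eqb_spec x y) => [->|xy].
    by rewrite mon_cons addmC addmK.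
  rewrite mon_cons IH [in RHS]mon_cons; apply/mnmP => i.
  rewrite !(mnmDE, mnmBE) !monE /= !addn0.
  have [yi|_] := eqVneq y (val i); last by rewrite !add0n.
  by have [xi|_] := eqVneq x (val i); [case: xy; rewrite xi yi|rewrite !subn0].
elim: t s => [|x t IH] s /=; first by rewrite mon_nil subm0.
by rewrite IH rem1 submDA -mon_cons.
Qed.

Lemma same_seqP s t : same_seq s t -> s = t.
Proof.
elim: s t => [|x s IH] [|y t] //= /andP[/PeanoNat.Nat.eqb_spec -> /IH ->] //.
Qed.

Lemma mon_sum n (F : nat -> nat) s : all (fun x => x < n) s ->
  \sum_(i < n) F i * mon n s i = \sum_(x <- s) F x.
Proof.
elim: s => [|x s IH] /= => [_|/andP[xn sn]].
  by rewrite big_nil big1 // => i _; rewrite monE muln0.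
rewrite big_cons -IH // (eq_bigr (fun i : 'I_n => (val i == x) * F x + F i * mon n s i)).
  rewrite big_split /= (bigD1 (Ordinal xn)) //= eqxx mul1n big1 ?addn0 // => i.
  by rewrite -val_eqE /= => /negbTE ->.
move=> i _; rewrite !monE /= mulnDr; congr (_ + _).
by rewrite eq_sym; case: eqP => [->|_]; rewrite ?muln1 ?mul1n ?muln0.
Qed.

Lemma mdeg_mon n s : all (fun x => x < n) s -> mdeg (mon n s) = size s.
Proof.
move=> sn; rewrite mdegE -sum1_size -[RHS](@mon_sum n (fun=> 1)) //.
by apply: eq_bigr => i _; rewrite mul1n.
Qed.

Definition weight (w : seq nat) (m : 'X_{1..21}) : nat :=
  \sum_(i < 21) nth 0 w i * m i.

Lemma weightD w m m' : weight w (m + m')%MM = weight w m + weight w m'.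
Proof.
by rewrite /weight -big_split; apply: eq_bigr => i _; rewrite mnmDE mulnDr.
Qed.

Lemma weight_mon w s : all (fun x => x < 21) s ->
  weight w (mon 21 s) = sumn [seq nth 0 w x | x <- s].
Proof. by move=> s21; rewrite /weight mon_sum // sumnE big_map. Qed.

Section System.
Variables (rs : seq rule) (bs : seq (seq rule)).
Hypothesis bs_rs : forall b r, b \in bs -> r \in b -> r \in rs.
Local Notation R := (map monr rs).

Lemma rule_step r s u : r \in rs -> take_out r.1 s = Some u ->
  rewrite_step R (mon 21 s) (mon 21 (mmul r.2 u)).
Proof.
move=> rR /(mon_take_out 21) ->; exists (monr r), (mon 21 u).
by rewrite map_f // mon_mul ![(mon 21 u + _)%MM]addmC.
Qed.

Lemma try_rulesP b s u : (forall r, r \in b -> r \in rs) ->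
  try_rules b s = Some u -> rewrite_step R (mon 21 s) (mon 21 u).
Proof.
elim: b => //= r b IH br; case E: (take_out r.1 s) => [v|].
  by case=> <-; apply: rule_step E; apply: br; rewrite inE eqxx.
by apply: IH => r' r'b; apply: br; rewrite inE r'b orbT.
Qed.

Lemma reduce_onceP s u : reduce_once bs s = Some u ->
  rewrite_step R (mon 21 s) (mon 21 u).
Proof.
elim: s u => //= x s IH u; case E: (try_rules _ _) => [v|].
  case=> <-; apply: try_rulesP E => r rb.
  have [xb|xb] := ltnP x (size bs); first exact: bs_rs (mem_nth _ xb) rb.
  by move: rb; rewrite nth_default.
case: (reduce_once bs s) IH => // v /(_ _ erefl) [r [w [rR e e']]] [<-].
exists r, (mon 21 [:: x] + w)%MM.
by rewrite mon_insert (mon_cons _ x s) (mon_cons _ x v) e e' !addmA.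
Qed.

Lemma reduce_allP k s : rewrites R (mon 21 s) (mon 21 (reduce_all k bs s)).
Proof.
elim: k s => [|k IH] s /=; first exact: rewrites_refl.
case E: (reduce_once bs s) => [u|]; last exact: rewrites_refl.
exact: rewrites_trans (reduce_onceP E) (IH u).
Qed.

Lemma joinableP s t : joinable bs s t ->
  exists z, rewrites R (mon 21 s) z /\ rewrites R (mon 21 t) z.
Proof.
move=> /same_seqP e; exists (mon 21 (reduce_all 100 bs s)).
by split; [|rewrite e]; exact: reduce_allP.
Qed.

Lemma pair_joinsP r1 r2 : r1 \in rs -> r2 \in rs -> pair_joins bs r1 r2 ->
  exists z,
    rewrites R ((monr r2).1 - (monr r1).1 + (monr r1).2)%MM z /\
    rewrites R ((monr r1).1 - (monr r2).1 + (monr r2).2)%MM z.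
Proof.
move=> R1 R2 /orP[|/joinableP[z]]; last first.
  by rewrite !mon_mul !mon_div_out; exists z.
move=> /same_seqP /(congr1 (mon 21)).
rewrite mon_div_out => dE.
have dE' : ((monr r1).1 - (monr r2).1 = (monr r1).1)%MM.
  apply/mnmP => i; move/mnmP: dE => /(_ i); rewrite !mnmBE /=; lia.
rewrite dE' [X in (X + _)%MM]dE; exists ((monr r1).2 + (monr r2).2)%MM.
split; apply: rewrites_trans (rewrites_refl _ _).
  by exists (monr r2), (monr r1).2; rewrite map_f // addmC.
by exists (monr r1), (monr r2).2; rewrite map_f // ![(_ + (monr r2).2)%MM]addmC.
Qed.

Lemma all_pairs_joinP : all_pairs_join bs rs -> critical_pairs_join R.
Proof.
move=> h; have {h} : forall r1 r2, r1 \in rs -> r2 \in rs ->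
    [\/ r1 = r2, pair_joins bs r1 r2 | pair_joins bs r2 r1].
  elim: (rs) h => //= r l IH /andP[/allP rl /IH{}IH] r1 r2; rewrite !inE.
  move=> /predU1P[->|l1] /predU1P[->|l2]; first by constructor 1.
  - by constructor 2; apply: rl.
  - by constructor 3; apply: rl.
  exact: IH.
move=> h _ _ /mapP[r1 R1 ->] /mapP[r2 R2 ->]; case: (h _ _ R1 R2) => [->|p|p].
- by eexists; split; exact: rewrites_refl.
- exact: pair_joinsP.
- by have [z []] := pair_joinsP R2 R1 p; exists z.
Qed.

End System.

Lemma buckets_sub rs b r : b \in buckets rs -> r \in b -> r \in rs.
Proof. by move=> /mapP[x _ ->]; rewrite mem_filter => /andP[]. Qed.

Lemma confluentP rs : confluent rs -> critical_pairs_join (map monr rs).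
Proof. by apply: all_pairs_joinP => b r; exact: buckets_sub. Qed.

Lemma followP ms path s u : follow ms path s = Some u ->
  rewrites (map monr ms) (mon 21 s) (mon 21 u).
Proof.
elim: path s => [|c path IH] s; first by case=> ->; exact: rewrites_refl.
rewrite /=; case E: (take_out _ s) => [v|//] /= fv.
have [cm|cm] := ltnP c (size ms).
  by apply: rewrites_trans (IH _ fv); apply: rule_step E; exact: mem_nth.
have vE : v = s by move: E; rewrite nth_default //= => -[].
by apply: IH; move: fv; rewrite nth_default // vE.
Qed.

End Soundness.

End MonomialLists.

(** * Certified Groebner bases of the ideal of the minors and of two colon ideals *)

Section Presentations.
Local Open Scope nat_scope.

Definition edge (p q : nat) : nat := 'C(maxn p q, 2) + minn p q.

Definition edge_out (p j : nat) := edge p ((p + nth 0 [:: 1; 4; 2] j) %% 7).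
Definition edge_in (p j : nat) := edge p ((p + nth 0 [:: 6; 3; 5] j) %% 7).

Definition minor_move (p j k : nat) : rule :=
  (mmul [:: edge_out p j] [:: edge_in p k], mmul [:: edge_out p k] [:: edge_in p j]).

Definition minor_moves : seq rule := Eval vm_compute in
  [seq minor_move p jk.1 jk.2 | p <- iota 0 7, jk <- [:: (0, 1); (0, 2); (1, 2)]].

(** The paths below refer to these by position: there are 21 minors, and move [c + 21] is the
    reverse of move [c]. *)
Definition moves : seq rule := Eval vm_compute in
  minor_moves ++ [seq (r.2, r.1) | r <- minor_moves].

(* A rule is given by its left-hand side and a path of moves which starts at the
   product of [e] and this left-hand side. *)
Definition rule_of (e : seq nat) (d : seq nat * seq nat) : rule :=
  (d.1, odflt [::] (obind (take_out e) (follow moves d.2 (mmul e d.1)))).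

(* A Groebner basis of the binomial ideal of the minors: its leading monomials
   are squarefree, except for some divisible by the variable 10 or 16. *)
Definition groebner_data : seq (seq nat * seq nat) :=
  [:: ([:: 0; 4], [:: 25]); ([:: 0; 11], [:: 24]); ([:: 0; 3; 17], [:: 0; 18]);
  ([:: 0; 3; 19], [:: 0; 19]); ([:: 0; 5; 13], [:: 31; 25]);
  ([:: 0; 12; 13], [:: 17; 24]); ([:: 0; 12; 14], [:: 36; 24]);
  ([:: 0; 13; 18], [:: 32; 25]); ([:: 0; 1; 13; 17], [:: 8; 17; 24; 28]);
  ([:: 0; 3; 5; 12], [:: 0; 6; 18]); ([:: 0; 7; 9; 12], [:: 33; 36; 24]);
  ([:: 0; 9; 10; 17], [:: 1; 18; 9; 23]);
  ([:: 0; 9; 12; 19], [:: 34; 36; 24; 28]);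
  ([:: 0; 9; 16; 17], [:: 41; 9; 0; 19]); ([:: 0; 10; 13; 17], [:: 1; 18; 16]);
  ([:: 0; 10; 13; 19], [:: 1; 19; 16]); ([:: 0; 10; 14; 18], [:: 37; 32; 25]);
  ([:: 0; 13; 16; 17], [:: 41; 32; 25]);
  ([:: 0; 0; 10; 14; 17], [:: 1; 8; 36; 24; 28; 22]);
  ([:: 0; 1; 7; 9; 17], [:: 8; 33; 36; 24; 28]);
  ([:: 0; 1; 9; 17; 19], [:: 8; 34; 36; 24; 14; 28]);
  ([:: 0; 3; 12; 16; 20], [:: 0; 40; 35; 29; 18; 22]);
  ([:: 0; 5; 7; 10; 15], [:: 1; 7; 14; 19; 21]);
  ([:: 0; 5; 9; 10; 12], [:: 1; 6; 18; 9; 23]);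
  ([:: 0; 5; 9; 12; 16], [:: 6; 41; 9; 0; 35; 28; 22]);
  ([:: 0; 10; 14; 14; 17], [:: 1; 8; 13; 19; 36; 5; 10; 16]);
  ([:: 1; 3], [:: 23]); ([:: 1; 15], [:: 22]); ([:: 1; 14; 17], [:: 8; 13]);
  ([:: 1; 16; 20], [:: 40; 22]); ([:: 1; 18; 20], [:: 39; 22]);
  ([:: 1; 4; 5; 14], [:: 7; 13; 10]); ([:: 1; 5; 14; 18], [:: 7; 13; 20; 27]);
  ([:: 1; 9; 16; 17], [:: 41; 9; 23]); ([:: 1; 11; 13; 18], [:: 32; 23; 38]);
  ([:: 1; 12; 14; 16], [:: 36; 40; 22; 24]);
  ([:: 1; 12; 14; 18], [:: 36; 39; 22; 24; 27]);
  ([:: 1; 13; 14; 18], [:: 32; 23; 12; 10]);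
  ([:: 1; 1; 10; 14; 18], [:: 37; 39; 8; 17; 22; 24; 28]);
  ([:: 1; 2; 10; 14; 18], [:: 37; 39; 22; 27; 17; 24]);
  ([:: 1; 4; 7; 10; 14], [:: 26; 37; 40; 22; 24]);
  ([:: 1; 4; 7; 12; 14], [:: 26; 36; 40; 22; 24; 38]);
  ([:: 1; 4; 10; 14; 16], [:: 37; 40; 22; 25]);
  ([:: 1; 4; 10; 14; 18], [:: 37; 39; 22; 25; 27; 17; 5]);
  ([:: 1; 5; 7; 11; 18], [:: 7; 14; 20; 5; 27]);
  ([:: 1; 5; 9; 12; 16], [:: 6; 41; 9; 23; 35; 28]);
  ([:: 1; 7; 9; 12; 16], [:: 33; 36; 40; 22; 24; 35; 28]);
  ([:: 1; 7; 10; 14; 18], [:: 37; 32; 23; 26; 15; 12]);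
  ([:: 1; 7; 11; 17; 18], [:: 8; 14; 20; 5]);
  ([:: 1; 9; 12; 16; 19], [:: 34; 36; 40; 22; 24; 28]);
  ([:: 1; 10; 14; 14; 18], [:: 37; 32; 23; 12; 10; 16]);
  ([:: 1; 10; 14; 16; 18], [:: 37; 32; 40; 22; 25]);
  ([:: 1; 10; 14; 18; 18], [:: 37; 32; 39; 22; 25; 27]); ([:: 2; 8], [:: 28]);
  ([:: 2; 17], [:: 27]); ([:: 2; 6; 19], [:: 35; 28]);
  ([:: 2; 9; 19], [:: 34; 28]); ([:: 2; 3; 7; 19], [:: 3; 0; 19; 15; 12]);
  ([:: 2; 3; 12; 16], [:: 4; 11; 17; 24]);
  ([:: 2; 6; 16; 20], [:: 40; 35; 28; 22]);
  ([:: 2; 9; 12; 16], [:: 4; 10; 17; 24]); ([:: 2; 9; 16; 20], [:: 4; 10; 16]);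
  ([:: 2; 2; 3; 16; 19], [:: 4; 0; 35; 28; 22; 25]);
  ([:: 2; 3; 3; 16; 19], [:: 4; 0; 11; 19; 16; 12; 9]);
  ([:: 2; 3; 13; 16; 19], [:: 4; 0; 19; 16; 12; 10]);
  ([:: 2; 3; 14; 16; 19], [:: 4; 0; 12; 10; 19; 16]);
  ([:: 2; 3; 16; 19; 19], [:: 4; 0; 19; 35; 26; 15; 13]);
  ([:: 2; 3; 16; 19; 20], [:: 4; 11; 16; 20]);
  ([:: 2; 5; 7; 10; 15], [:: 3; 38; 6; 18; 32; 25]);
  ([:: 2; 5; 7; 15; 20], [:: 3; 15; 6; 18]);
  ([:: 2; 6; 10; 12; 16], [:: 2; 4; 11; 17; 24]); ([:: 3; 4], [:: 11]);
  ([:: 3; 5; 19], [:: 30; 20]); ([:: 3; 5; 7; 15], [:: 30; 33; 21]);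
  ([:: 3; 9; 12; 19], [:: 34; 29; 23; 12]);
  ([:: 3; 12; 14; 16], [:: 36; 5; 11; 16]);
  ([:: 3; 3; 5; 12; 16], [:: 6; 4; 0; 11; 18; 16; 12; 9]);
  ([:: 3; 5; 9; 12; 16], [:: 6; 41; 34; 28; 23; 12; 9]);
  ([:: 3; 5; 12; 12; 16], [:: 6; 4; 11; 17; 24; 27]);
  ([:: 3; 7; 9; 12; 16], [:: 33; 36; 5; 11; 16; 12; 9]);
  ([:: 3; 9; 12; 16; 17], [:: 41; 34; 29; 23; 12; 9]); ([:: 4; 9], [:: 10]);
  ([:: 4; 6; 10], [:: 2; 11]); ([:: 4; 7; 20], [:: 26; 15]);
  ([:: 4; 6; 16; 20], [:: 40; 21; 25]);
  ([:: 4; 6; 18; 20], [:: 39; 21; 25; 27]);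
  ([:: 4; 6; 19; 20], [:: 35; 26; 15; 13]);
  ([:: 4; 5; 7; 10; 15], [:: 26; 38; 6; 18; 16]); ([:: 5; 12; 15], [:: 6; 18]);
  ([:: 5; 6; 12; 16], [:: 6; 41; 35; 28]);
  ([:: 5; 7; 13; 15], [:: 31; 33; 21; 25]);
  ([:: 5; 7; 10; 14; 15], [:: 37; 31; 33; 21; 25]);
  ([:: 5; 9; 9; 12; 16], [:: 6; 41; 9; 34; 28; 23; 12]);
  ([:: 5; 9; 12; 12; 16], [:: 6; 4; 10; 17; 24; 27]); ([:: 6; 14], [:: 12]);
  ([:: 6; 15], [:: 21]); ([:: 6; 12; 19], [:: 35; 29]);
  ([:: 6; 12; 16; 17], [:: 41; 35; 29]);
  ([:: 6; 12; 16; 20], [:: 40; 35; 29; 22]);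
  ([:: 6; 7; 9; 12; 16], [:: 33; 36; 40; 21; 24; 35; 28; 23]);
  ([:: 7; 8], [:: 14]); ([:: 7; 9; 15], [:: 33; 21]);
  ([:: 7; 9; 9; 12; 16], [:: 33; 36; 5; 10; 16; 12]);
  ([:: 7; 9; 12; 12; 16], [:: 33; 36; 40; 35; 29; 22; 24; 27]);
  ([:: 8; 12], [:: 29]); ([:: 8; 14], [:: 13]); ([:: 9; 18], [:: 9]);
  ([:: 9; 12; 14; 16], [:: 36; 5; 10; 16]);
  ([:: 9; 12; 16; 20], [:: 40; 34; 29; 22]);
  ([:: 9; 9; 12; 16; 17], [:: 41; 9; 34; 29; 23; 12]);
  ([:: 9; 9; 12; 16; 19], [:: 34; 29; 41; 9; 23; 12]);
  ([:: 9; 12; 12; 16; 17], [:: 41; 34; 29; 36; 39; 22; 24; 27]);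
  ([:: 9; 12; 12; 16; 19], [:: 34; 29; 36; 40; 22; 24; 27]);
  ([:: 10; 11], [:: 38]); ([:: 11; 16], [:: 5]); ([:: 11; 20], [:: 15]);
  ([:: 12; 13; 16], [:: 17; 5]); ([:: 13; 20], [:: 16]);
  ([:: 15; 17], [:: 18]); ([:: 15; 19], [:: 19]); ([:: 18; 19], [:: 20])].

(** These weights strictly decrease along every rule of the basis and so play the role of its term
    order. *)
Definition groebner_weights : seq nat :=
  [:: 33; 23; 0; 71; 48; 25; 47; 3; 94; 50; 19; 49; 20; 38; 36; 107; 21; 48; 51; 36; 46].

(* A Groebner basis, with squarefree leading monomials, of the quotient of this
   ideal by the variable 10. *)
Definition colon10_data : seq (seq nat * seq nat) :=
  [:: ([:: 0; 3], [:: 0]); ([:: 0; 10], [:: 1]);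
  ([:: 0; 13; 19], [:: 1; 19; 16]);
  ([:: 0; 5; 7; 15], [:: 1; 7; 14; 19; 4; 21; 11; 16]);
  ([:: 0; 5; 7; 20], [:: 1; 7; 3; 15; 29; 22]);
  ([:: 0; 8; 9; 11], [:: 24; 28; 33]);
  ([:: 0; 8; 11; 13], [:: 24; 28; 31; 33]); ([:: 1; 3], [:: 23]);
  ([:: 1; 5; 7], [:: 7; 3]); ([:: 1; 5; 16], [:: 7; 4]);
  ([:: 1; 11; 15], [:: 22; 38]); ([:: 1; 14; 15], [:: 22; 37]);
  ([:: 1; 14; 18], [:: 37; 39; 22]); ([:: 1; 4; 9; 16], [:: 10; 7; 4]);
  ([:: 1; 5; 6; 19], [:: 7; 35; 3]); ([:: 1; 9; 14; 16], [:: 37; 40; 22; 34]);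
  ([:: 1; 9; 16; 18], [:: 9; 7; 4; 11]); ([:: 2; 7], [:: 3]);
  ([:: 2; 8], [:: 28]); ([:: 2; 16], [:: 4]); ([:: 2; 17], [:: 27]);
  ([:: 2; 6; 14], [:: 12; 3]); ([:: 2; 6; 19], [:: 35; 3]);
  ([:: 2; 14; 18], [:: 37; 39; 27; 17]);
  ([:: 2; 6; 13; 20], [:: 16; 12; 3; 38]); ([:: 3; 4], [:: 11]);
  ([:: 3; 5], [:: 30]); ([:: 3; 8; 11], [:: 38; 29; 23]);
  ([:: 3; 6; 11; 19], [:: 35; 38; 29; 23]); ([:: 4; 6; 10], [:: 2; 11]);
  ([:: 4; 6; 12], [:: 2; 11; 17]); ([:: 4; 6; 15], [:: 21; 11]);
  ([:: 4; 6; 20], [:: 2; 11; 39; 22]); ([:: 4; 5; 7; 10], [:: 26; 38; 6; 4]);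
  ([:: 4; 5; 7; 15], [:: 26; 38; 6; 4; 18; 16]);
  ([:: 4; 5; 7; 20], [:: 26; 15; 6; 4]); ([:: 4; 9; 12; 16], [:: 10; 6; 4]);
  ([:: 5; 13], [:: 31]); ([:: 5; 6; 10], [:: 2; 30]);
  ([:: 5; 6; 15], [:: 21; 30]); ([:: 5; 6; 20], [:: 2; 30; 39; 22]);
  ([:: 5; 7; 12], [:: 6; 3]); ([:: 5; 12; 16], [:: 6; 4]);
  ([:: 5; 6; 12; 14], [:: 6; 12; 3]);
  ([:: 5; 7; 11; 15], [:: 38; 6; 3; 18; 16]);
  ([:: 5; 7; 14; 15], [:: 37; 31; 33; 21; 11; 16]);
  ([:: 5; 7; 14; 20], [:: 37; 31; 26; 15; 40; 34; 29; 22]);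
  ([:: 6; 12; 19], [:: 35; 29]); ([:: 6; 12; 16; 17], [:: 41; 35; 29]);
  ([:: 6; 12; 16; 20], [:: 40; 35; 29]);
  ([:: 6; 9; 10; 16; 18], [:: 2; 9; 7; 4; 0; 11]); ([:: 7; 8], [:: 14]);
  ([:: 7; 9], [:: 33]); ([:: 8; 12], [:: 29]);
  ([:: 8; 11; 15], [:: 38; 29; 22]); ([:: 8; 11; 18], [:: 38; 29; 32; 23]);
  ([:: 9; 19], [:: 34]); ([:: 9; 16; 17], [:: 41; 34]);
  ([:: 9; 16; 20], [:: 40; 34]); ([:: 9; 12; 16; 18], [:: 9; 6; 4; 11]);
  ([:: 10; 11], [:: 38]); ([:: 10; 14], [:: 37]); ([:: 11; 16], [:: 5]);
  ([:: 11; 20], [:: 15]); ([:: 12; 13; 16], [:: 17; 5]);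
  ([:: 12; 14; 16], [:: 36; 5]); ([:: 12; 14; 18], [:: 36; 39]);
  ([:: 15; 19], [:: 19]); ([:: 18; 19], [:: 20]); ([:: 18; 20], [:: 39])].

Definition colon10_weights : seq nat :=
  [:: 0; 12; 31; 40; 5; 2; 5; 10; 16; 8; 41; 4; 28; 14; 3; 28; 16; 17; 20; 18; 28].

Definition colon16_data : seq (seq nat * seq nat) :=
  [:: ([:: 0; 10], [:: 1]); ([:: 0; 4; 17], [:: 25; 41]);
  ([:: 0; 4; 20], [:: 25; 40]); ([:: 0; 8; 11], [:: 24; 14]);
  ([:: 0; 9; 11], [:: 24; 33]); ([:: 0; 13; 17], [:: 41; 32; 25]);
  ([:: 0; 2; 9; 12], [:: 4; 10; 17; 1; 7; 24; 14; 19]);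
  ([:: 0; 8; 9; 12], [:: 29; 41; 9; 0; 7; 19]);
  ([:: 0; 9; 12; 17], [:: 41; 9; 0; 6; 19]);
  ([:: 0; 9; 12; 20], [:: 40; 34; 36; 24; 14; 19]); ([:: 1; 5], [:: 7]);
  ([:: 1; 17], [:: 8]); ([:: 1; 3; 14], [:: 23; 37]);
  ([:: 1; 4; 9], [:: 10; 7]); ([:: 1; 9; 18], [:: 9; 7]);
  ([:: 1; 14; 15], [:: 22; 37]); ([:: 1; 18; 19], [:: 20; 8]);
  ([:: 1; 18; 20], [:: 39; 8]); ([:: 1; 3; 11; 18], [:: 23; 38; 32]);
  ([:: 1; 4; 6; 14], [:: 12; 10; 7; 14]); ([:: 1; 4; 8; 14], [:: 13; 10; 7]);
  ([:: 1; 4; 14; 20], [:: 40; 22; 25; 37]);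
  ([:: 1; 6; 14; 18], [:: 12; 9; 7; 14]); ([:: 1; 8; 14; 18], [:: 13; 9; 7]);
  ([:: 1; 11; 15; 18], [:: 22; 38; 32]);
  ([:: 1; 6; 11; 14; 16], [:: 5; 12; 10; 7; 3; 14]); ([:: 2; 7], [:: 3]);
  ([:: 2; 16], [:: 4]); ([:: 2; 10; 19], [:: 4; 1; 19]);
  ([:: 2; 9; 12; 15], [:: 4; 10; 6; 18; 32; 25]);
  ([:: 2; 13; 14; 17], [:: 27; 31; 36]);
  ([:: 2; 13; 17; 19], [:: 27; 31; 34; 36]); ([:: 3; 5], [:: 30]);
  ([:: 4; 7], [:: 26]); ([:: 4; 6; 20], [:: 40; 21; 25]);
  ([:: 4; 9; 12], [:: 10; 6]); ([:: 4; 9; 10; 11], [:: 10; 38; 6]);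
  ([:: 5; 12], [:: 6]); ([:: 5; 13], [:: 31]);
  ([:: 5; 6; 20], [:: 40; 21; 30; 20]); ([:: 5; 10; 11], [:: 38; 6]);
  ([:: 5; 11; 20], [:: 15; 6]); ([:: 5; 11; 15; 19], [:: 19; 15; 6; 41]);
  ([:: 6; 10], [:: 2]); ([:: 6; 15], [:: 21]);
  ([:: 6; 13; 17], [:: 41; 32; 35; 26]); ([:: 6; 18; 20], [:: 39; 21]);
  ([:: 7; 8], [:: 14]); ([:: 7; 9], [:: 33]);
  ([:: 7; 13; 17], [:: 41; 32; 26]); ([:: 7; 10; 11; 17], [:: 38; 41; 32; 26]);
  ([:: 8; 11; 15], [:: 5; 14; 21; 25]); ([:: 8; 11; 16], [:: 5; 14]);
  ([:: 8; 11; 18], [:: 5; 14; 20]); ([:: 8; 9; 12; 15], [:: 29; 18; 9; 7]);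
  ([:: 8; 9; 12; 16], [:: 29; 41; 9; 7]); ([:: 9; 19], [:: 34]);
  ([:: 9; 11; 15], [:: 5; 33; 21; 25]); ([:: 9; 11; 16], [:: 5; 33]);
  ([:: 9; 12; 18], [:: 9; 6]); ([:: 9; 11; 18; 20], [:: 9; 15; 6]);
  ([:: 9; 12; 15; 20], [:: 40; 34; 29; 18; 22; 37; 32; 25]);
  ([:: 10; 14], [:: 37]); ([:: 10; 11; 18], [:: 38; 32]);
  ([:: 12; 13], [:: 17]); ([:: 12; 14], [:: 36]); ([:: 13; 18], [:: 32]);
  ([:: 15; 17], [:: 18]); ([:: 16; 17], [:: 41]); ([:: 16; 20], [:: 40])].

Definition colon16_weights : seq nat :=
  [:: 28; 16; 0; 17; 12; 31; 20; 40; 5; 2; 18; 5; 10; 16; 8; 28; 41; 4; 28; 14; 3].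

Definition groebner : seq rule := Eval vm_compute in map (rule_of [::]) groebner_data.
Definition colon10 : seq rule := Eval vm_compute in map (rule_of [:: 10]) colon10_data.
Definition colon16 : seq rule := Eval vm_compute in map (rule_of [:: 16]) colon16_data.

Definition good_rules (w : seq nat) (rs : seq rule) : bool :=
  all (fun r => [&& sumn [seq nth 0 w x | x <- r.2] < sumn [seq nth 0 w x | x <- r.1],
    size r.2 == size r.1, all (fun x => x < 21) r.1 & all (fun x => x < 21) r.2]) rs.

Lemma good_rulesP w rs r : good_rules w rs -> r \in map monr rs ->
  weight w r.2 < weight w r.1 /\ mdeg r.2 = mdeg r.1.
Proof.
move=> /allP good /mapP[s /good /and4P[lt /eqP sz s1 s2] ->] /=.
by rewrite !weight_mon // !mdeg_mon.
Qed.

(** The path from [e] times one side to [e] times the other certifies that the rule lies in the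
    quotient of the ideal by [e], and in the ideal itself when [e] is empty. *)
Definition derivable (e : seq nat) (data : seq (seq nat * seq nat)) (rs : seq rule) :=
  same_seq [seq size d.1 | d <- data] [seq size r.1 | r <- rs] &&
  all (fun dr => if follow moves dr.1.2 (mmul e dr.2.1) is Some u
                 then same_seq u (mmul e dr.2.2) else false) (zip data rs).

Lemma derivableP e data rs r : derivable e data rs -> r \in rs ->
  rewrites (map monr moves) (mon 21 e + mon 21 r.1)%MM (mon 21 e + mon 21 r.2)%MM.
Proof.
move=> /andP[/same_seqP /(congr1 size)]; rewrite !size_map => sz /allP h rR.
have : r \in unzip2 (zip data rs) by rewrite unzip2_zip // sz.
move=> /mapP[[d r'] /h /=]; case E: follow => [u|//] /same_seqP ue ->.
by rewrite -!mon_mul -ue; exact: followP E.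
Qed.

(** The opposite inclusion: the minors lie in the ideal of the rules. *)
Definition moves_join (rs : seq rule) : bool :=
  all (fun r => joinable (buckets rs) r.1 r.2) moves.

Lemma moves_joinP rs r : moves_join rs -> r \in map monr moves -> exists z,
  rewrites (map monr rs) r.1 z /\ rewrites (map monr rs) r.2 z.
Proof.
move=> /allP h /mapP[s /h j ->]; exact: (joinableP (@buckets_sub rs) j).
Qed.

Lemma groebner_good : good_rules groebner_weights groebner.
Proof. by vm_compute. Qed.

Lemma groebner_confluent : confluent groebner.
Proof. by vm_compute. Qed.

Lemma groebner_derivable : derivable [::] groebner_data groebner.
Proof. by vm_compute. Qed.

Lemma groebner_moves : moves_join groebner.
Proof. by vm_compute. Qed.

Lemma groebner_squarefree :
  all (fun r => [&& uniq r.1 || ((10 \in r.1) || (16 \in r.1)),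
    count_mem 10 r.1 <= 1 & count_mem 16 r.1 <= 1]) groebner.
Proof. by vm_compute. Qed.

Definition colon (y : nat) := if y == 10 then colon10 else colon16.
Definition colon_weights (y : nat) :=
  if y == 10 then colon10_weights else colon16_weights.
Definition colon_data (y : nat) := if y == 10 then colon10_data else colon16_data.

Definition good_colon (y : nat) : bool :=
  [&& good_rules (colon_weights y) (colon y), confluent (colon y),
    derivable [:: y] (colon_data y) (colon y), moves_join (colon y) &
    all (fun r => uniq r.1) (colon y)].

Lemma good_colonE y : y \in [:: 10; 16] -> good_colon y.
Proof. by rewrite !inE => /pred2P[] ->; vm_compute. Qed.

Local Notation M := (map monr moves).

Definition groebner_wt r (rR : r \in map monr groebner) :=
  (good_rulesP groebner_good rR).1.

(** A complete invariant of monomials modulo the minors, by [versal_class_rewrites] and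
    [groebner_rewrites]. It is never [None]: the ideal contains no monomial. *)
Definition versal_class : 'X_{1..21} -> option 'X_{1..21} :=
  nf_class (weightD groebner_weights) groebner_wt.

Lemma versal_class_congruence : graded_congruence versal_class.
Proof.
apply: nf_graded_congruence; last exact: confluentP groebner_confluent.
by move=> r rR; have [] := good_rulesP groebner_good rR.
Qed.

Lemma versal_class_rewrites m m' : rewrites M m m' -> versal_class m = versal_class m'.
Proof.
elim=> // m1 m2 m3 [r [u [rM -> ->]]] _ <-.
have [z [z1 z2]] := moves_joinP groebner_moves rM.
congr Some.
exact: (join_nf _ _ (confluentP groebner_confluent) (rewrites_addl u z1)
  (rewrites_addl u z2)).
Qed.

Lemma groebner_rewrites m m' : rewrites (map monr groebner) m m' -> rewrites M m m'.
Proof.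
elim=> [m1|m1 m2 m3 [_ [u [/mapP[r rR ->] -> ->]]] _ IH]; first exact: rewrites_refl.
apply: rewrites_cat IH; have := derivableP groebner_derivable rR.
by rewrite mon_nil !add0m; exact: rewrites_addl.
Qed.

Lemma versal_radical (C : numFieldType) (f : mfps C 21) :
  graded_kernel versal_class (f * f)%R -> graded_kernel versal_class f.
Proof.
pose Y : seq 'I_21 := [:: inord 10; inord 16].
have valY y : y \in Y -> val y \in [:: 10; 16].
  by rewrite !inE => /pred2P[] ->; rewrite /= inordK.
have good y : y \in Y -> good_colon y by move=> /valY /good_colonE.
apply: (@graded_radical _ C _ _ (weightD groebner_weights) groebner_wt _
  (confluentP groebner_confluent) Y (fun y => map monr (colon y))
  (fun y => weight (colon_weights y)) (fun y => weightD (colon_weights y))).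
- by move=> r rR; have [] := good_rulesP groebner_good rR.
- by move=> y r /good /and5P[h _ _ _ _] rS; have [] := good_rulesP h rS.
- by move=> y r /good /and5P[h _ _ _ _] rS; have [] := good_rulesP h rS.
- by move=> y /good /and5P[_ h _ _ _]; exact: confluentP.
- move=> y _ /good /and5P[_ _ _ _ /allP h] /mapP[r /h u ->] i.
  by rewrite monE count_uniq_mem //; case: (_ \in _).
- move=> _ /mapP[r /(allP groebner_squarefree) /and3P[u _ _] ->].
  case/orP: u => [u|u]; first by left=> i; rewrite monE count_uniq_mem //; case: (_ \in _).
  right; case/orP: u => u; [exists (inord 10)|exists (inord 16)];
    by rewrite ?inE ?eqxx ?orbT // monE -has_count has_pred1 /= inordK.
- move=> _ y /mapP[r /(allP groebner_squarefree) /and3P[_ r10 r16] ->] /valY.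
  by rewrite monE !inE => /pred2P[] ->.
- move=> y _ yY /mapP[r rS ->]; have /and5P[_ _ h _ _] := good y yY.
  have := derivableP h rS; rewrite mon1 => /versal_class_rewrites.
  by case.
- move=> y _ yY /mapP[r rR ->] /=; have /and5P[g c _ h _] := good y yY.
  have R_wt r' (rS : r' \in map monr (colon y)) := (good_rulesP g rS).1.
  exists (nf (weightD (colon_weights y)) R_wt (mon 21 r.1)).
  split; first exact: nf_rewrites.
  have := derivableP groebner_derivable rR; rewrite mon_nil !add0m => rw.
  suff -> : nf (weightD (colon_weights y)) R_wt (mon 21 r.1) =
      nf (weightD (colon_weights y)) R_wt (mon 21 r.2) by exact: nf_rewrites.
  elim: rw => // m1 m2 m3 [r' [u [rM -> ->]]] _ <-.
  have [z [z1 z2]] := moves_joinP h rM.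
  exact: (join_nf _ _ (confluentP c) (rewrites_addl u z1) (rewrites_addl u z2)).
Qed.

End Presentations.

Lemma tmatrix_val (p : 'Z_7) i j :
  tmatrix p i j = (if i == 0 then edge_out p j else edge_in p j) :> nat.
Proof.
rewrite mxE /tvar inordK.
  case: p => [[|[|[|[|[|[|[|//]]]]]]] ?]; case: j => [[|[|[|//]]] ?];
  case: i => [[|[|//]] ?]; by vm_compute.
case: p => [[|[|[|[|[|[|[|//]]]]]]] ?]; case: j => [[|[|[|//]]] ?];
  case: i => [[|[|//]] ?]; by vm_compute.
Qed.

Lemma versal_eqnsE (C : numFieldType) g : @versal_eqns C g <->
  exists2 r, r \in minor_moves & g = 'X_[mon 21 r.1] - 'X_[mon 21 r.2].
Proof.
have minorE (p : 'Z_7) (j k : 'I_3) :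
    minor2 (map_mx (fun e : 'I_21 => 'X_e : {mpoly C[21]}) (tmatrix p)) j k =
    'X_[mon 21 (minor_move p j k).1] - 'X_[mon 21 (minor_move p j k).2].
  have -> : (minor_move p j k).1 = mmul [:: edge_out p j] [:: edge_in p k] by [].
  have -> : (minor_move p j k).2 = mmul [:: edge_out p k] [:: edge_in p j] by [].
  rewrite /minor2 ![map_mx _ _ _ _]mxE !mon_mul.
  have U0 (l : 'I_3) : mon 21 [:: edge_out p l] = U_(tmatrix p 0%R l)%MM.
    by rewrite -mon1 -[val _]/(nat_of_ord _) tmatrix_val.
  have U1 (l : 'I_3) : mon 21 [:: edge_in p l] = U_(tmatrix p 1%R l)%MM.
    by rewrite -mon1 -[val _]/(nat_of_ord _) tmatrix_val.
  by rewrite !U0 !U1 !mpolyXD.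
have movesE : minor_moves = [seq minor_move p jk.1 jk.2 | p <- iota 0 7,
    jk <- [:: (0, 1); (0, 2); (1, 2)]%N] by vm_compute.
split=> [[p [j [k [jk ->]]]]|[r]].
  exists (minor_move p j k); last exact: minorE.
  rewrite movesE; apply/allpairsP; exists (val p, (val j, val k)).
  split; [by rewrite mem_iota /= ltn_ord| |by []].
  by case: j k jk => [[|[|[|//]]] ?] [[|[|[|//]]] ?].
rewrite movesE => /allpairsP[[p [j k]] [p7 jk ->] ->].
have {}p7 : (p < 7)%N by move: p7; rewrite mem_iota.
have [j3 k3 jk'] : [/\ (j < 3)%N, (k < 3)%N & (j < k)%N].
  by move: jk; rewrite !inE => /or3P[] /eqP[-> ->].
by exists (Ordinal p7), (Ordinal j3), (Ordinal k3); split=> //; rewrite minorE.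
Qed.

Lemma versal_moves (C : numFieldType) m m' : rewrites (map monr moves) m m' ->
  extended_ideal (@versal_eqns C) (of_mpoly ('X_[m] - 'X_[m'])).
Proof.
elim=> [m1|m1 m2 m3 [_ [u [/mapP[r rM ->] -> ->]]] _ IH].
  by rewrite subrr rmorph0; exact: ideal_span0.
rewrite -(subrKA 'X_[u + (monr r).2]%MM) rmorphD; apply: ideal_spanD => //.
rewrite !mpolyXD -mulrBr rmorphM; apply: ideal_span_mull.
have movesE : moves = minor_moves ++ [seq (r.2, r.1) | r <- minor_moves].
  by vm_compute.
move: rM; rewrite movesE mem_cat => /orP[rM|/mapP[s sM ->]].
  by apply: extended_ideal_gen; apply/versal_eqnsE; exists r.
rewrite -opprB rmorphN; apply: ideal_spanN.
by apply: extended_ideal_gen; apply/versal_eqnsE; exists s.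
Qed.

Lemma versal_base_graded (C : numFieldType) (x : local_ring C 21) :
  x \in versal_base C <-> graded_kernel versal_class x.
Proof.
split=> [/asboolP|/(graded_kernelP versal_class_congruence) h].
  move: x; apply: (@extended_ideal_le C 21 _ (fun x => graded_kernel versal_class x)).
  - by move=> d; rewrite /= raddf0 [LHS]raddf0.
  - by move=> x y; exact: graded_kernelD.
  - by move=> a x; apply: graded_kernel_mull; exact: versal_class_congruence.
  move=> g /versal_eqnsE[r rM ->]; apply: graded_kernel_relation.
    exact: versal_class_congruence.
  exists (mon 21 r.1), (Some (mon 21 r.2)); split=> //; apply/esym.
  apply: versal_class_rewrites; apply: rewrites_trans (rewrites_refl _ _).
  exists (monr r), 0%MM; split; rewrite ?add0m //; apply: map_f.
  suff /allP h : all (fun s => s \in moves) minor_moves by exact: h.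
  by vm_compute.
apply/asboolP; move: x h; apply: extended_ideal_le.
- exact: ideal_span0.
- by move=> x y; exact: ideal_spanD.
- by move=> a x; exact: ideal_span_mull.
move=> _ [m [[m'|] [] // [e] ->]].
have nfM a : rewrites (map monr moves) a (nf (weightD groebner_weights) groebner_wt a).
  by apply/groebner_rewrites/nf_rewrites.
rewrite -(subrKA 'X_[nf (weightD groebner_weights) groebner_wt m]) rmorphD.
apply: ideal_spanD; first exact: versal_moves.
by rewrite -e -opprB rmorphN; apply: ideal_spanN; exact: versal_moves.
Qed.

Lemma versal_base_sqrt (C : numFieldType) (x : local_ring C 21) :
  x * x \in versal_base C -> x \in versal_base C.
Proof.
by move=> /versal_base_graded h; apply/versal_base_graded; exact: versal_radical.
Qed.

(** * The toric ideal and the faces *)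

Section MonomialClass.
Variables (n k : nat) (e : 'I_n -> option 'X_{1..k}).

(** The action on monomials of the substitution [x_i := e i], where [None] stands for 0; its kernel
    is a toric ideal enlarged by variables. *)
Definition monomial_class (m : 'X_{1..n}) : option 'X_{1..k} :=
  if [forall i, (m i == 0%N) || isSome (e i)]
  then Some [multinom (\sum_i m i * odflt 0%MM (e i) j)%N | j < k] else None.

Lemma monomial_classN m :
  monomial_class m = None <-> exists2 i, (0 < m i)%N & e i = None.
Proof.
rewrite /monomial_class; case: forallP => [h|/existsNP[i /negP]].
  by split=> // -[i mi ei]; have := h i; rewrite ei orbF; lia.
rewrite negb_or -lt0n => /andP[mi ei].
by split=> // _; exists i => //; case: (e i) ei.
Qed.

Lemma monomial_classS m w : monomial_class m = Some w ->
  forall j, w j = (\sum_i m i * odflt 0%MM (e i) j)%N.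
Proof. by rewrite /monomial_class; case: ifP => // _ [<-] j; rewrite mnmE. Qed.

Lemma monomial_class0 : monomial_class 0%MM = Some 0%MM.
Proof.
rewrite /monomial_class; case: ifP => [_|/forallP[] i]; last by rewrite mnm0E.
by congr Some; apply/mnmP => j; rewrite mnmE mnm0E big1 // => i _; rewrite mnm0E.
Qed.

Lemma monomial_classD m m' :
  monomial_class (m + m')%MM = add_option (monomial_class m) (monomial_class m').
Proof.
case E: (monomial_class m) => [w|] /=; last first.
  move: E => /monomial_classN[i mi ei]; apply/monomial_classN; exists i => //.
  by rewrite mnmDE; lia.
case E': (monomial_class m') => [w'|] /=; last first.
  move: E' => /monomial_classN[i mi ei]; apply/monomial_classN; exists i => //.
  by rewrite mnmDE; lia.
case E'': (monomial_class (m + m')%MM) => [w''|]; last first.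
  move: E'' => /monomial_classN[i mi ei]; move: mi; rewrite mnmDE addn_gt0.
  case/orP => mi; [have : monomial_class m = None|have : monomial_class m' = None];
    by [apply/monomial_classN; exists i|rewrite ?E ?E'].
congr Some; apply/mnmP => j; rewrite mnmDE (monomial_classS E'') (monomial_classS E).
rewrite (monomial_classS E') -big_split; apply: eq_bigr => i _.
by rewrite mnmDE mulnDl.
Qed.

Lemma monomial_classU i : monomial_class U_(i)%MM = e i.
Proof.
case E: (e i) => [w|]; last by apply/monomial_classN; exists i; rewrite ?mnm1E ?eqxx.
case E': (monomial_class U_(i)%MM) => [w'|]; last first.
  by move: E' => /monomial_classN[l]; rewrite mnm1E lt0b => /eqP <-; rewrite E.
congr Some; apply/mnmP => j; rewrite (monomial_classS E') (bigD1 i) //=.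
rewrite mnm1E eqxx mul1n E /= big1 ?addn0 // => l li.
by rewrite mnm1E eq_sym (negbTE li).
Qed.

Variable D : pred 'I_k.
Hypothesis e_deg : forall i w, e i = Some w -> (\sum_(j | D j) w j)%N = 1%N.

(** Each variable has an image of degree 1 in the variables of [D], so the degree of [m] can be read
    off its class and the kernel is homogeneous. *)
Lemma monomial_class_deg m w : monomial_class m = Some w ->
  mdeg m = (\sum_(j | D j) w j)%N.
Proof.
move=> E; rewrite (eq_bigr _ (fun j _ => monomial_classS E j)) exchange_big mdegE.
apply: eq_bigr => i _; rewrite -big_distrr /=.
case ei: (e i) => [v|] /=; first by rewrite (e_deg ei) muln1.
case mi: (m i) => [//|a].
have : monomial_class m = None by apply/monomial_classN; exists i; rewrite ?mi.
by rewrite E.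
Qed.

Lemma monomial_class_congruence : graded_congruence monomial_class.
Proof.
split=> [u m m' h|u m h|m m' h].
- by rewrite !monomial_classD h.
- by rewrite monomial_classD h; case: (monomial_class u).
case E: (monomial_class m) h => [w|//] /esym E' _.
by rewrite (monomial_class_deg E) (monomial_class_deg E').
Qed.

End MonomialClass.

Section ComponentClasses.
Local Open Scope nat_scope.

(* The edges of each species [a], followed from the vertex 0, are mapped to
   [y_a], [y_a z_a], [y_a z_a z_2a], ..., where [y_a] is the variable [a] and
   [z_q] the variable [2 + q]; this parametrizes the smoothing component. *)
Definition toric_table : seq (seq nat) := Eval vm_compute in
  let exps := [seq (edge_out (k * nth 0 [:: 1; 4; 2] a %% 7) a,
      a :: [seq 2 + (l * nth 0 [:: 1; 4; 2] a) %% 7 | l <- iota 1 k])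
    | a <- iota 0 3, k <- iota 0 7] in
  [seq foldr insert [::] (flatten [seq e.2 | e <- exps & e.1 == i]) | i <- iota 0 21].

(* The star of [p], whose edges stay subject to the minors at [p] only, and the
   edges [es], which are then free. *)
Definition face (p : nat) (es : seq (nat * nat)) : seq nat :=
  [seq edge_out p j | j <- iota 0 3] ++ [seq edge_in p j | j <- iota 0 3] ++
  [seq edge ((p + e.1) %% 7) ((p + e.2) %% 7) | e <- es].

(** Position [4 * p + k] holds the [k]-th face at [p]. The first edge set joins each [p + x] to
    [p - x]; the other three are permuted by multiplication by 2. This makes 7 faces of size 9 and
    21 of size 10. *)
Definition faces : seq (seq nat) := Eval vm_compute in
  [seq face p es | p <- iota 0 7, es <-
    [:: [:: (6, 1); (5, 2); (3, 4)]; [:: (1, 2); (5, 2); (5, 6); (3, 4)];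
        [:: (2, 4); (3, 4); (3, 5); (6, 1)]; [:: (4, 1); (6, 1); (6, 3); (5, 2)]]].

(* The coordinates of a face are, in order, the 2 x 3 entries [x_i y_j] of the
   Segre cone, followed by those of the affine factor. *)
Definition segre_exponent (l : nat) : seq nat :=
  if l < 6 then [:: l %/ 3; 2 + l %% 3] else [:: l.-1].

Definition comp_table (c i : nat) : option (seq nat) :=
  if c is c'.+1 then
    let F := nth [::] faces c' in
    if i \in F then Some (segre_exponent (index i F)) else None
  else Some (nth [::] toric_table i).

Definition comp_exponent (c : nat) (i : 'I_21) : option 'X_{1..9} :=
  omap (mon 9) (comp_table c i).

Definition comp_class (c : nat) : 'X_{1..21} -> option 'X_{1..9} :=
  monomial_class (comp_exponent c).

(** These are the [y_a] for the toric component; for a face they are the [x_i] of the Segre cone and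
    the affine coordinates. *)
Definition graded_vars (c : nat) : pred nat :=
  fun j => if c == 0 then j < 3 else (j < 2) || (4 < j).

Lemma comp_table_deg : all (fun c => all (fun i =>
    if comp_table c i is Some s then (count (graded_vars c) s == 1) && all (fun x => x < 9) s
    else true) (iota 0 21)) (iota 0 29).
Proof. by vm_compute. Qed.

Lemma mon_count k (D : pred nat) s : all (fun x => x < k) s ->
  \sum_(j < k | D (val j)) mon k s j = count D s.
Proof.
move=> sk; rewrite -sum1_count big_mkcond [RHS]big_mkcond /=.
transitivity (\sum_(j < k) D j * mon k s j).
  by apply: eq_bigr => j _; case: (D _); rewrite ?mul1n ?mul0n.
by rewrite (mon_sum (fun j => D j : nat)).
Qed.

Lemma comp_class_congruence c : c < 29 -> graded_congruence (comp_class c).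
Proof.
move=> c29; apply: (@monomial_class_congruence _ _ _ (fun j => graded_vars c (val j))).
move=> i w; rewrite /comp_exponent; case E: comp_table => [s|//] [<-].
have /allP /(_ c) := comp_table_deg; rewrite mem_iota c29 => /(_ isT) /allP /(_ (val i)).
rewrite mem_iota ltn_ord => /(_ isT); rewrite E => /andP[/eqP cs s9].
by rewrite mon_count.
Qed.

Fixpoint class_list (c : nat) (s : seq nat) : option (seq nat) :=
  if s is x :: s' then
    match comp_table c x, class_list c s' with
    | Some a, Some b => Some (mmul a b)
    | _, _ => None
    end
  else Some [::].

Lemma class_listE c s : all (fun x => x < 21) s ->
  comp_class c (mon 21 s) = omap (mon 9) (class_list c s).
Proof.
elim: s => [_|x s IH /= /andP[x21 s21]].
  by rewrite mon_nil /comp_class monomial_class0 /= mon_nil.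
have -> : comp_class c (mon 21 (x :: s)) =
    add_option (comp_class c (mon 21 [:: x])) (comp_class c (mon 21 s)).
  by rewrite mon_cons /comp_class monomial_classD.
have -> : comp_class c (mon 21 [:: x]) = omap (mon 9) (comp_table c x).
  by rewrite -[x in LHS]/(val (Ordinal x21)) mon1 /comp_class monomial_classU.
rewrite IH //; case: (comp_table c x) => [a|] //=.
by case: (class_list c s) => [b|] //=; rewrite mon_mul.
Qed.

End ComponentClasses.

(** * The 29 primes and their incomparability *)

Section MonomialMembership.
Variables (C : numFieldType) (n k : nat) (kap : 'X_{1..n} -> option 'X_{1..k}).
Hypothesis kapP : graded_congruence kap.

Lemma oX_inj : injective (@oX C k).
Proof.
move=> [w|] [w'|] //= => [||] /(congr1 (mcoeff _)).
- move=> /(_ w); rewrite !mcoeffX eqxx; case: eqP => [-> //|_ /eqP].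
  by rewrite oner_eq0.
- move=> /(_ w); rewrite mcoeffX eqxx mcoeff0 => /eqP.
  by rewrite oner_eq0.
- move=> /(_ w'); rewrite mcoeffX eqxx mcoeff0 => /eqP.
  by rewrite eq_sym oner_eq0.
Qed.

Lemma graded_kernel_X m : graded_kernel kap (mfps_of_mpoly 'X_[m] : mfps C n) <->
  kap m = None.
Proof.
split=> [/(_ (mdeg m))|km].
  by rewrite hpart_mpolyX eqxx collapseX -[0]/(oX C None) => /oX_inj.
have -> : 'X_[m] = 'X_[m] - oX C None :> {mpoly C[n]} by rewrite subr0.
by apply: graded_kernel_relation => //; exists m, None.
Qed.

Lemma graded_kernel_binomial m m' : mdeg m = mdeg m' ->
  graded_kernel kap (mfps_of_mpoly ('X_[m] - 'X_[m']) : mfps C n) <-> kap m = kap m'.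
Proof.
move=> mm'; split=> [/(_ (mdeg m))|km].
  rewrite mfps_of_mpolyB (raddfB (hpart (mdeg m))) /= !hpart_mpolyX eqxx mm' eqxx.
  move=> /eqP; rewrite [X in X == _](raddfB (collapse kap)) subr_eq0 /=.
  by rewrite !collapseX => /eqP /oX_inj.
by apply: graded_kernel_relation => //; exists m, (Some m').
Qed.

End MonomialMembership.

Lemma comp_prime_exists (C : numFieldType) (c : nat) : (c < 29)%N ->
  exists P : prime_idealr (local_ring C 21),
    forall x : local_ring C 21, x \in P <-> graded_kernel (comp_class c) x.
Proof.
move=> c29; apply: graded_kernel_prime_ideal.
- exact: comp_class_congruence.
- exact: monomial_classD.
- exact: monomial_class0.
Qed.

Definition comp_prime (C : numFieldType) (c : 'I_29) : prime_idealr (local_ring C 21) :=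
  projT1 (cid (comp_prime_exists C (ltn_ord c))).

Lemma comp_primeP (C : numFieldType) (c : 'I_29) (x : local_ring C 21) :
  x \in comp_prime C c <-> graded_kernel (comp_class c) x.
Proof. by rewrite /comp_prime; case: cid => P. Qed.

Section Components.
Variable C : numFieldType.
Implicit Types (c : 'I_29) (m : 'X_{1..21}).
Local Notation P := (comp_prime C).

Local Open Scope nat_scope.

Lemma comp_moves : all (fun d => all (fun r => class_list d r.1 == class_list d r.2)
  minor_moves) (iota 0 29).
Proof. by vm_compute. Qed.

Lemma minor_moves_deg : all (fun r => [&& all (fun x => x < 21) r.1,
  all (fun x => x < 21) r.2 & size r.1 == size r.2]) minor_moves.
Proof. by vm_compute. Qed.

Lemma versal_sub_comp c : {subset versal_base C <= P c}.
Proof.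
move=> x /asboolP; move: x.
apply: (@extended_ideal_le C 21 _ (fun x => x \in P c)).
- exact: idealr0.
- by move=> x y; exact: rpredD.
- by move=> a x; exact: idealMr.
move=> _ /versal_eqnsE[r rM ->]; apply/comp_primeP.
have /allP /(_ r rM) /and3P[r1 r2 /eqP sz] := minor_moves_deg.
apply/graded_kernel_binomial; first exact: comp_class_congruence.
  by rewrite !mdeg_mon.
rewrite !class_listE //; have /allP /(_ (val c)) := comp_moves.
by rewrite mem_iota ltn_ord => /(_ isT) /allP /(_ r rM) /eqP ->.
Qed.

(** The [j]-th binomial lies in the toric prime but not in the prime of the [j]-th face. *)
Definition toric_cubics : seq rule :=
  [:: ([:: 0; 9; 12], [:: 2; 6; 20]); ([:: 0; 9; 12], [:: 2; 6; 20]);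
    ([:: 0; 8; 13], [:: 1; 9; 16]); ([:: 1; 7; 18], [:: 6; 12; 16]);
    ([:: 0; 14; 18], [:: 5; 7; 15]); ([:: 0; 14; 18], [:: 5; 7; 15]);
    ([:: 0; 13; 19], [:: 1; 14; 16]); ([:: 1; 7; 18], [:: 6; 12; 16]);
    ([:: 1; 4; 20], [:: 2; 10; 19]); ([:: 0; 9; 12], [:: 2; 6; 20]);
    ([:: 1; 4; 20], [:: 2; 10; 19]); ([:: 1; 11; 18], [:: 4; 6; 12]);
    ([:: 3; 8; 11], [:: 6; 13; 17]); ([:: 2; 3; 14], [:: 9; 11; 15]);
    ([:: 4; 8; 15], [:: 5; 10; 16]); ([:: 3; 8; 11], [:: 6; 13; 17]);
    ([:: 0; 8; 13], [:: 1; 9; 16]); ([:: 0; 9; 17], [:: 5; 6; 20]);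
    ([:: 0; 8; 13], [:: 1; 9; 16]); ([:: 3; 8; 11], [:: 6; 13; 17]);
    ([:: 2; 3; 14], [:: 9; 11; 15]); ([:: 2; 3; 14], [:: 9; 11; 15]);
    ([:: 1; 4; 14], [:: 2; 13; 19]); ([:: 3; 11; 19], [:: 7; 13; 17]);
    ([:: 5; 7; 10], [:: 0; 13; 17]); ([:: 0; 14; 17], [:: 5; 7; 20]);
    ([:: 4; 8; 15], [:: 5; 10; 16]); ([:: 3; 12; 16], [:: 7; 10; 18])].

Definition classes_differ (o o' : option (seq nat)) : bool :=
  match o, o' with
  | Some a, Some b => has (fun x => count_mem x a != count_mem x b) (iota 0 9)
  | None, None => false
  | _, _ => true
  end.

Lemma classes_differP o o' : classes_differ o o' -> omap (mon 9) o <> omap (mon 9) o'.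
Proof.
case: o o' => [a|] [b|]; [|by move=> _; discriminate..|by []].
move=> /hasP[x]; rewrite mem_iota => x9 /eqP ab /Some_inj.
by move=> /mnmP /(_ (Ordinal x9)); rewrite !monE.
Qed.

Lemma toric_not_in_face : all (fun j => let r := nth ([::], [::]) toric_cubics j in
  [&& all (fun x => x < 21) r.1, all (fun x => x < 21) r.2, size r.1 == size r.2,
   class_list 0 r.1 == class_list 0 r.2 &
   classes_differ (class_list j.+1 r.1) (class_list j.+1 r.2)]) (iota 0 28).
Proof. by vm_compute. Qed.

Lemma faces_differ : all (fun d => all (fun d' => (d == d') ||
  has (fun x => ~~ isSome (comp_table d x) && isSome (comp_table d' x)) (iota 0 21))
  (iota 0 29)) (iota 1 28).
Proof. by vm_compute. Qed.

(** The prime of a face contains a variable off that face which is missing from [P c']. The toric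
    prime contains no variable and is separated from the faces by [toric_cubics]. *)
Lemma comp_incomparable c c' : c != c' -> exists x, x \in P c /\ x \notin P c'.
Proof.
move=> cc'; have [c0|c1] := posnP c.
  have c'1 : 0 < c'.
    by rewrite lt0n; apply: contra cc' => /eqP c'0; apply/eqP/val_inj; rewrite /= c0 c'0.
  have /allP /(_ (nat_of_ord c').-1) := toric_not_in_face.
  have c'28 : (nat_of_ord c').-1 < 28 by have := ltn_ord c'; lia.
  rewrite mem_iota c'28 /= prednK // => /(_ isT).
  case: nth => l r /= /and5P[l21 r21 /eqP sz /eqP e /classes_differP d].
  exists (of_mpoly ('X_[mon 21 l] - 'X_[mon 21 r])%R).
  have dE : mdeg (mon 21 l) = mdeg (mon 21 r) by rewrite !mdeg_mon.
  split; [|apply/negP => /comp_primeP h].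
    apply/comp_primeP/graded_kernel_binomial => //; first exact: comp_class_congruence.
    by rewrite !class_listE // c0 e.
  apply: d; rewrite -!class_listE //; apply/(@graded_kernel_binomial C) => //.
  exact: comp_class_congruence.
have /allP /(_ (val c)) := faces_differ; rewrite mem_iota c1 ltn_ord => /(_ isT) /allP.
move=> /(_ (val c')); rewrite mem_iota ltn_ord => /(_ isT).
rewrite val_eqE (negbTE cc') orFb => /hasP[x]; rewrite mem_iota => x21 /andP[xc xc'].
pose i := Ordinal x21.
have classE d : comp_class d U_(i)%MM = None <-> comp_table d x = None.
  rewrite monomial_classN; split=> [[l]|dN].
    rewrite mnm1E lt0b => /eqP <-; rewrite /comp_exponent /=.
    by case: comp_table.
  by exists i; rewrite ?mnm1E ?eqxx // /comp_exponent /= dN.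
exists (of_mpoly 'X_i%R); split; [|apply/negP => /comp_primeP h].
  apply/comp_primeP/graded_kernel_X; first exact: comp_class_congruence.
  by apply/classE; case: comp_table xc.
have : comp_class c' U_(i)%MM = None.
  apply/(@graded_kernel_X C); first exact: comp_class_congruence.
  exact: h.
by move/classE => e; rewrite e in xc'.
Qed.

End Components.

(** * Primes containing the minors *)

Section Supports.
Local Open Scope nat_scope.

(* Weights defining, up to the symmetry group of order 42, the faces of the cone
   of the smoothing component which are not contained in a face of [faces]. *)
Definition weight_orbits : seq (seq nat) :=
  [:: [:: 9; 3; 6; 0; 3; 3; 3; 6; 0; 0; 0; 3; 3; 0; 3; 6; 6; 0; 3; 3; 3];
      [:: 10; 3; 7; 0; 3; 4; 3; 6; 0; 1; 0; 3; 3; 0; 4; 7; 6; 0; 3; 3; 4];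
      [:: 8; 3; 5; 1; 2; 2; 4; 6; 0; 0; 0; 3; 3; 0; 2; 5; 5; 0; 3; 2; 2];
      [:: 9; 3; 6; 1; 2; 3; 4; 6; 0; 1; 0; 3; 3; 0; 3; 6; 5; 0; 3; 2; 3];
      [:: 8; 3; 5; 1; 3; 2; 4; 7; 0; 0; 0; 4; 3; 1; 3; 5; 6; 0; 3; 3; 2];
      [:: 8; 6; 5; 2; 0; 2; 5; 3; 3; 2; 3; 0; 3; 0; 0; 5; 3; 0; 2; 1; 3];
      [:: 7; 5; 4; 2; 0; 1; 5; 4; 2; 1; 2; 1; 3; 0; 0; 4; 3; 0; 2; 1; 2];
      [:: 6; 3; 3; 3; 0; 0; 6; 6; 0; 0; 0; 3; 3; 0; 0; 3; 3; 0; 3; 0; 0];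
      [:: 6; 3; 3; 4; 0; 0; 7; 7; 0; 0; 0; 4; 4; 0; 0; 3; 3; 1; 4; 0; 0];
      [:: 7; 3; 4; 3; 0; 1; 6; 6; 0; 1; 0; 3; 3; 0; 1; 4; 3; 0; 3; 0; 1];
      [:: 7; 3; 4; 4; 0; 1; 7; 7; 0; 1; 0; 4; 4; 0; 1; 4; 3; 1; 4; 0; 1];
      [:: 6; 4; 3; 2; 0; 0; 5; 5; 1; 0; 1; 2; 3; 0; 0; 3; 3; 0; 2; 1; 1];
      [:: 6; 3; 3; 3; 0; 0; 5; 5; 0; 0; 1; 2; 3; 0; 0; 4; 3; 0; 3; 0; 1];
      [:: 6; 3; 3; 4; 0; 0; 6; 6; 0; 0; 1; 3; 4; 0; 0; 4; 3; 1; 4; 0; 1];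
      [:: 7; 3; 4; 3; 0; 1; 5; 5; 0; 1; 1; 2; 3; 0; 1; 5; 3; 0; 3; 0; 2];
      [:: 7; 3; 4; 4; 0; 1; 6; 6; 0; 1; 1; 3; 4; 0; 1; 5; 3; 1; 4; 0; 2];
      [:: 6; 6; 3; 0; 0; 0; 3; 3; 3; 0; 3; 0; 3; 0; 0; 3; 3; 0; 0; 3; 3];
      [:: 6; 7; 3; 0; 1; 0; 3; 3; 4; 0; 4; 0; 3; 1; 0; 3; 4; 0; 0; 4; 3];
      [:: 6; 5; 3; 1; 0; 0; 3; 3; 2; 0; 3; 0; 3; 0; 0; 4; 3; 0; 1; 2; 3];
      [:: 6; 6; 3; 1; 1; 0; 3; 3; 3; 0; 4; 0; 3; 1; 0; 4; 4; 0; 1; 3; 3];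
      [:: 6; 3; 3; 3; 0; 0; 3; 3; 0; 0; 3; 0; 3; 0; 0; 6; 3; 0; 3; 0; 3];
      [:: 7; 3; 4; 3; 0; 1; 3; 3; 0; 1; 3; 0; 3; 0; 1; 7; 3; 0; 3; 0; 4];
      [:: 6; 3; 3; 2; 0; 0; 5; 6; 0; 0; 0; 3; 3; 0; 1; 3; 3; 0; 2; 1; 1];
      [:: 7; 3; 4; 2; 0; 1; 5; 6; 0; 1; 0; 3; 3; 0; 2; 4; 3; 0; 2; 1; 2];
      [:: 8; 6; 5; 4; 0; 2; 6; 3; 3; 3; 4; 0; 3; 1; 0; 6; 3; 0; 3; 0; 3];
      [:: 9; 6; 6; 4; 0; 3; 6; 3; 3; 4; 4; 0; 3; 1; 1; 7; 3; 0; 3; 0; 4];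
      [:: 7; 6; 4; 3; 0; 1; 6; 4; 3; 2; 3; 1; 3; 1; 0; 4; 3; 0; 2; 1; 2];
      [:: 6; 4; 3; 4; 0; 0; 4; 3; 1; 1; 4; 0; 3; 1; 0; 6; 3; 0; 3; 0; 3];
      [:: 5; 3; 2; 2; 0; 0; 5; 5; 1; 0; 0; 2; 2; 0; 0; 2; 3; 0; 2; 1; 0];
      [:: 5; 3; 2; 3; 0; 0; 6; 6; 1; 0; 0; 3; 3; 0; 0; 2; 3; 1; 3; 1; 0];
      [:: 6; 3; 3; 2; 0; 1; 5; 5; 1; 1; 0; 2; 2; 0; 1; 3; 3; 0; 2; 1; 1];
      [:: 5; 3; 2; 1; 0; 0; 4; 5; 1; 0; 0; 2; 2; 0; 1; 2; 3; 0; 1; 2; 1];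
      [:: 5; 3; 2; 0; 0; 0; 3; 5; 1; 0; 0; 2; 2; 0; 2; 2; 3; 0; 0; 3; 2];
      [:: 6; 3; 3; 0; 0; 1; 3; 5; 1; 1; 0; 2; 2; 0; 3; 3; 3; 0; 0; 3; 3];
      [:: 3; 3; 0; 0; 0; 0; 3; 3; 3; 0; 0; 0; 0; 0; 0; 0; 3; 0; 0; 3; 0];
      [:: 3; 3; 0; 1; 0; 0; 4; 4; 3; 0; 0; 1; 1; 0; 0; 0; 3; 1; 1; 3; 0];
      [:: 3; 4; 0; 0; 1; 0; 3; 3; 4; 0; 1; 0; 0; 1; 0; 0; 4; 0; 0; 4; 0];
      [:: 3; 4; 0; 1; 1; 0; 4; 4; 4; 0; 1; 1; 1; 1; 0; 0; 4; 1; 1; 4; 0];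
      [:: 4; 3; 1; 0; 0; 1; 3; 3; 3; 1; 0; 0; 0; 0; 1; 1; 3; 0; 0; 3; 1];
      [:: 4; 4; 1; 0; 1; 1; 3; 3; 4; 1; 1; 0; 0; 1; 1; 1; 4; 0; 0; 4; 1];
      [:: 3; 2; 0; 1; 0; 0; 3; 3; 2; 0; 0; 0; 0; 0; 0; 1; 3; 0; 1; 2; 0];
      [:: 3; 2; 0; 2; 0; 0; 4; 4; 2; 0; 0; 1; 1; 0; 0; 1; 3; 1; 2; 2; 0];
      [:: 3; 1; 0; 1; 0; 0; 2; 3; 1; 0; 0; 0; 0; 0; 1; 2; 3; 0; 1; 2; 1];
      [:: 0; 0; 0; 0; 0; 0; 0; 0; 0; 0; 0; 0; 0; 0; 0; 0; 0; 0; 0; 0; 0];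
      [:: 0; 0; 0; 1; 0; 0; 1; 1; 0; 0; 0; 1; 1; 0; 0; 0; 0; 1; 1; 0; 0];
      [:: 0; 1; 0; 1; 1; 0; 1; 1; 1; 0; 1; 1; 1; 1; 0; 0; 1; 1; 1; 1; 0]].

Definition edges : seq (nat * nat) :=
  flatten [seq [seq (p, q) | p <- iota 0 q] | q <- iota 0 7].

(* The affine maps [x |-> u x + v] of [Z/7] permute the minors. *)
Definition act (u v : nat) (w : seq nat) : seq nat :=
  [seq nth 0 w (edge ((u * e.1 + v) %% 7) ((u * e.2 + v) %% 7)) | e <- edges].

Definition weights : seq (seq nat) := Eval vm_compute in
  [seq act uv.1 uv.2 w | w <- weight_orbits,
    uv <- [seq (u, v) | u <- iota 1 6, v <- iota 0 7]].

Definition zeros (w : seq nat) : seq bool := [seq Nat.eqb x 0 | x <- w].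

Definition supports : seq (seq bool) := Eval vm_compute in map zeros weights.

Definition face_bits : seq (seq bool) := Eval vm_compute in
  [seq [seq (x \in F) | x <- iota 0 21] | F <- faces].

Fixpoint sub_bits (s t : seq bool) : bool :=
  match s, t with
  | b :: s', b' :: t' => if b then (if b' then sub_bits s' t' else false) else sub_bits s' t'
  | _, _ => true
  end.

Fixpoint same_bits (s t : seq bool) : bool :=
  match s, t with
  | [::], [::] => true
  | b :: s', b' :: t' => if b then (if b' then same_bits s' t' else false)
                         else (if b' then false else same_bits s' t')
  | _, _ => false
  end.

(* Under call by value, [has] would not stop at the first success. *)
Fixpoint has_lazy (T : Type) (a : T -> bool) (s : seq T) : bool :=
  if s is x :: s' then if a x then true else has_lazy a s' else false.

Definition classified (s : seq bool) : bool :=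
  has_lazy (sub_bits s) face_bits || has_lazy (same_bits s) supports.

(** Both sides of a minor have the same value in a domain, so the variables of one are all nonzero
    exactly when those of the other are. *)
Definition respects (s : seq bool) (r : rule) : bool :=
  eqb (all (nth false s) r.1) (all (nth false s) r.2).

(** Filed by its largest variable, a minor is tested as soon as the last of its bits has been
    chosen. *)
Definition moves_by_max : seq (seq rule) := Eval vm_compute in
  [seq [seq r <- minor_moves | foldr maxn 0 (r.1 ++ r.2) == x] | x <- iota 0 21].

(* The branch-and-bound enumeration of the sets of variables that can be the
   nonzero ones at a point of the versal base. *)
Fixpoint search (k : nat) (s : seq bool) : bool :=
  if k is k'.+1 then
    let branch b := let s' := rcons s b in
      if all (respects s') (nth [::] moves_by_max (size s)) then search k' s' else true in
    branch true && branch false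
  else classified s.

(* The gate [(p, a)] is the column [a] of the matrix at the vertex [p]: the edge
   leaving [p] and the edge entering [p] of species [a]. *)
Definition gates : seq (nat * nat) := Eval vm_compute in
  [seq (p, a) | p <- iota 0 7, a <- iota 0 3].

Definition g_out (g : nat * nat) := edge_out g.1 g.2.
Definition g_in (g : nat * nat) := edge_in g.1 g.2.
Definition g_next (g : nat * nat) := ((g.1 + nth 0 [:: 1; 4; 2] g.2) %% 7, g.2).

(* For each gate [3 p + a]: its two edges, the next and the previous gate of
   the same species, and the other two gates at [p]. *)
Definition gate_table : seq (nat * nat * (nat * nat) * (nat * nat)) := Eval vm_compute in
  let num g := 3 * g.1 + g.2 in
  [seq (g_out g, g_in g,
        (num (g_next g), num ((g.1 + nth 0 [:: 6; 3; 5] g.2) %% 7, g.2)),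
        (num (g.1, (g.2 + 1) %% 3), num (g.1, (g.2 + 2) %% 3))) | g <- gates].

(* Gates where a flow must vanish: the flows of the three gates at a vertex add
   up to 0, and consecutive gates have equal flows unless the edge between them
   is in [s]. *)
Definition zero_step (s z : seq bool) : seq bool :=
  [seq let: (x, b) := xb in let: (eo, ei, (nx, pv), (g1, g2)) := x in
     if b then true
     else if nth false z g1 && nth false z g2 then true
     else if ~~ nth false s eo && nth false z nx then true
     else ~~ nth false s ei && nth false z pv | xb <- zip gate_table z].

(** The propagation starts from two gates at which the flow is normalized to 0; the 12 rounds
    suffice for [good_weights]. *)
Definition zero_gates (s : seq bool) (g g' : nat) : seq bool :=
  iter 12 (zero_step s) [seq Nat.eqb x g || Nat.eqb x g' | x <- iota 0 21].

Definition open_gate (s : seq bool) (x : nat * nat * (nat * nat) * (nat * nat)) :=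
  nth false s x.1.1.1 && nth false s x.1.1.2.

(** A gate which may carry flow must be open: its two variables are then nonzero and can be
    cancelled in a domain. *)
Definition all_closed (s : seq bool) (g g' : nat) : bool :=
  all (fun xb => open_gate s xb.1 || xb.2) (zip gate_table (zero_gates s g g')).

(** Pairs of gates of different species, the largest sets of gates at which constants with sum 0,
    one per species, can always make a flow vanish. *)
Definition anchors : seq (nat * nat) :=
  [seq (3 * pq.1 + ij.1, 3 * pq.2 + ij.2) | ij <- [:: (0, 1); (0, 2); (1, 2)],
    pq <- [seq (p, q) | p <- iota 0 7, q <- iota 0 7]].

Definition good_weight (w : seq nat) : bool :=
  all (fun r => Nat.eqb (sumn [seq nth 0 w x | x <- r.1]) (sumn [seq nth 0 w x | x <- r.2]))
    minor_moves &&
  has_lazy (fun gg => all_closed (zeros w) gg.1 gg.2) anchors.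

Lemma search_true : search 21 [::].
Proof. by vm_compute. Qed.

Lemma good_weights : all good_weight weights.
Proof. by vm_compute. Qed.

Lemma has_lazyE (T : Type) (a : T -> bool) s : has_lazy a s = has a s.
Proof. by elim: s => //= x s ->; case: (a x). Qed.

Lemma moves_by_max_bound : all (fun x => all (fun r =>
  all (fun y => y <= x) (r.1 ++ r.2) && (r \in minor_moves)) (nth [::] moves_by_max x))
  (iota 0 21).
Proof. by vm_compute. Qed.

Lemma searchP k s s' : search k s -> size s' = k ->
  (forall r, r \in minor_moves -> respects (s ++ s') r) -> classified (s ++ s').
Proof.
elim: k s s' => [|k IH] s s'; first by move=> h /size0nil ->; rewrite cats0.
case: s' => [|b s'] // /andP[bt bf] [sk] res.
have : if all (respects (rcons s b)) (nth [::] moves_by_max (size s))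
    then search k (rcons s b) else true by case: b res.
rewrite -cat_rcons; case: ifP => [_ h|/negP[]].
  by apply: IH => // r rM; rewrite cat_rcons; exact: res.
apply/allP => r rk; have [sz|sz] := ltnP (size s) 21; last first.
  by move: rk; rewrite nth_default.
have /allP /(_ (size s)) := moves_by_max_bound; rewrite mem_iota sz => /(_ isT).
move=> /allP /(_ r rk) /andP[/allP le_r /res]; rewrite /respects -cat_rcons.
have nthE x : x \in r.1 ++ r.2 -> nth false (rcons s b ++ s') x = nth false (rcons s b) x.
  by move=> /le_r xs; rewrite nth_cat size_rcons ltnS xs.
rewrite (eq_in_all (a2 := nth false (rcons s b))) => [|x xr]; last first.
  by apply: nthE; rewrite mem_cat xr.
rewrite (eq_in_all (a2 := nth false (rcons s b)) (s := r.2)) // => x xr.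
by apply: nthE; rewrite mem_cat xr orbT.
Qed.

Lemma respects_classified s : size s = 21 ->
  (forall r, r \in minor_moves -> respects s r) -> classified s.
Proof. by move=> sz; exact: (@searchP 21 [::] s search_true sz). Qed.

Lemma sub_bitsP s t : size s = size t -> sub_bits s t ->
  forall i, nth false s i -> nth false t i.
Proof.
elim: s t => [|b s IH] [|b' t] // [sz].
by case: b b' => [] [] //= h [|i] //=; exact: IH.
Qed.

Lemma same_bitsP s t : same_bits s t -> s = t.
Proof. by elim: s t => [|b s IH] [|b' t] //=; case: b b' => [] [] // /IH ->. Qed.

Lemma classifiedP s : size s = 21 -> classified s ->
  (exists2 j, j < 28 & forall x, nth false s x -> x \in nth [::] faces j) \/
  (exists2 w, w \in weights & s = zeros w).
Proof.
move=> sz; rewrite /classified !has_lazyE => /orP[/hasP[t tf st]|/hasP[t tS st]].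
  have fE : face_bits = [seq [seq (x \in F) | x <- iota 0 21] | F <- faces].
    by vm_compute.
  move: tf; rewrite fE => /mapP[F Ff tE]; left; exists (index F faces).
    by rewrite (_ : 28 = size faces) // index_mem.
  move=> x sx; rewrite nth_index //.
  have x21 : x < 21 by rewrite -sz ltnNge; apply/negP => h; rewrite nth_default in sx.
  have := sub_bitsP _ st sx; rewrite tE (nth_map 0) ?size_iota // nth_iota // add0n.
  by apply; rewrite sz size_map size_iota.
have sE : supports = map zeros weights by vm_compute.
by move: tS; rewrite sE => /mapP[w ww tE]; right; exists w; rewrite -?tE //; exact: same_bitsP.
Qed.

End Supports.

Definition mexp (m : 'X_{1..21}) (x : nat) : nat := nth 0%N (multinom_val m) x.

Lemma mexpE (m : 'X_{1..21}) (i : 'I_21) : mexp m i = m i.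
Proof. by rewrite (mnm_nth 0%N). Qed.

Lemma mexp_default (m : 'X_{1..21}) x : (21 <= x)%N -> mexp m x = 0%N.
Proof. by move=> x21; rewrite /mexp nth_default // size_tuple. Qed.

Lemma sum_mexp (F : nat -> nat) (m : 'X_{1..21}) :
  (\sum_(i < 21) m i * F i = \sum_(x <- iota 0 21) mexp m x * F x)%N.
Proof.
rewrite -[iota 0 21]/(index_iota 0 21) big_mkord.
by apply: eq_bigr => i _; rewrite mexpE.
Qed.

Lemma mon_mexp m : mon 21 (flatten [seq nseq (mexp m x) x | x <- iota 0 21]) = m.
Proof.
apply/mnmP => i; rewrite monE count_flatten -map_comp sumnE big_map.
rewrite (bigD1_seq (val i)) ?iota_uniq ?mem_iota ?ltn_ord //= count_nseq /= eqxx.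
rewrite mul1n mexpE big1 ?addn0 // => x /negbTE xi.
by rewrite count_nseq /= xi.
Qed.

(** * Evaluations of monomials compatible with the minors *)

Section SwapProducts.
Variables (D : comNzRingType) (ev : 'X_{1..21} -> D).
Hypothesis ev0 : ev 0%MM = 1.
Hypothesis evD : forall m m', ev (m + m')%MM = ev m * ev m'.
Hypothesis evM : forall r, r \in minor_moves -> ev (mon 21 r.1) = ev (mon 21 r.2).

Definition ev_var (x : nat) : D := ev (mon 21 [:: x]).

Lemma ev_mon s : ev (mon 21 s) = \prod_(x <- s) ev_var x.
Proof.
elim: s => [|x s IH]; first by rewrite mon_nil big_nil.
by rewrite mon_cons evD big_cons IH.
Qed.

Lemma ev_flatten (I : eqType) (s : seq I) (f : I -> seq nat) :
  ev (mon 21 (flatten [seq f i | i <- s])) = \prod_(i <- s) \prod_(x <- f i) ev_var x.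
Proof. by rewrite ev_mon big_flatten big_map. Qed.

Lemma prod_nseq k x : \prod_(y <- nseq k x) ev_var y = ev_var x ^+ k.
Proof. by rewrite big_nseq -Monoid.iteropE. Qed.

Lemma evE m : ev m = \prod_(x <- iota 0 21) ev_var x ^+ mexp m x.
Proof.
by rewrite -[in LHS](mon_mexp m) ev_flatten; apply: eq_bigr => x _; rewrite prod_nseq.
Qed.

Lemma minor_moves_pairs : all (fun p => all (fun a => all (fun b =>
  [|| a == b, minor_move p a b \in minor_moves | minor_move p b a \in minor_moves])
  (iota 0 3)) (iota 0 3)) (iota 0 7).
Proof. by vm_compute. Qed.

Lemma ev_var_swap p a b : (p < 7)%N -> (a < 3)%N -> (b < 3)%N ->
  ev_var (edge_out p a) * ev_var (edge_in p b) =
  ev_var (edge_in p a) * ev_var (edge_out p b).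
Proof.
move=> p7 a3 b3; have moveE x y : minor_move p x y \in minor_moves ->
    ev_var (edge_out p x) * ev_var (edge_in p y) =
    ev_var (edge_out p y) * ev_var (edge_in p x).
  move=> /evM; have -> : (minor_move p x y).1 = mmul [:: edge_out p x] [:: edge_in p y] by [].
  have -> : (minor_move p x y).2 = mmul [:: edge_out p y] [:: edge_in p x] by [].
  by rewrite !mon_mul !evD.
have /allP /(_ p) := minor_moves_pairs; rewrite mem_iota p7 => /(_ isT).
move=> /allP /(_ a); rewrite mem_iota a3 => /(_ isT).
move=> /allP /(_ b); rewrite mem_iota b3 => /(_ isT) /or3P[/eqP ->|/moveE h|/moveE h].
- by rewrite mulrC.
- by rewrite h mulrC.
- by rewrite [RHS]mulrC h mulrC.
Qed.

Lemma swap_prod p s t : (p < 7)%N -> size s = size t ->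
  all (fun a => (a < 3)%N) s -> all (fun a => (a < 3)%N) t ->
  \prod_(a <- s) ev_var (edge_out p a) * \prod_(b <- t) ev_var (edge_in p b) =
  \prod_(a <- s) ev_var (edge_in p a) * \prod_(b <- t) ev_var (edge_out p b).
Proof.
move=> p7; elim: s t => [|a s IH] [|b t] //=; first by rewrite !big_nil.
move=> [st] /andP[a3 s3] /andP[b3 t3]; rewrite !big_cons mulrACA [RHS]mulrACA.
by rewrite IH // (ev_var_swap p7 a3 b3).
Qed.

(** Exponent matrices on the 2 x 3 variables at [p] with equal row and column sums are connected by
    minors. Beyond the common part [com], the columns [s] with too many outgoing edges and the
    columns [t] with too many incoming ones form lists of equal length, and are exchanged in
    pairs. *)
Lemma swap_pow p (al be al' be' : nat -> nat) : (p < 7)%N ->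
  (forall a, (a < 3)%N -> al a + be a = al' a + be' a)%N ->
  (\sum_(a <- iota 0 3) al a = \sum_(a <- iota 0 3) al' a)%N ->
  \prod_(a <- iota 0 3) (ev_var (edge_out p a) ^+ al a * ev_var (edge_in p a) ^+ be a) =
  \prod_(a <- iota 0 3) (ev_var (edge_out p a) ^+ al' a * ev_var (edge_in p a) ^+ be' a).
Proof.
move=> p7 ab sumE.
pose s := flatten [seq nseq (al a - al' a) a | a <- iota 0 3].
pose t := flatten [seq nseq (al' a - al a) a | a <- iota 0 3].
have st : size s = size t.
  rewrite !size_flatten !sumnE !big_map.
  rewrite (eq_bigr (fun a => al a - al' a)%N) => [|a _]; last by rewrite size_nseq.
  rewrite [RHS](eq_bigr (fun a => al' a - al a)%N) => [|a _]; last by rewrite size_nseq.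
  by move: sumE; rewrite !big_cons !big_nil; lia.
have small (f : nat -> nat) :
    all (fun a => (a < 3)%N) (flatten [seq nseq (f a) a | a <- iota 0 3]).
  apply/allP => x /flattenP[_ /mapP[a + ->]]; rewrite mem_iota => a3.
  by rewrite mem_nseq => /andP[_ /eqP ->].
have powE (f : nat -> D) (g : nat -> nat) : \prod_(a <- flatten
    [seq nseq (g a) a | a <- iota 0 3]) f a = \prod_(a <- iota 0 3) f a ^+ g a.
  rewrite big_flatten big_map; apply: eq_bigr => a _.
  by rewrite big_nseq -Monoid.iteropE.
have := swap_prod p7 st (small _) (small _); rewrite !powE => sw.
pose com a := ev_var (edge_out p a) ^+ minn (al a) (al' a) *
  ev_var (edge_in p a) ^+ minn (be a) (be' a).
transitivity (\prod_(a <- iota 0 3) com a *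
  (\prod_(a <- iota 0 3) ev_var (edge_out p a) ^+ (al a - al' a) *
   \prod_(a <- iota 0 3) ev_var (edge_in p a) ^+ (al' a - al a))); last rewrite sw;
  rewrite -!big_split; apply: eq_big_seq => a;
  rewrite mem_iota => a3; have abE := ab a a3; rewrite /com /=.
  rewrite mulrACA -!exprD; congr (_ ^+ _ * _ ^+ _); lia.
rewrite [X in _ * X]mulrC mulrACA -!exprD; congr (_ ^+ _ * _ ^+ _); lia.
Qed.

End SwapProducts.

(** * Evaluations supported on a face *)

Section FaceCase.
Variables (D : comNzRingType) (ev : 'X_{1..21} -> D).
Hypothesis ev0 : ev 0%MM = 1.
Hypothesis evD : forall m m', ev (m + m')%MM = ev m * ev m'.
Hypothesis evM : forall r, r \in minor_moves -> ev (mon 21 r.1) = ev (mon 21 r.2).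
Local Notation tt := (ev_var ev).

Lemma comp_class_coord c m w (j : 'I_9) : comp_class c m = Some w ->
  w j = (\sum_(x <- iota 0 21)
    mexp m x * (if comp_table c x is Some s then count_mem (val j) s else 0))%N.
Proof.
move=> /monomial_classS ->; rewrite -sum_mexp; apply: eq_bigr => i _.
rewrite /comp_exponent; case: comp_table => [s|] /=; last by rewrite mnm0E.
by rewrite monE.
Qed.

Lemma faces_shape : all (fun F => [&& uniq F, all (fun x => (x < 21)%N) F &
    (size F == 9) || (size F == 10)]) faces &&
  all (fun j => let F := nth [::] faces j in
    F == [seq edge_out (j %/ 4) a | a <- iota 0 3] ++
         [seq edge_in (j %/ 4) a | a <- iota 0 3] ++ drop 6 F) (iota 0 28).
Proof. by vm_compute. Qed.

Variable j : nat.
Hypothesis j28 : (j < 28)%N.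
Local Notation F := (nth [::] faces j).
Hypothesis off_face : forall x, (x < 21)%N -> x \notin F -> tt x = 0.

Let F_faces : F \in faces. Proof. by rewrite mem_nth. Qed.
Let F_uniq : uniq F.
Proof. by have /andP[/allP /(_ _ F_faces) /and3P[]] := faces_shape. Qed.
Let F_lt x : x \in F -> (x < 21)%N.
Proof. by have /andP[/allP /(_ _ F_faces) /and3P[_ /allP h _] _] := faces_shape; exact: h. Qed.

Lemma big_face (R : Type) (idx : R) (op : Monoid.com_law idx) (G : nat -> R) :
  (forall x, x \notin F -> G x = idx) ->
  \big[op/idx]_(x <- iota 0 21) G x = \big[op/idx]_(x <- F) G x.
Proof.
move=> GN; rewrite (bigID (mem F)) [X in op _ X]big1 ?Monoid.mulm1 //.
rewrite -big_filter; apply: perm_big; apply: uniq_perm => //.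
  by rewrite filter_uniq // iota_uniq.
move=> x; rewrite mem_filter mem_iota /=.
by case: (boolP (x \in F)) => // /F_lt ->.
Qed.

Lemma face_class_off m w : comp_class j.+1 m = Some w ->
  forall x, x \notin F -> mexp m x = 0%N.
Proof.
move=> mw x xF; have [x21|] := ltnP x 21; last exact: mexp_default.
apply/eqP; rewrite -leqn0 leqNgt; apply/negP => mx.
suff : comp_class j.+1 m = None by rewrite mw.
apply/monomial_classN; exists (Ordinal x21); first by rewrite -mexpE.
by rewrite /comp_exponent /= (negbTE xF).
Qed.

Lemma face_class_coord m w (l : 'I_9) : comp_class j.+1 m = Some w ->
  w l = (\sum_(i <- iota 0 (size F))
    mexp m (nth 0 F i) * count_mem (val l) (segre_exponent i))%N.
Proof.
move=> mw; rewrite (comp_class_coord _ mw) big_face; last first.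
  by move=> x xF; rewrite /= (negbTE xF) muln0.
rewrite (big_nth 0) /index_iota subn0; apply: eq_big_seq => i.
by rewrite mem_iota => iF; rewrite /= mem_nth // index_uniq.
Qed.

Lemma face_ev m w : comp_class j.+1 m = Some w ->
  ev m = \prod_(i <- iota 0 (size F)) tt (nth 0 F i) ^+ mexp m (nth 0 F i).
Proof.
move=> mw; rewrite (evE ev0 evD) big_face; last first.
  by move=> x xF; rewrite (face_class_off mw xF) expr0.
by rewrite (big_nth 0) /index_iota subn0.
Qed.

Lemma ev_coord0 (m : 'X_{1..21}) (i : 'I_21) : (0 < m i)%N -> tt i = 0 -> ev m = 0.
Proof.
move=> mi ci; rewrite (_ : m = (m - U_(i) + U_(i))%MM); last by rewrite submK // lep1mP -lt0n.
by rewrite evD -mon1 -/(tt _) ci mulr0.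
Qed.

Lemma face_class_None m : comp_class j.+1 m = None -> ev m = 0.
Proof.
move=> /monomial_classN[i mi]; rewrite /comp_exponent /=.
by case: (boolP (val i \in F)) => // iF _; apply: ev_coord0 mi _; apply: off_face.
Qed.

(** A nonzero class fixes the exponents of the free edges, and on the star of the vertex it fixes
    the row and column sums, which is what [swap_pow] asks for. *)
Lemma face_case m m' : comp_class j.+1 m = comp_class j.+1 m' -> ev m = ev m'.
Proof.
move=> mm'; case E: (comp_class j.+1 m) mm' => [w|] /esym E'; last first.
  by rewrite !face_class_None.
rewrite (face_ev E) (face_ev E').
have wE (l : 'I_9) := etrans (esym (face_class_coord l E)) (face_class_coord l E').
(* There are four faces at each vertex, so [j %/ 4] is the vertex of the face. *)
have p7 : (j %/ 4 < 7)%N by rewrite ltn_divLR.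
have /andP[/allP /(_ _ F_faces) /and3P[_ _ sz] /allP /(_ j)] := faces_shape.
rewrite mem_iota j28 => /(_ isT) /eqP FE.
pose al a := mexp m (edge_out (j %/ 4) a); pose be a := mexp m (edge_in (j %/ 4) a).
pose al' a := mexp m' (edge_out (j %/ 4) a); pose be' a := mexp m' (edge_in (j %/ 4) a).
have regroup (x0 x1 x2 y0 y1 y2 z : D) : x0 * (x1 * (x2 * (y0 * (y1 * (y2 * z))))) =
    x0 * y0 * (x1 * y1 * (x2 * y2)) * z by ring.
have sw := @swap_pow _ _ evD evM _ al be al' be' p7.
have w0 := wE (@Ordinal 9 0 isT); have w1 := wE (@Ordinal 9 1 isT).
have w2 := wE (@Ordinal 9 2 isT); have w3 := wE (@Ordinal 9 3 isT).
have w4 := wE (@Ordinal 9 4 isT); have w5 := wE (@Ordinal 9 5 isT).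
have w6 := wE (@Ordinal 9 6 isT); have w7 := wE (@Ordinal 9 7 isT).
have w8 := wE (@Ordinal 9 8 isT).
move: sz w0 w1 w2 w3 w4 w5 w6 w7 w8 sw; rewrite FE.
move: (drop 6 _) => e; rewrite /= !eqSS.
case/orP => /eqP; case: e => [|e0 [|e1 [|e2 [|e3 [|//]]]]] // _;
  rewrite /= !big_cons !big_nil /= !(muln0, muln1, addn0, add0n, mulr1);
  rewrite -/(al 0%N) -/(al 1%N) -/(al 2%N) -/(be 0%N) -/(be 1%N) -/(be 2%N)
    -/(al' 0%N) -/(al' 1%N) -/(al' 2%N) -/(be' 0%N) -/(be' 1%N) -/(be' 2%N);
  move=> w0 w1 w2 w3 w4 w5 w6 w7 w8 sw; rewrite ?w5 ?w6 ?w7 ?w8 !regroup;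
  by congr (_ * _); apply: sw => //; case=> [|[|[|//]]] _.
Qed.

End FaceCase.

(** * Flows through the gates *)

Section Flow.
Variables (D : comNzRingType) (ev : 'X_{1..21} -> D).
Hypothesis evD : forall m m', ev (m + m')%MM = ev m * ev m'.
Hypothesis ev0 : ev 0%MM = 1.
Hypothesis evM : forall r, r \in minor_moves -> ev (mon 21 r.1) = ev (mon 21 r.2).
Local Notation tt := (ev_var ev).

Variables (c : nat -> nat -> int) (m m' : 'X_{1..21}).
Hypothesis c_sum : forall p, (p < 7)%N -> c p 0%N + c p 1%N + c p 2%N = 0.
Hypothesis c_diff : forall g, g \in gates -> (mexp m (g_out g))%:Z - (mexp m' (g_out g))%:Z
  = c g.1 g.2 - c (g_next g).1 (g_next g).2.

Definition pos (x : int) : nat := if x is Posz k then k else 0%N.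

Lemma posE (x : int) : x = (pos x)%:Z - (pos (- x))%:Z.
Proof. by case: x => [[|k]|k]; rewrite /pos /=; lia. Qed.

Definition forward (g : nat * nat) := pos (c g.1 g.2).
Definition backward (g : nat * nat) := pos (- c g.1 g.2).

Definition flow_list (f f' : nat * nat -> nat) : seq nat :=
  flatten [seq nseq (forward g) (f g) ++ nseq (backward g) (f' g) | g <- gates].

Lemma gates_check : [&& uniq gates,
  all (fun g => all (fun g' => ((g_out g == g_out g') ==> (g == g')) &&
    ((g_in g == g_in g') ==> (g == g'))) gates) gates,
  all (fun g => (g_next g \in gates) && (g_in (g_next g) == g_out g)) gates &
  all (fun x => x \in map g_out gates) (iota 0 21)].
Proof. by vm_compute. Qed.

Lemma gate_sum (f h : nat * nat -> nat) g : {in gates &, injective f} -> g \in gates ->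
  (\sum_(x <- gates) (f x == f g) * h x = h g)%N.
Proof.
move=> finj gg; have /and4P[gu _ _ _] := gates_check.
rewrite (bigD1_seq g) //= eqxx mul1n big_seq_cond big1 ?addn0 // => x /andP[xg xg'].
by case: eqP => // /finj e; rewrite e ?eqxx in xg'.
Qed.

Lemma g_out_inj : {in gates &, injective g_out}.
Proof.
move=> g g' gg gg'; have /and4P[_ /allP /(_ _ gg) /allP /(_ _ gg') /andP[h _] _ _] := gates_check.
by move=> /eqP e; apply/eqP; move: h; rewrite e.
Qed.

Lemma g_in_inj : {in gates &, injective g_in}.
Proof.
move=> g g' gg gg'; have /and4P[_ /allP /(_ _ gg) /allP /(_ _ gg') /andP[_ h] _ _] := gates_check.
by move=> /eqP e; apply/eqP; move: h; rewrite e.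
Qed.

Lemma count_flow_list f f' x : count_mem x (flow_list f f') =
  (\sum_(g <- gates) ((f g == x) * forward g) + \sum_(g <- gates) ((f' g == x) * backward g))%N.
Proof.
rewrite /flow_list count_flatten -map_comp sumnE big_map -big_split /=.
by apply: eq_bigr => g _; rewrite count_cat !count_nseq.
Qed.

(** Every edge leaves one gate [g] and enters [g_next g], so [c_diff] is this equality at one
    edge. *)
Lemma flow_balance :
  (m + mon 21 (flow_list g_in g_out) = m' + mon 21 (flow_list g_out g_in))%MM.
Proof.
apply/mnmP => i; rewrite !mnmDE !monE !count_flow_list -!mexpE.
have /and4P[_ _ /allP nxt /allP /(_ (val i))] := gates_check.
rewrite mem_iota ltn_ord => /(_ isT) /mapP[g gg iE].
rewrite -[nat_of_ord i]/(val i) !iE.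
have /andP[ng /eqP <-] := nxt g gg.
rewrite !(gate_sum _ g_in_inj) // (eqP (proj2 (andP (nxt g gg)))).
rewrite !(gate_sum _ g_out_inj) //.
have := c_diff gg; rewrite (posE (c g.1 g.2)) (posE (c _ (g_next g).2)).
rewrite -/(forward g) -/(backward g) -/(forward (g_next g)) -/(backward (g_next g)).
by lia.
Qed.

Lemma ev_flow_list f f' : ev (mon 21 (flow_list f f')) =
  \prod_(g <- gates) (tt (f g) ^+ forward g * tt (f' g) ^+ backward g).
Proof.
rewrite (ev_flatten ev0 evD); apply: eq_bigr => g _.
by rewrite big_cat /= !prod_nseq.
Qed.

Lemma ev_flow_swap :
  ev (mon 21 (flow_list g_in g_out)) = ev (mon 21 (flow_list g_out g_in)).
Proof.
have gatesE : gates = [seq (p, a) | p <- iota 0 7, a <- iota 0 3] by [].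
rewrite !ev_flow_list gatesE !big_allpairs; apply: eq_big_seq => p.
rewrite mem_iota => p7; have := @swap_pow _ _ evD evM p
  (fun a => backward (p, a)) (fun a => forward (p, a))
  (fun a => forward (p, a)) (fun a => backward (p, a)) p7.
move=> sw; rewrite -[RHS]sw.
- by apply: eq_bigr => a _; rewrite mulrC.
- by move=> a _; rewrite addnC.
have := c_sum p7; rewrite (posE (c p 0%N)) (posE (c p 1%N)) (posE (c p 2%N)) => h.
by rewrite !big_cons !big_nil /forward /backward /=; lia.
Qed.

(* Exchanging the in- and out-edges of every gate [g], [c g] times, turns [m] into
   [m']; at each vertex this is done by minors, since the flows there add up to 0. *)
Lemma ev_flow : ev m * ev (mon 21 (flow_list g_out g_in)) =
  ev m' * ev (mon 21 (flow_list g_out g_in)).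
Proof. by rewrite -[in LHS]ev_flow_swap -!evD flow_balance. Qed.

Lemma mem_flow_list x : x \in flow_list g_out g_in ->
  exists2 g, g \in gates & c g.1 g.2 != 0 /\ (x = g_out g \/ x = g_in g).
Proof.
move=> /flattenP[_ /mapP[g gg ->]]; rewrite mem_cat !mem_nseq => h; exists g => //.
case/orP: h => /andP[c0 /eqP ->]; split; [|by left| |by right];
  by apply: contraTneq c0; rewrite /forward /backward => ->.
Qed.

End Flow.

(** The part of the cycle of species [a] from [p] to its return to 0. The numbers 1, 2, 4 are the
    inverses of the steps 1, 4, 2 modulo 7, so [k] is the position of [p] on the cycle. *)
Definition tail_edges (p a : nat) : seq nat :=
  let k := (p * nth 0 [:: 1; 2; 4] a %% 7)%N in
  [seq edge_out (l * nth 0 [:: 1; 4; 2] a %% 7)%N a | l <- iota k (7 - k)].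

Definition toric_row (j : nat) : seq nat :=
  [seq x <- iota 0 21 | j \in nth [::] toric_table x].

(** The toric parameter [y_a] occurs in the whole cycle of species [a], and [z_p] in the three tails
    that start at [p]. *)
Lemma tail_edges_check :
  [&& all (fun g => if (g_next g).1 == 0%N then tail_edges g.1 g.2 == [:: g_out g]
      else tail_edges g.1 g.2 == g_out g :: tail_edges (g_next g).1 (g_next g).2) gates,
    all (fun a => perm_eq (tail_edges 0 a) (toric_row a)) (iota 0 3),
    all (fun p => perm_eq (tail_edges p 0 ++ tail_edges p 1 ++ tail_edges p 2)
      (toric_row p.+2)) (iota 1 6) &
    all uniq toric_table].
Proof. by vm_compute. Qed.

Lemma gate_table_check : all (fun x =>
  let e := nth (0, 0, (0, 0), (0, 0))%N gate_table x in
  let g y := (y %/ 3, y %% 3)%N in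
  [&& (g x \in gates) && (g e.1.2.2 \in gates),
    (e.1.1.1 == g_out (g x)) && (g e.1.2.1 == g_next (g x)),
    (e.1.1.2 == g_out (g e.1.2.2)) && (g_next (g e.1.2.2) == g x),
    ((g e.2.1).1 == (g x).1) && ((g e.2.2).1 == (g x).1) &&
      perm_eq [:: (g x).2; (g e.2.1).2; (g e.2.2).2] (iota 0 3) &
    [&& e.1.1.1 < 21, e.1.1.2 < 21, e.1.2.1 < 21, e.1.2.2 < 21, e.2.1 < 21 &
        e.2.2 < 21]%N]) (iota 0 21).
Proof. by vm_compute. Qed.

(** * The flow between monomials with the same toric image *)

Section ToricFlow.
Variables m m' : 'X_{1..21}.
Hypothesis mm' : comp_class 0 m = comp_class 0 m'.

Let V (x : nat) : int := (mexp m x)%:Z - (mexp m' x)%:Z.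

Lemma toric_class_Some u : exists w, comp_class 0 u = Some w.
Proof.
case E: (comp_class 0 u) => [w|]; first by exists w.
by move: E => /monomial_classN[i _].
Qed.

Lemma toric_row_sum j : (j < 9)%N -> \sum_(x <- toric_row j) V x = 0.
Proof.
move=> j9; have [w mw] := toric_class_Some m; have m'w := mw; rewrite mm' in m'w.
have rowE u : comp_class 0 u = Some w -> w (Ordinal j9) = (\sum_(x <- toric_row j) mexp u x)%N.
  move=> uw; rewrite (comp_class_coord _ uw) big_filter [RHS]big_mkcond.
  apply: eq_big_seq => x; rewrite mem_iota => x21 /=.
  have /and4P[_ _ _ /allP tu] := tail_edges_check.
  rewrite count_uniq_mem ?tu //; first by case: (_ \in _); rewrite ?muln1 ?muln0.
  by apply: mem_nth.
rewrite sumrB -!(big_morph Posz PoszD (erefl _)) -(rowE _ mw) -(rowE _ m'w).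
by rewrite subrr.
Qed.

(** Partial sums along a cycle solve the difference equation. Equal exponents of the [y_a] make them
    close up at 0, and equal exponents of [z_p] make the three flows at [p] add up to 0. *)
Definition toric_flow (p a : nat) : int := \sum_(x <- tail_edges p a) V x.

Lemma toric_flow0 a : (a < 3)%N -> toric_flow 0 a = 0.
Proof.
move=> a3; have /and4P[_ /allP /(_ a) + _ _] := tail_edges_check.
rewrite mem_iota a3 => /(_ isT) pe; rewrite /toric_flow (perm_big _ pe) /=.
by apply: toric_row_sum; lia.
Qed.

Lemma toric_flow_sum p : (p < 7)%N ->
  toric_flow p 0 + toric_flow p 1 + toric_flow p 2 = 0.
Proof.
case: p => [_|p p7]; first by rewrite !toric_flow0 // !addr0.
have /and4P[_ _ /allP /(_ p.+1) + _] := tail_edges_check.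
rewrite mem_iota /= p7 => /(_ isT) pe; rewrite -addrA /toric_flow -!big_cat.
by rewrite (perm_big _ pe) /=; apply: toric_row_sum; lia.
Qed.

Lemma toric_flow_diff g : g \in gates ->
  V (g_out g) = toric_flow g.1 g.2 - toric_flow (g_next g).1 (g_next g).2.
Proof.
move=> gg; have /and4P[/allP /(_ g gg) + _ _ _] := tail_edges_check.
case: eqP => [n0 /eqP tE|_ /eqP tE].
  have a3 : (g.2 < 3)%N.
    have /allP : all (fun g => (g.2 < 3)%N) gates by vm_compute.
    exact.
  by rewrite n0 toric_flow0 // subr0 /toric_flow tE big_seq1.
by rewrite {1}/toric_flow tE big_cons addrK.
Qed.

Variables (i j p q : nat).
Hypothesis ij : (i, j) \in [:: (0, 1); (0, 2); (1, 2)]%N.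

Definition flow_shift (a : nat) : int :=
  if a == i then toric_flow p i else if a == j then toric_flow q j
  else - (toric_flow p i + toric_flow q j).

Definition anchored_flow (r a : nat) : int := toric_flow r a - flow_shift a.

Lemma anchored_flow_sum r : (r < 7)%N ->
  anchored_flow r 0 + anchored_flow r 1 + anchored_flow r 2 = 0.
Proof.
move=> /toric_flow_sum; rewrite /anchored_flow /flow_shift.
by move: ij; rewrite !inE => /or3P[] /eqP[-> ->] /=; lia.
Qed.

Lemma anchored_flow_diff g : g \in gates ->
  V (g_out g) = anchored_flow g.1 g.2 - anchored_flow (g_next g).1 (g_next g).2.
Proof. by move=> /toric_flow_diff ->; rewrite /anchored_flow /=; lia. Qed.

Lemma anchored_flow0 : anchored_flow p i = 0 /\ anchored_flow q j = 0.
Proof.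
rewrite /anchored_flow /flow_shift !eqxx subrr; split=> //.
by move: ij; rewrite !inE => /or3P[] /eqP[-> ->]; rewrite /= subrr.
Qed.

Let cc (x : nat) : int := anchored_flow (x %/ 3) (x %% 3).

Lemma gate_table_facts x : (x < 21)%N ->
  let e := nth (0, 0, (0, 0), (0, 0))%N gate_table x in
  [/\ cc x + cc e.2.1 + cc e.2.2 = 0, V e.1.1.1 = cc x - cc e.1.2.1,
      V e.1.1.2 = cc e.1.2.2 - cc x &
      [&& e.1.1.1 < 21, e.1.1.2 < 21, e.1.2.1 < 21, e.1.2.2 < 21, e.2.1 < 21 &
        e.2.2 < 21]%N].
Proof.
move=> x21; have /allP /(_ x) := gate_table_check; rewrite mem_iota => /(_ x21).
set e := nth _ gate_table x => /and5P[/andP[xg vg] /andP[/eqP eo /eqP nx] ]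
  /andP[/eqP ei /eqP pv] /andP[/andP[/eqP q1 /eqP q2] pe] lt.
split=> //.
- have := anchored_flow_sum (_ : (x %/ 3 < 7)%N); rewrite ltn_divLR // => /(_ x21).
  have sumE (A : nat -> int) s : \sum_(a <- s) A a = foldr (fun a y => A a + y) 0 s.
    by elim: s => [|a s IH]; rewrite ?big_nil ?big_cons ?IH.
  have : \sum_(a <- [:: x %% 3; e.2.1 %% 3; e.2.2 %% 3]%N) anchored_flow (x %/ 3) a =
      \sum_(a <- iota 0 3) anchored_flow (x %/ 3) a by exact: perm_big.
  move: q1 q2 => /= q1 q2; by rewrite !sumE /cc q1 q2 /= !addr0 !addrA => ->.
- by rewrite eo (anchored_flow_diff xg) -nx.
- by rewrite ei (anchored_flow_diff vg) pv.
Qed.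

End ToricFlow.

Lemma zero_gates_sound (V cc : nat -> int) (s z : seq bool) :
  (forall x, (x < 21)%N ->
    let e := nth (0, 0, (0, 0), (0, 0))%N gate_table x in
    [/\ cc x + cc e.2.1 + cc e.2.2 = 0, V e.1.1.1 = cc x - cc e.1.2.1,
      V e.1.1.2 = cc e.1.2.2 - cc x &
      [&& e.1.1.1 < 21, e.1.1.2 < 21, e.1.2.1 < 21, e.1.2.2 < 21, e.2.1 < 21 &
        e.2.2 < 21]%N]) ->
  (forall x, (x < 21)%N -> ~~ nth false s x -> V x = 0) ->
  size z = 21 -> (forall x, nth false z x -> cc x = 0) ->
  size (zero_step s z) = 21 /\ forall x, nth false (zero_step s z) x -> cc x = 0.
Proof.
move=> facts V0 sz z0; have szt : size gate_table = 21 by [].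
have szz : size (zip gate_table z) = 21 by rewrite size_zip szt sz.
split=> [|x]; first by rewrite size_map.
have [x21|x21] := ltnP x 21; last by rewrite nth_default // size_map szz.
rewrite (nth_map ((0, 0, (0, 0), (0, 0))%N, false)) ?szz // nth_zip ?szt //.
have := facts x x21; case: (nth _ gate_table x) => [[[eo ei] [nx pv]] [g1 g2]] /=.
move=> [sum fo fi /and5P[o21 i21 _ _ _]].
case: ifP => [/z0 //|_]; case: ifP => [/andP[/z0 c1 /z0 c2]|_].
  by move: sum; rewrite c1 c2 !addr0.
case: ifP => [/andP[/(V0 _ o21) vo /z0 cn]|_].
  by move: fo; rewrite vo cn subr0.
by move=> /andP[/(V0 _ i21) vi /z0 cp]; move: fi; rewrite vi cp sub0r => /esym/eqP;
  rewrite oppr_eq0 => /eqP.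
Qed.

Lemma size_zero_gates s g g' : size (zero_gates s g g') = 21%N.
Proof.
rewrite /zero_gates; set z0 := [seq _ | _ <- _].
suff h N : size (iter N (zero_step s) z0) = 21%N by exact: h.
by elim: N => [|k IH]; [rewrite size_map size_iota | rewrite iterS size_map size_zip IH].
Qed.

Lemma zero_gates_vanish (V cc : nat -> int) (s : seq bool) g g' :
  (forall x, (x < 21)%N ->
    let e := nth (0, 0, (0, 0), (0, 0))%N gate_table x in
    [/\ cc x + cc e.2.1 + cc e.2.2 = 0, V e.1.1.1 = cc x - cc e.1.2.1,
      V e.1.1.2 = cc e.1.2.2 - cc x &
      [&& e.1.1.1 < 21, e.1.1.2 < 21, e.1.2.1 < 21, e.1.2.2 < 21, e.2.1 < 21 &
        e.2.2 < 21]%N]) ->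
  (forall x, (x < 21)%N -> ~~ nth false s x -> V x = 0) ->
  cc g = 0 -> cc g' = 0 -> forall x, nth false (zero_gates s g g') x -> cc x = 0.
Proof.
move=> facts V0 cg cg'; rewrite /zero_gates; set z0 := [seq _ | _ <- _].
suff h N : size (iter N (zero_step s) z0) = 21%N /\
    forall y, nth false (iter N (zero_step s) z0) y -> cc y = 0 by exact: (h _).2.
elim: N => [|k [sk zk]]; last by rewrite iterS; exact: (zero_gates_sound facts).
split=> [|y]; first by rewrite size_map size_iota.
have [y21|y21] := ltnP y 21; last by rewrite nth_default // size_map size_iota.
rewrite (nth_map 0%N) ?size_iota // nth_iota // add0n.
by move=> /orP[] /PeanoNat.Nat.eqb_spec ->.
Qed.

Lemma gate_table_out_in r a (y := (3 * r + a)%N) : (r, a) \in gates ->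
  let e := nth (0, 0, (0, 0), (0, 0))%N gate_table y in
  [/\ (y < 21)%N, (y %/ 3)%N = r, (y %% 3)%N = a &
    [/\ e.1.1.1 = g_out (r, a), e.1.1.2 = g_in (r, a), (e.1.1.1 < 21)%N &
      (e.1.1.2 < 21)%N]].
Proof.
have /allP inv : all (fun g => let: e :=
  nth (0, 0, (0, 0), (0, 0))%N gate_table (3 * g.1 + g.2) in
  [&& 3 * g.1 + g.2 < 21, g.2 < 3, e.1.1.1 == g_out g, e.1.1.2 == g_in g,
    e.1.1.1 < 21 & e.1.1.2 < 21]%N) gates by vm_compute.
move=> /inv /= /and5P[y21 a3 /eqP eo /eqP ei /andP[o21 i21]]; split=> //.
- by rewrite /y mulnC divnMDl // divn_small // addn0.
- by rewrite /y mulnC modnMDl modn_small.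
Qed.

Lemma all_closed_open s g g' y : all_closed s g g' -> (y < 21)%N ->
  ~~ nth false (zero_gates s g g') y ->
  open_gate s (nth (0, 0, (0, 0), (0, 0))%N gate_table y).
Proof.
have szt : size gate_table = 21%N by [].
have := size_zero_gates s g g'; rewrite /all_closed; move: (zero_gates s g g') => z sz.
move=> /(all_nthP ((0, 0, (0, 0), (0, 0))%N, false)) /(_ y).
rewrite size_zip sz szt nth_zip ?sz ?szt // => h /h{h}.
by case/orP => [//|/= ->].
Qed.

Lemma anchorsP g g' : (g, g') \in anchors -> exists i j p q : nat,
  [/\ (i, j) \in [:: (0, 1); (0, 2); (1, 2)]%N, (p < 7)%N, (q < 7)%N,
    g = (3 * p + i)%N & g' = (3 * q + j)%N].
Proof.
move=> /allpairsP[[[i j] [p q]] [ij pq [gE g'E]]]; exists i, j, p, q; split=> //.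
  by move: pq => /allpairsP[[p' q'] [+ _ [-> _]]]; rewrite mem_iota.
by move: pq => /allpairsP[[p' q'] [_ + [_ ->]]]; rewrite mem_iota.
Qed.

(** * Evaluations supported on a face of the toric cone *)

Section ToricCase.
Variables (D : comNzRingType) (ev : 'X_{1..21} -> D).
Hypothesis evD : forall m m', ev (m + m')%MM = ev m * ev m'.
Hypothesis ev0 : ev 0%MM = 1.
Hypothesis evM : forall r, r \in minor_moves -> ev (mon 21 r.1) = ev (mon 21 r.2).
Hypothesis D_domain : forall x y : D, x * y = 0 -> x = 0 \/ y = 0.
Local Notation tt := (ev_var ev).

Variable w : seq nat.
Hypothesis w_good : good_weight w.
Hypothesis w_size : size w = 21.
Hypothesis w_supp : forall x, (x < 21)%N -> (tt x == 0) = (nth 0%N w x != 0%N).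

(** The flow argument applies to the evaluation [2 ^+ weight w u], which respects the minors because
    they are homogeneous for [w], and which never vanishes. *)
Lemma toric_weight m m' : comp_class 0 m = comp_class 0 m' ->
  weight w m = weight w m'.
Proof.
move=> mm'; pose evw u : int := 2 ^+ weight w u.
have evwD u v : evw (u + v)%MM = evw u * evw v by rewrite /evw weightD exprD.
have evw0 : evw 0%MM = 1.
  by rewrite /evw /weight big1 // => i _; rewrite mnm0E muln0.
have evwM r : r \in minor_moves -> evw (mon 21 r.1) = evw (mon 21 r.2).
  move=> rM; have /andP[/allP /(_ r rM) /PeanoNat.Nat.eqb_spec we _] := w_good.
  have /allP /(_ r rM) /and3P[r1 r2 _] := minor_moves_deg.
  by rewrite /evw !weight_mon // we.
have := @ev_flow _ evw evwD evw0 evwM (toric_flow m m') m m' (toric_flow_sum mm')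
  (toric_flow_diff mm').
have n0 u : evw u != 0 by rewrite expf_neq0.
by move=> /(mulIf (n0 _)); apply: ieexprIn.
Qed.

Lemma toric_weight_pos m : (0 < weight w m)%N -> ev m = 0.
Proof.
move=> wm; have [h|/existsNP] := pselect (forall i : 'I_21, (nth 0%N w i * m i)%N = 0%N).
  by move: wm; rewrite /weight big1.
move=> [i /eqP]; rewrite muln_eq0 negb_or => /andP[wi mi].
apply: (ev_coord0 evD (i := i)); first by rewrite lt0n.
by apply/eqP; rewrite w_supp.
Qed.

Lemma ev_mon_neq0 s : (forall x, x \in s -> tt x <> 0) -> ev (mon 21 s) <> 0.
Proof.
rewrite (ev_mon ev0 evD); elim: s => [_|x s IH h].
  by rewrite big_nil => /eqP; rewrite oner_eq0.
rewrite big_cons => /D_domain[]; first by apply: h; rewrite inE eqxx.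
by apply: IH => y ys; apply: h; rewrite inE ys orbT.
Qed.

Lemma toric_case m m' : comp_class 0 m = comp_class 0 m' -> ev m = ev m'.
Proof.
move=> mm'; have wE := toric_weight mm'; have [w0|wpos] := posnP (weight w m); last first.
  by rewrite !toric_weight_pos -?wE.
have off u : weight w u = 0%N -> forall x, (x < 21)%N -> nth 0%N w x != 0%N -> mexp u x = 0%N.
  move=> u0 x x21 wx; apply/eqP; rewrite -leqn0 leqNgt; apply/negP => ux.
  have : (nth 0%N w x * mexp u x <= weight w u)%N.
    by rewrite /weight (bigD1 (Ordinal x21)) //= -mexpE leq_addr.
  by rewrite u0 leqn0 muln_eq0 (negbTE wx) -leqn0 leqNgt ux.
have /andP[_] := w_good; rewrite has_lazyE => /hasP[[g g'] /anchorsP ga closed].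
have {ga} [i [j [p [q [ij p7 q7 gE g'E]]]]] := ga.
pose c := anchored_flow m m' i j p q.
have [i3 j3] : (i < 3)%N /\ (j < 3)%N.
  by move: ij; rewrite !inE => /or3P[] /eqP[-> ->].
have zero x : nth false (zero_gates (zeros w) g g') x -> c (x %/ 3)%N (x %% 3)%N = 0.
  have facts x' := @gate_table_facts m m' mm' i j p q ij x'.
  have [c0 c1] := anchored_flow0 m m' p q ij.
  move: x; pose V x : int := (mexp m x)%:Z - (mexp m' x)%:Z.
  apply: (@zero_gates_vanish V (fun x => c (x %/ 3)%N (x %% 3)%N) _ _ _ facts).
  - move=> y y21 ny; have wy : nth 0%N w y != 0%N.
      by move: ny; rewrite (nth_map 0%N) ?w_size //; case: nth.
    by rewrite /V !off ?subrr -?wE.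
  - by rewrite gE mulnC divnMDl // modnMDl divn_small // modn_small // addn0.
  - by rewrite g'E mulnC divnMDl // modnMDl divn_small // modn_small // addn0.
have fl := @ev_flow _ ev evD ev0 evM c m m' (@anchored_flow_sum m m' mm' i j p q ij)
  (@anchored_flow_diff m m' mm' i j p q ij).
apply/eqP; rewrite -subr_eq0; apply/eqP.
(* Only open gates carry flow after anchoring, so the common factor provided by [ev_flow] is nonzero
   and cancels. *)
have /D_domain[//|] : (ev m - ev m') * ev (mon 21 (flow_list c g_out g_in)) = 0.
  by rewrite mulrBl fl subrr.
apply: contraPP => _; apply: ev_mon_neq0 => x /mem_flow_list[[r a] gg [cra xE]].
have [y21 yr ya [eo ei o21 i21]] := gate_table_out_in gg.
have nz : ~~ nth false (zero_gates (zeros w) g g') (3 * r + a)%N.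
  by apply: contra cra => /zero; rewrite yr ya => ->.
have := all_closed_open closed y21 nz; rewrite /open_gate eo ei.
have bitE e : (e < 21)%N -> nth false (zeros w) e -> tt e <> 0.
  move=> e21; rewrite (nth_map 0%N) ?w_size // => /PeanoNat.Nat.eqb_spec we.
  by apply/eqP; rewrite w_supp // we.
move=> /andP[/bitE bo /bitE bi]; case: xE => ->.
  by apply: bo; rewrite -eo.
by apply: bi; rewrite -ei.
Qed.

End ToricCase.

(** * From a prime over the minors to one of the 29 primes *)

Section Valuation.
Variables (D : comNzRingType) (ev : 'X_{1..21} -> D).
Hypothesis evD : forall m m', ev (m + m')%MM = ev m * ev m'.
Hypothesis ev0 : ev 0%MM = 1.
Hypothesis evM : forall r, r \in minor_moves -> ev (mon 21 r.1) = ev (mon 21 r.2).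
Hypothesis D_domain : forall x y : D, x * y = 0 -> x = 0 \/ y = 0.
Local Notation tt := (ev_var ev).

Lemma ev_mon_eq0 s : (ev (mon 21 s) != 0) = all (fun x => tt x != 0) s.
Proof.
apply/idP/allP => [h x xs|h].
  apply: contra_neq h => x0; rewrite (ev_mon ev0 evD).
  rewrite (perm_big _ (perm_to_rem xs)) big_cons x0; exact: mul0r.
by apply/eqP; apply: (ev_mon_neq0 evD ev0 D_domain) => x /h /eqP.
Qed.

Theorem valuation_case : exists c : 'I_29, forall m : 'X_{1..21},
  (comp_class c m = None -> ev m = 0) /\
  forall m', comp_class c m = comp_class c m' -> ev m = ev m'.
Proof.
pose s := [seq tt x != 0 | x <- iota 0 21].
have sE x : (x < 21)%N -> nth false s x = (tt x != 0).
  by move=> x21; rewrite (nth_map 0%N) ?size_iota // nth_iota.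
have sz : size s = 21%N by rewrite size_map size_iota.
have /respects_classified : forall r, r \in minor_moves -> respects s r.
  move=> r rM; have /allP /(_ r rM) /and3P[/allP r1 /allP r2 _] := minor_moves_deg.
  rewrite /respects (eq_in_all (a2 := fun x => tt x != 0)) => [|x /r1 /sE //].
  rewrite [X in eqb _ X](eq_in_all (a2 := fun x => tt x != 0)) => [|x /r2 /sE //].
  by rewrite -!ev_mon_eq0 (evM rM); case: (_ != _).
move=> /(_ sz) /(classifiedP sz)[[j j28 jF]|[w ws sw]].
  have j29 : (j.+1 < 29)%N by [].
  have off x : (x < 21)%N -> x \notin nth [::] faces j -> tt x = 0.
    by move=> x21; apply: contraNeq => x0; apply: jF; rewrite sE.
  exists (Ordinal j29) => m; split=> [|m']; first exact: (face_class_None evD off).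
  exact: (face_case ev0 evD evM j28 off).
exists ord0 => m; split=> [|m'].
  by have [u ->] := toric_class_Some m.
have sw' : size w = 21%N by rewrite -sz sw size_map.
apply: (toric_case evD ev0 evM D_domain _ sw').
  by have /allP := good_weights; apply.
move=> x x21; apply: negb_inj; rewrite -sE // sw (nth_map 0%N) ?sw' //.
by rewrite negbK; apply/PeanoNat.Nat.eqb_spec/eqP.
Qed.

End Valuation.

Theorem prime_contains_comp (C : numFieldType) (P : prime_idealr (local_ring C 21)) :
  {subset versal_base C <= P} -> exists c : 'I_29, {subset comp_prime C c <= P}.
Proof.
move=> VP; pose Q := {ideal_quot P}.
pose ev (m : 'X_{1..21}) : Q := (\pi_Q (of_mpoly 'X_[m]))%qT.
have evD m m' : ev (m + m')%MM = ev m * ev m'.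
  by rewrite /ev mpolyXD !rmorphM.
have ev0 : ev 0%MM = 1 by rewrite /ev mpolyX0 !rmorph1.
have evM r : r \in minor_moves -> ev (mon 21 r.1) = ev (mon 21 r.2).
  move=> rM; apply/eqP; rewrite -subr_eq0 -!rmorphB quot_eq0; apply: VP.
  by apply/asboolP/extended_ideal_gen/versal_eqnsE; exists r.
have D_domain (x y : Q) : x * y = 0 -> x = 0 \/ y = 0.
  by move=> /Quotient.rquot_IdomainAxiom /orP[] /eqP; [left|right].
have [c cP] := valuation_case evD ev0 evM D_domain; exists c => x /comp_primeP.
move=> /(graded_kernelP (comp_class_congruence (ltn_ord c))).
move: x; apply: (@extended_ideal_le C 21 _ (fun x => x \in P)).
- exact: idealr0.
- by move=> x y xP yP; rewrite rpredD.
- by move=> a x xP; rewrite idealMr.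
move=> _ [m [o [mo ->]]]; rewrite -quot_eq0 !rmorphB subr_eq0 /=; apply/eqP.
have [cN cE] := cP m; case: o mo => [m' /esym /cE //|/cN mN].
by rewrite -/(ev m) mN !rmorph0.
Qed.

(** * Irreducible components *)

Section ReducedQuotient.
Variables (A : comNzRingType) (I : idealr A).
Hypothesis I_sqrt : forall x, x * x \in I -> x \in I.

Lemma radical_exp x k : x ^+ k \in I -> x \in I.
Proof.
have two j : x ^+ (2 ^ j)%N \in I -> x \in I.
  by elim: j => [|j IH]; rewrite ?expr1 // expnS mulnC exprM expr2 => /I_sqrt.
(* Since [k < 2 ^ k], the power [x ^+ (2 ^ k)] is a multiple of [x ^+ k]. *)
move=> xk; apply: (two k); rewrite -(subnK (ltnW (ltn_expl k (ltnSn 1)))) exprD.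
exact: idealMr.
Qed.

Lemma radical_reduced : reduced {ideal_quot I}.
Proof.
move=> x k; rewrite -[x]reprK -rmorphXn /= => /eqP.
by rewrite quot_eq0 => /radical_exp xI; apply/eqP; rewrite quot_eq0.
Qed.

End ReducedQuotient.

Section IrreducibleComponents.
Variable C : numFieldType.
Local Notation V := (versal_base C).
Local Notation P := (comp_prime C).
Local Notation locus c := [set x | x \in P c].

Lemma comp_sub_eq c c' : {subset P c <= P c'} -> c = c'.
Proof.
move=> cc'; apply/eqP; apply/negPn/negP => /(@comp_incomparable C) [x [xc]].
by rewrite cc'.
Qed.

Lemma comp_minimal c : minimal_prime_over V (P c).
Proof.
split=> [|P' /prime_contains_comp[c' c'P'] P'P]; first exact: versal_sub_comp.
by rewrite -(comp_sub_eq (fun x xc => P'P x (c'P' x xc))).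
Qed.

Lemma minimal_comp (P' : prime_idealr (local_ring C 21)) :
  minimal_prime_over V P' -> exists c, forall x, (x \in P') = (x \in P c).
Proof.
move=> [/prime_contains_comp[c cP'] P'min]; exists c => x.
by apply/idP/idP; [apply: P'min => //; exact: versal_sub_comp | exact: cP'].
Qed.

Lemma componentsE : components V = range (fun c => locus c).
Proof.
apply/seteqP; split=> [Z [P' /minimal_comp[c cE] ->]|_ [c _ <-]].
  by exists c => //; apply/seteqP; split=> x /=; rewrite cE.
by exists (P c) => //; exact: comp_minimal.
Qed.

Lemma card_components : (components V #= `I_29)%card.
Proof.
rewrite componentsE; have -> : range (fun c => locus c) = (fun k => locus (inord k)) @` `I_29.
  apply/seteqP; split=> [_ [c _ <-]|_ [k _ <-]]; last by exists (inord k).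
  by exists (val c) => //=; rewrite ?inord_val.
apply: inj_card_eq => k k' /set_mem /= k29 /set_mem /= k'29 kk'.
have /(congr1 val) : inord k = inord k' :> 'I_29.
  by apply: comp_sub_eq => x; move: (congr1 (fun Z => Z x) kk') => /= ->.
by rewrite /= !inordK.
Qed.

Lemma versal_intersection : [set x | x \in V] = \bigcap_(Z in components V) Z.
Proof.
rewrite componentsE; apply/seteqP; split=> [x xV _ [c _ <-]|x xc] /=.
  exact: versal_sub_comp.
apply/negPn/negP => xV; have xk k : x ^+ k \notin V.
  by apply: contra xV; apply: radical_exp => y; exact: versal_base_sqrt.
have [P' [/prime_contains_comp[c cP'] xP']] := prime_avoidance xk.
by have := cP' x (xc (locus c) (ex_intro2 _ _ c I erefl)); rewrite (negbTE xP').
Qed.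

End IrreducibleComponents.

(** * The smoothing component as the toric prime *)

Definition toric_form (l : nat) (v : 'rV[int]_21) : int :=
  \sum_i v 0 i * (count_mem l (nth [::] toric_table i))%:Z.

Lemma toric_form_is_zmod_morphism l : zmod_morphism (toric_form l).
Proof.
move=> u v; rewrite /toric_form -sumrB; apply: eq_bigr => i _.
by rewrite !mxE mulrBl.
Qed.

HB.instance Definition _ l := GRing.isZmodMorphism.Build 'rV[int]_21 int (toric_form l)
  (toric_form_is_zmod_morphism l).

Lemma toric_formZ l a v : toric_form l (a *: v) = a * toric_form l v.
Proof. by rewrite /toric_form mulr_sumr; apply: eq_bigr => i _; rewrite mxE mulrA. Qed.

Lemma toric_form_delta l i :
  toric_form l (delta_mx 0 i) = (count_mem l (nth [::] toric_table i))%:Z.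
Proof.
rewrite /toric_form (bigD1 i) //= mxE !eqxx mul1r big1 ?addr0 // => j ji.
by rewrite mxE eqxx (negbTE ji) mul0r.
Qed.

Lemma toric_table_balanced : all (fun p => all (fun a => all (fun b =>
  let T := nth [::] toric_table in
  perm_eq (T (edge_out p a) ++ T (edge_in p b)) (T (edge_out p b) ++ T (edge_in p a)))
  (iota 0 3)) (iota 0 3)) (iota 0 7).
Proof. by vm_compute. Qed.

Lemma toric_form_exponent l p j k : toric_form l (exponent p j k) = 0.
Proof.
rewrite /exponent raddfB !(raddfD (toric_form l)) /= !toric_form_delta !tmatrix_val /=.
rewrite -!PoszD -!count_cat.
have /allP /(_ (val p)) := toric_table_balanced; rewrite mem_iota ltn_ord => /(_ isT).
move=> /allP /(_ (val j)); rewrite mem_iota ltn_ord => /(_ isT).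
move=> /allP /(_ (val k)); rewrite mem_iota ltn_ord => /(_ isT) /permP ->.
by rewrite subrr.
Qed.

(** A linear form with integer values that vanishes on a lattice also vanishes on its saturation. *)
Lemma toric_form_sat l v : lattice_sat v -> toric_form l v = 0.
Proof.
move=> [d d0 [c cE]]; apply: (mulfI d0); rewrite mulr0.
rewrite -toric_formZ cE !raddf_sum big1 // => p _.
rewrite raddf_sum big1 // => j _; rewrite raddf_sum big1 // => k _ /=.
by rewrite toric_formZ toric_form_exponent mulr0.
Qed.

Lemma pos_partB v i : (pos_part v i)%:Z - (pos_part (- v) i)%:Z = v 0 i.
Proof. by rewrite !mnmE mxE; move: (v 0 i) => z; case: (ltP z 0); case: (ltP (- z) 0); lia. Qed.

Lemma pos_part_class v : lattice_sat v ->
  comp_class 0 (pos_part v) = comp_class 0 (pos_part (- v)).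
Proof.
move=> vL; have [w vw] := toric_class_Some (pos_part v).
have [w' vw'] := toric_class_Some (pos_part (- v)); rewrite vw vw'; congr Some.
apply/mnmP => j; rewrite (comp_class_coord _ vw) (comp_class_coord _ vw') -!sum_mexp.
apply/eqP; rewrite -eqz_nat -subr_eq0 !(big_morph Posz PoszD (erefl _)) -sumrB.
apply/eqP; rewrite -[RHS](toric_form_sat j vL); apply: eq_bigr => i _.
by rewrite !PoszM -mulrBl pos_partB.
Qed.

Lemma exponentE p j k x : (x < 21)%N -> exponent p j k 0 (inord x) =
  ((edge_out p j == x)%:Z - (edge_in p j == x)%:Z) -
  ((edge_out p k == x)%:Z - (edge_in p k == x)%:Z).
Proof.
move=> x21; have addE (u v : 'rV[int]_21) i : (u + v) 0 i = u 0 i + v 0 i by rewrite mxE.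
have oppE (u : 'rV[int]_21) i : (- u) 0 i = - u 0 i by rewrite mxE.
have deltaE (i : 'I_21) : (delta_mx 0 i : 'rV[int]_21) 0 (inord x) = (nat_of_ord i == x)%:Z.
  by rewrite mxE eqxx eq_sym -val_eqE /= inordK // natz.
by rewrite /exponent addE oppE !addE !deltaE !tmatrix_val /=; lia.
Qed.

Lemma class_lattice m m' : comp_class 0 m = comp_class 0 m' ->
  lattice (\row_i ((m i)%:Z - (m' i)%:Z)).
Proof.
move=> mm'; pose f := toric_flow m m'.
(* The third flow at [p] is minus the sum of the other two, so the flow at [p] is a combination of
   [exponent p 0 2] and [exponent p 1 2] alone. *)
exists (fun p j k => if (val k == 2)%N then f p j else 0).
apply/rowP => i; rewrite -(inord_val i); move: (ltn_ord i); move: (val i) => x x21.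
rewrite mxE summxE.
have /and4P[_ _ /allP nxt /allP /(_ x)] := gates_check.
rewrite mem_iota x21 => /(_ isT) /mapP[g gg xE].
have -> : (m (inord x))%:Z - (m' (inord x))%:Z = f g.1 g.2 - f (g_next g).1 (g_next g).2.
  by rewrite /f -(toric_flow_diff mm' gg) -xE -!mexpE inordK.
transitivity (\sum_(h <- gates) f h.1 h.2 * ((g_out h == x)%:Z - (g_in h == x)%:Z)).
  rewrite (eq_bigr (fun h => f h.1 h.2 * (g_out h == x)%:Z -
    f h.1 h.2 * (g_in h == x)%:Z)) => [|h _]; last by rewrite mulrBr.
  have /and4P[gu _ _ _] := gates_check.
  have /andP[ng nE] := nxt g gg.
  rewrite sumrB (bigD1_seq g) //= xE eqxx mulr1 big_seq_cond big1 ?addr0; last first.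
    move=> h /andP[hg hg'].
    by case: eqP => [/(g_out_inj hg gg) e|_]; [rewrite e eqxx in hg' | rewrite mulr0].
  rewrite (bigD1_seq (g_next g)) //= nE mulr1 [X in _ - (_ + X)]big_seq_cond big1 ?addr0 //.
  move=> h /andP[hg hg']; case: eqP => [e|_]; last by rewrite mulr0.
  by move: hg'; rewrite (g_in_inj hg ng) ?eqxx // e (eqP nE).
have inner (q : pred 'I_3) a (E : 'I_3 -> 'rV[int]_21) y :
    \sum_(k < 3 | q k) ((if val k == 2%N then a else 0) *: E k) 0 y =
    if q ord_max then a * E ord_max 0 y else 0.
  rewrite big_mkcond (bigD1 ord_max) //= big1 ?addr0 => [|k k2].
    by case: ifP => // _; rewrite mxE.
  rewrite (_ : val k == 2%N = false) ?scale0r ?mxE; first by case: ifP.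
  by apply: contra_neqF k2 => /eqP k2; apply: val_inj.
have gatesE : gates = [seq (p, a) | p <- iota 0 7, a <- iota 0 3] by [].
rewrite gatesE big_allpairs -[iota 0 7]/(index_iota 0 7) big_mkord.
apply: eq_bigr => p _; rewrite summxE !big_ord_recl big_ord0 /=.
rewrite !summxE !inner /= !exponentE //= !big_cons big_nil /= /g_out /g_in /=.
have -> : f p 2%N = - (f p 0%N + f p 1%N).
  apply/eqP; rewrite -addr_eq0 addrC; apply/eqP; exact: toric_flow_sum mm' _ (ltn_ord p).
by rewrite /bump /= !addn0; ring.
Qed.

Lemma smoothing_comp (C : numFieldType) :
  smoothing_component C = [set x | x \in comp_prime C 0].
Proof.
apply/seteqP; split=> x /=.
  move: x; apply: (@extended_ideal_le C 21 _ (fun x => x \in comp_prime C 0)).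
  - exact: idealr0.
  - by move=> x y xP yP; rewrite rpredD.
  - by move=> a x xP; rewrite idealMr.
  move=> _ [v vL <-]; apply/comp_primeP.
  apply: (graded_kernel_relation (comp_class_congruence (isT : (0 < 29)%N))).
  exists (pos_part v), (Some (pos_part (- v))); split=> //=.
  by rewrite -pos_part_class.
move=> /comp_primeP /(graded_kernelP (comp_class_congruence (isT : (0 < 29)%N))).
move: x; apply: (@extended_ideal_le C 21 _ (smoothing_component C)).
- exact: ideal_span0.
- exact: ideal_spanD.
- exact: ideal_span_mull.
move=> _ [m [[m'|] [mo ->]]] /=; last by have [w] := toric_class_Some m; rewrite mo.
pose v : 'rV[int]_21 := \row_i ((m i)%:Z - (m' i)%:Z).
have vL : lattice_sat v by exists 1 => //; rewrite scale1r; exact: class_lattice.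
(* The greatest common divisor of [m] and [m']. *)
pose u := (m - pos_part v)%MM.
have mE : m = (u + pos_part v)%MM by apply/mnmP => i; rewrite !mnmE mxE; lia.
have m'E : m' = (u + pos_part (- v))%MM by apply/mnmP => i; rewrite !mnmE !mxE; lia.
rewrite mE m'E !mpolyXD -mulrBr rmorphM; apply: ideal_span_mull.
by apply: extended_ideal_gen; exists v.
Qed.

(** * The Segre cone *)

Lemma digits_inj (B k : nat) (a b : nat -> nat) :
  (forall i, (a i < B)%N) -> (forall i, (b i < B)%N) ->
  (\sum_(i < k) a i * B ^ i = \sum_(i < k) b i * B ^ i)%N ->
  forall i, (i < k)%N -> a i = b i.
Proof.
elim: k a b => [//|k IH] a b aB bB; rewrite !big_ord_recl /= !expn0 !muln1.
have tail (f : nat -> nat) : (\sum_(i < k) f (bump 0 i) * B ^ bump 0 i)%N =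
    ((\sum_(i < k) f i.+1 * B ^ i) * B)%N.
  by rewrite big_distrl; apply: eq_bigr => i _; rewrite /bump add1n expnSr mulnA.
rewrite !tail => h; have B0 : (0 < B)%N by apply: leq_ltn_trans (aB 0%N).
have a0 : a 0%N = b 0%N.
  by have := congr1 (modn^~ B) h; rewrite /= ![(_ + _ * B)%N]addnC !modnMDl !modn_small.
case=> [//|i]; rewrite ltnS => ik; apply: (IH (a \o succn) (b \o succn)) => //=.
by move: h; rewrite a0 => /addnI h; apply/eqP; rewrite -(eqn_pmul2r B0); apply/eqP.
Qed.

Lemma mpoly_vanish (C : numFieldType) n (p : {mpoly C[n]}) :
  (forall v, p.@[v] = 0) -> p = 0.
Proof.
(* Kronecker's substitution [x_i := t ^ (B ^ i)]. *)
move=> p0; pose B := msize p; pose q : {poly C} := mmap polyC (fun i : 'I_n => 'X^(B ^ i)) p.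
pose e (m : 'X_{1..n}) := (\sum_(i < n) m i * B ^ i)%N.
have qE : q = \sum_(m <- msupp p) p@_m *: 'X^(e m).
  rewrite /q /mmap; apply: eq_bigr => m _; rewrite mul_polyC; congr (_ *: _).
  by rewrite /mmap1 /e expr_sum; apply: eq_bigr => i _; rewrite -exprM mulnC.
have q0 : q = 0.
  (* The natural numbers are distinct in [C], so those below [size q] are too many roots for a
     nonzero [q]. *)
  apply: (@roots_geq_poly_eq0 _ _ [seq i%:R | i <- iota 0 (size q)]).
  - apply/allP => _ /mapP[t _ ->]; rewrite /root qE horner_sum; apply/eqP.
    rewrite -[RHS](p0 (fun i => t%:R ^+ (B ^ i))) mevalE; apply: eq_bigr => m _.
    rewrite hornerZ hornerXn /e expr_sum; congr (_ * _).
    by apply: eq_bigr => i _; rewrite -exprM mulnC.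
  - by rewrite map_inj_uniq ?iota_uniq // => i j /eqP; rewrite eqr_nat => /eqP.
  - by rewrite size_map size_iota.
apply/mpolyP => m; rewrite mcoeff0.
have [mp|/memN_msupp_eq0 //] := boolP (m \in msupp p).
have mB (u : 'X_{1..n}) i : u \in msupp p -> (nth 0 (multinom_val u) i < B)%N.
  move=> up; have [i_n|ni] := ltnP i n; last first.
    rewrite nth_default ?size_tuple //; apply: leq_ltn_trans (msize_mdeg_lt up).
    exact: leq0n.
  rewrite -(mnm_nth 0%N u (Ordinal i_n)); apply: leq_ltn_trans (msize_mdeg_lt up).
  by rewrite mdegE (bigD1 (Ordinal i_n)) //= leq_addr.
rewrite -(coef0 _ (e m)) -q0 qE coef_sum (bigD1_seq m) ?msupp_uniq //=.
rewrite coefZ coefXn eqxx mulr1 big_seq_cond big1 ?addr0 // => u /andP[up um].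
rewrite coefZ coefXn; case: eqP => [ee|]; last by rewrite mulr0.
case/eqP: um; apply/mnmP => i; rewrite !(mnm_nth 0%N).
apply: (@digits_inj B n _ _ (fun i => mB u i up) (fun i => mB m i mp)) => //.
by under eq_bigr do rewrite -mnm_nth; under [RHS]eq_bigr do rewrite -mnm_nth.
Qed.

(** A nonzero class lies in a single degree, so its coefficient sum in [p] is already the sum in
    that degree. *)
Lemma graded_kernel_mpoly (C : comNzRingType) n k (kap : 'X_{1..n} -> option 'X_{1..k})
    (p : {mpoly C[n]}) :
  graded_congruence kap -> collapse kap p = 0 -> graded_kernel kap (mfps_of_mpoly p).
Proof.
move=> [_ _ kapdeg] p0 d; apply/mpolyP => w; rewrite mcoeff0.
pose D := maxn (msize (hpart d (mfps_of_mpoly p))) (msize p).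
rewrite (@mcoeff_collapse _ _ _ _ D) ?leq_maxl //.
have : (collapse kap p)@_w = 0 by rewrite p0 mcoeff0.
rewrite (@mcoeff_collapse _ _ _ _ D) ?leq_maxr // => pw.
have [[m0 [m0w m0d]]|no] := pselect (exists m, kap m = Some w /\ mdeg m = d).
  rewrite -[RHS]pw; apply: eq_bigr => m /eqP mw; rewrite mcoeff_hpart.
  by rewrite -m0d (kapdeg m m0) ?eqxx ?mw ?m0w.
rewrite big1 // => m /eqP mw; rewrite mcoeff_hpart; case: eqP => // md.
by case: no; exists m.
Qed.

Section SegreClass.
Variable d : nat.

Definition segre_class : 'X_{1..2 * 3 + d} -> option 'X_{1..9} :=
  monomial_class (fun l : 'I_(2 * 3 + d) => Some (mon 9 (segre_exponent l))).

Lemma segre_class_Some m : exists w, segre_class m = Some w.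
Proof.
case E: (segre_class m) => [w|]; first by exists w.
by move: E => /monomial_classN[i _].
Qed.

Lemma segre_classX (C : comNzRingType) m w (z : 'I_9 -> C) : segre_class m = Some w ->
  'X_[w].@[z] = 'X_[m].@[fun l => 'X_[mon 9 (segre_exponent (val l))].@[z]].
Proof.
move=> mw; rewrite !mevalX; under [RHS]eq_bigr do rewrite mevalX -prodrXl.
rewrite exchange_big; apply: eq_bigr => j _; rewrite (monomial_classS mw) expr_sum.
by apply: eq_bigr => l _; rewrite -exprM mulnC.
Qed.

(** Collapsing is pulling back along the parametrization of the cone, so a polynomial vanishing on
    the cone has a collapse that vanishes everywhere. *)
Lemma collapse_segre (C : comNzRingType) (g : {mpoly C[2 * 3 + d]}) z :
  (collapse segre_class g).@[z] = g.@[fun l => 'X_[mon 9 (segre_exponent (val l))].@[z]].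
Proof.
rewrite [in RHS](mpolyE g) /collapse !raddf_sum; apply: eq_bigr => m _ /=.
have [w mw] := segre_class_Some m; rewrite !mevalZ mw /=; congr (_ * _).
exact: segre_classX.
Qed.

Hypothesis d4 : (d <= 4)%N.

Lemma segre_exponent_deg : all (fun l => (count (graded_vars 1) (segre_exponent l) == 1)%N &&
  all (fun x => (x < 9)%N) (segre_exponent l)) (iota 0 10).
Proof. by vm_compute. Qed.

Lemma segre_class_congruence : graded_congruence segre_class.
Proof.
apply: (@monomial_class_congruence _ _ _ (fun j => graded_vars 1 (val j))) => l w [<-].
have /allP /(_ (val l)) := segre_exponent_deg.
rewrite mem_iota (leq_trans (ltn_ord l)) ?(leq_add2l 6) // => /(_ isT) /andP[/eqP cs s9].
by rewrite mon_count.
Qed.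

Lemma mxvec_index_val (i : 'I_2) (j : 'I_3) : val (mxvec_index i j) = (3 * i + j)%N.
Proof.
have enumE : enum {: 'I_2 * 'I_3} = [seq (i, j) | i <- enum 'I_2, j <- enum 'I_3].
  by rewrite enumT unlock.
have codomE : codom (fun x : 'I_2 * 'I_3 => 3 * x.1 + x.2)%N = iota 0 6.
  rewrite /codom /image_mem enumE map_allpairs.
  rewrite -[RHS]/[seq 3 * i + j | i <- iota 0 2, j <- iota 0 3]%N -!val_enum_ord.
  by rewrite allpairs_mapl allpairs_mapr.
have := nth_codom 0%N (fun x : 'I_2 * 'I_3 => 3 * x.1 + x.2)%N (enum_rank (i, j)).
rewrite enum_rankK /= => <-; rewrite codomE nth_iota //.
by rewrite -[6%N]/(2 * 3)%N -mxvec_cast ltn_ord.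
Qed.

Variable C : numFieldType.

Lemma mevalX_mon1 n a (z : 'I_n.+1 -> C) : (a < n.+1)%N ->
  'X_[mon n.+1 [:: a]].@[z] = z (inord a).
Proof. by move=> an; rewrite -{1}(inordK an) mon1 mevalXU. Qed.

Lemma segre_point (l : 'I_(2 * 3 + d)) (z : 'I_9 -> C) :
  'X_[mon 9 (segre_exponent (val l))].@[z] =
  if (l < 6)%N then z (inord (l %/ 3)) * z (inord (2 + l %% 3)) else z (inord l.-1).
Proof.
rewrite /segre_exponent; case: ltnP => l6.
  have l2 : (l %/ 3 < 2)%N by rewrite ltn_divLR.
  have l3 : (l %% 3 < 3)%N by rewrite ltn_mod.
  by rewrite mon_cons mpolyXD mevalM !mevalX_mon1 //; lia.
have ln : (val l < 2 * 3 + d)%N := ltn_ord l; rewrite mevalX_mon1 //; lia.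
Qed.

Lemma segre_cone_point z :
  segre_cone (fun l : 'I_(2 * 3 + d) => 'X_[mon 9 (segre_exponent (val l))].@[z] : C).
Proof.
exists (fun i => z (inord i)), (fun j => z (inord (2 + j))) => i j.
have lE : nat_of_ord (lshift d (mxvec_index i j)) = (3 * i + j)%N := mxvec_index_val i j.
rewrite segre_point lE.
have [i2 j3] := (ltn_ord i, ltn_ord j); rewrite ifT; last by lia.
by rewrite mulnC divnMDl // modnMDl divn_small // modn_small // addn0.
Qed.

Lemma segre_coneP (v : 'I_(2 * 3 + d) -> C) : segre_cone v ->
  exists z, v =1 fun l => 'X_[mon 9 (segre_exponent (val l))].@[z].
Proof.
(* The parameters 0 and 1 are [x], 2 to 4 are [y], and parameter [k] from 5 on is the coordinate
   [k.+1], or 0 if there is none. *)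
move=> [x [y vE]]; exists (fun k => if (k < 2)%N then x (inord k) else
  if (k < 5)%N then y (inord (k - 2)) else
  if insub k.+1 is Some l then v l else 0) => l; rewrite segre_point.
case: ltnP => l6.
  have l2 : (l %/ 3 < 2)%N by rewrite ltn_divLR.
  have l3 : (l %% 3 < 3)%N by rewrite ltn_mod.
  rewrite !inordK ?l2; [|lia|lia].
  have -> : (2 + l %% 3 < 2)%N = false by lia.
  have -> : (2 + l %% 3 < 5)%N by lia.
  rewrite addKn -vE; congr v; apply: val_inj; apply: esym.
  apply: etrans (mxvec_index_val _ _) _; rewrite !inordK //.
  by rewrite mulnC -divn_eq.
have ln := ltn_ord l; rewrite inordK; last by lia.
rewrite !ifN; try lia.
rewrite prednK; last by lia.
by rewrite valK.
Qed.

Lemma segre_germP x : x \in segre_germ C d <-> graded_kernel segre_class x.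
Proof.
split=> [/asboolP|/(graded_kernelP segre_class_congruence) h].
  move: x; apply: (@extended_ideal_le _ _ _
    (fun x : local_ring C _ => graded_kernel segre_class x)).
  - by move=> e; rewrite [hpart _ _]raddf0 raddf0.
  - by move=> x y; exact: graded_kernelD.
  - by move=> a x; apply: graded_kernel_mull; exact: segre_class_congruence.
  move=> g g0 e; have cg0 : collapse segre_class g = 0.
    by apply: mpoly_vanish => z; rewrite collapse_segre; apply: g0; exact: segre_cone_point.
  exact: graded_kernel_mpoly segre_class_congruence cg0 e.
apply/asboolP; move: x h.
apply: (@extended_ideal_le _ _ _ (extended_ideal (@segre_eqns C d))).
- exact: ideal_span0.
- exact: ideal_spanD.
- exact: ideal_span_mull.
move=> _ [m [[m'|] [mo ->]]]; last by have [w] := segre_class_Some m; rewrite mo.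
apply: extended_ideal_gen => v /segre_coneP[z vz]; rewrite mevalB.
have -> : v = fun l => 'X_[mon 9 (segre_exponent (val l))].@[z] by apply/funext.
have [w mw] := segre_class_Some m.
by rewrite -(segre_classX z mw) -(segre_classX z (etrans mo mw)) subrr.
Qed.

End SegreClass.

(** * Isomorphisms of germs from morphisms of local rings *)

Section GermIso.
Variables (C : numFieldType) (m n : nat).
Variables (I : idealr (local_ring C m)) (J : idealr (local_ring C n)).
Variable psi : {rmorphism local_ring C m -> local_ring C n}.
Hypothesis psi_surj : forall y, exists x, psi x = y.
Hypothesis psi_ideal : forall x, (psi x \in J) = (x \in I).
Hypothesis psiC : forall c : C, psi (of_mpoly c%:MP) = of_mpoly c%:MP.

Let A := {ideal_quot I}.
Let B := {ideal_quot J}.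

Definition quot_map (x : A) : B := (\pi_B (psi (repr x)))%qT.

Lemma quot_map_pi a : quot_map (\pi_A a)%qT = (\pi_B (psi a))%qT.
Proof.
apply/eqP; rewrite -subr_eq0 -!rmorphB quot_eq0 psi_ideal.
by rewrite -quot_eq0 rmorphB /= reprK subrr.
Qed.

Lemma quot_map_is_zmod_morphism : zmod_morphism quot_map.
Proof.
move=> x y; rewrite -[x]reprK -[y]reprK -rmorphB !quot_map_pi.
by rewrite !rmorphB.
Qed.

Lemma quot_map_is_monoid_morphism : monoid_morphism quot_map.
Proof.
split=> [|x y]; first by rewrite -[1](rmorph1 (\pi_A)%qT) quot_map_pi !rmorph1.
rewrite -[x]reprK -[y]reprK -rmorphM !quot_map_pi.
by rewrite !rmorphM.
Qed.

HB.instance Definition _ := GRing.isZmodMorphism.Build A B quot_map quot_map_is_zmod_morphism.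
HB.instance Definition _ := GRing.isMonoidMorphism.Build A B quot_map quot_map_is_monoid_morphism.

Lemma germ_iso_of_rmorphism : germ_iso I J.
Proof.
exists quot_map; split=> [|c]; last by rewrite [LHS]quot_map_pi psiC.
pose s y := projT1 (cid (psi_surj y)); have sK y : psi (s y) = y by rewrite /s; case: cid.
exists (fun y => (\pi_A (s (repr y)))%qT) => x /=; last first.
  by rewrite [LHS]quot_map_pi sK reprK.
rewrite -[RHS]reprK; apply/eqP; rewrite -subr_eq0 -rmorphB quot_eq0 -psi_ideal.
by rewrite rmorphB /= sK -quot_eq0 rmorphB /= reprK -/(quot_map x) subrr.
Qed.

End GermIso.

Lemma mnm_ind n (Q : 'X_{1..n} -> Prop) : Q 0%MM -> (forall i, Q U_(i)%MM) ->
  (forall m m', Q m -> Q m' -> Q (m + m')%MM) -> forall m, Q m.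
Proof.
move=> Q0 Q1 QD m; rewrite (multinomUE_id m); apply: big_ind => // i _.
by elim: (m i) => [|k IH]; rewrite ?mulm0n // mulmS; apply: QD.
Qed.

Lemma monomial_class_bind n k l (e : 'I_n -> option 'X_{1..k}) (e' : 'I_k -> option 'X_{1..l})
    (e'' : 'I_n -> option 'X_{1..l}) :
  (forall i, e'' i = obind (monomial_class e') (e i)) ->
  forall m, monomial_class e'' m = obind (monomial_class e') (monomial_class e m).
Proof.
move=> eE; elim/mnm_ind => [|i|m m' Hm Hm']; rewrite ?monomial_class0 ?monomial_classU //.
  by rewrite /= monomial_class0.
rewrite !monomial_classD Hm Hm'; case: (monomial_class e m) => [w|] //=.
case: (monomial_class e m') => [w'|] /=; rewrite ?monomial_classD //.
by case: (monomial_class e' w).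
Qed.

Lemma collapse_bind (C : comNzRingType) n k l (kap : 'X_{1..n} -> option 'X_{1..k})
    (kap' : 'X_{1..k} -> option 'X_{1..l}) (p : {mpoly C[n]}) :
  collapse (fun m => obind kap' (kap m)) p = collapse kap' (collapse kap p).
Proof.
rewrite [LHS]/collapse [X in collapse kap' X]/collapse [RHS]linear_sum.
apply: eq_bigr => m _; rewrite [RHS]linearZ /=; congr (_ *: _).
by case: (kap m) => [w|] /=; rewrite ?collapseX ?raddf0.
Qed.

(** * Restriction of series to a coordinate subspace *)

Section Restriction.
Variables (N n : nat) (rho : 'I_N -> option 'I_n) (iota : 'I_n -> 'I_N).
Hypothesis iotaK : pcancel iota rho.
Hypothesis rhoK : ocancel rho iota.

Local Notation kap :=
  (monomial_class (fun i : 'I_N => omap (fun l => U_(l)%MM : 'X_{1..n}) (rho i))).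

Definition extend_mnm (u : 'X_{1..n}) : 'X_{1..N} :=
  [multinom (if rho i is Some l then u l else 0)%N | i < N].

Lemma restrict_mnmE m u : kap m = Some u -> forall l, u l = m (iota l).
Proof.
move=> mu l; rewrite (monomial_classS mu) (bigD1 (iota l)) //= iotaK /= mnm1E eqxx muln1.
rewrite big1 ?addn0 // => i il; have := rhoK i; case: (rho i) => [l'|] /= => [e|_].
  by rewrite mnm1E; case: eqP => [l'l|]; [rewrite -e l'l eqxx in il|rewrite muln0].
by rewrite mnm0E muln0.
Qed.

Lemma extend_mnmK u : kap (extend_mnm u) = Some u.
Proof.
case E: (kap (extend_mnm u)) => [w|].
  by congr Some; apply/mnmP => l; rewrite (restrict_mnmE E) mnmE iotaK.
by move: E => /monomial_classN[j]; rewrite mnmE; case: (rho j).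
Qed.

Lemma restrict_mnmK m u : kap m = Some u -> m = extend_mnm u.
Proof.
move=> mu; apply/mnmP => i; rewrite mnmE; case E: (rho i) => [l|].
  by rewrite (restrict_mnmE mu); have := rhoK i; rewrite E /= => ->.
apply/eqP; rewrite -leqn0 leqNgt; apply/negP => mi.
suff : kap m = None by rewrite mu.
by apply/monomial_classN; exists i; rewrite ?E.
Qed.

Lemma mdeg_restrict m u : kap m = Some u -> mdeg m = mdeg u.
Proof.
move=> mu; rewrite (@monomial_class_deg _ _ _ predT _ _ _ mu) ?mdegE // => i w.
by case: (rho i) => [l|] //= [<-]; rewrite -mdegE mdeg1.
Qed.

Lemma mdeg_extend u : mdeg (extend_mnm u) = mdeg u.
Proof. exact: mdeg_restrict (extend_mnmK u). Qed.

Lemma extend_mnm_eq0 u : (extend_mnm u == 0%MM) = (u == 0%MM).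
Proof. by rewrite -!mdeg_eq0 mdeg_extend. Qed.

Section Series.
Variable C : numFieldType.
Implicit Types (f g : mfps C N) (p : {mpoly C[N]}).

(** This sets the variables outside the image of [iota] to 0. *)
Definition restrict f : mfps C n := fun u => f (extend_mnm u).

Lemma mcoeff_collapse_restrict p u : (collapse kap p)@_u = p@_(extend_mnm u).
Proof.
pose D := maxn (msize p) (mdeg (extend_mnm u)).+1.
rewrite (@mcoeff_collapse _ _ _ _ D) ?leq_maxl //.
have uD : (mdeg (extend_mnm u) < D)%N by rewrite leq_maxr.
rewrite (bigD1 (BMultinom uD)) /=; last by rewrite extend_mnmK.
rewrite big1 ?addr0 // => m /andP[/eqP /restrict_mnmK mu /eqP []].
exact: val_inj.
Qed.

Lemma restrict_is_monoid_morphism : monoid_morphism restrict.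
Proof.
split=> [|f g]; apply/funext => u.
  by rewrite -[LHS]/((extend_mnm u == 0%MM)%:R) extend_mnm_eq0.
rewrite -[LHS]/(mfps_mul f g (extend_mnm u)) -[RHS]/(mfps_mul (restrict f) (restrict g) u).
rewrite (mfps_mul_trunc _ _ (ltnSn _)) -mcoeff_collapse_restrict.
rewrite (collapseM (@monomial_classD _ _ _)) mdeg_extend; apply/esym.
by apply: mfps_mulE => k ku; rewrite mcoeff_collapse_restrict mcoeff_trunc mdeg_extend ltnS ku.
Qed.

Lemma hpart_restrict d f : hpart d (restrict f) = collapse kap (hpart d f).
Proof.
by apply/mpolyP => u; rewrite mcoeff_collapse_restrict !mcoeff_hpart mdeg_extend.
Qed.

Lemma restrict_cvg (x : local_ring C N) : restrict x \in @cvg_series C n.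
Proof.
have /asboolP/mfps_cvgP[r [M [r0 xM]]] := series_of_cvg x.
apply/asboolP/mfps_cvgP; exists r, M; split=> // u.
by have := xM (extend_mnm u); rewrite mdeg_extend.
Qed.

Definition restrict_germ x : local_ring C n := LocalRing (restrict_cvg x).

Lemma restrict_germ_is_zmod_morphism : zmod_morphism restrict_germ.
Proof. by move=> x y; apply: val_inj. Qed.

Lemma restrict_germ_is_monoid_morphism : monoid_morphism restrict_germ.
Proof.
have [r1 rM] := restrict_is_monoid_morphism.
by split=> [|x y]; apply: val_inj; [exact: r1|exact: rM].
Qed.

HB.instance Definition _ := GRing.isZmodMorphism.Build (local_ring C N) (local_ring C n)
  restrict_germ restrict_germ_is_zmod_morphism.
HB.instance Definition _ := GRing.isMonoidMorphism.Build (local_ring C N) (local_ring C n)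
  restrict_germ restrict_germ_is_monoid_morphism.

Lemma restrict_germ_surj y : exists x, restrict_germ x = y.
Proof.
pose f : mfps C N := fun m => if kap m is Some u then series_of y u else 0.
have fC : f \in @cvg_series C N.
  have /asboolP/mfps_cvgP[r [M [r0 yM]]] := series_of_cvg y.
  apply/asboolP/mfps_cvgP; exists r, M; split=> // m; rewrite /f.
  case E: (kap m) => [u|]; first by rewrite (mdeg_restrict E).
  by rewrite normr0 mul0r; apply: le_trans (yM 0%MM); rewrite mulr_ge0 // exprn_ge0 // ltW.
exists (LocalRing fC); apply/val_inj/funext => u.
by rewrite /= /restrict /= /f extend_mnmK.
Qed.

Lemma restrict_germC c : restrict_germ (of_mpoly c%:MP) = of_mpoly c%:MP.
Proof.
apply/val_inj/funext => u; rewrite /= /restrict /mfps_of_mpoly !mcoeffC.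
by rewrite extend_mnm_eq0.
Qed.

Lemma graded_kernel_restrict k (th : 'X_{1..n} -> option 'X_{1..k}) f :
  graded_kernel (fun m => obind th (kap m)) f <-> graded_kernel th (restrict f).
Proof.
by split=> h d; have := h d; rewrite hpart_restrict collapse_bind.
Qed.

End Series.
End Restriction.

(** * The germ of a face as a Segre cone times an affine space *)

Section FaceGerm.
Variables (C : numFieldType) (j d : nat).
Hypothesis j28 : (j < 28)%N.
Local Notation F := (nth [::] faces j).
Hypothesis F_size : size F = (2 * 3 + d)%N.

Let F_faces : F \in faces. Proof. by rewrite mem_nth. Qed.
Let F_uniq : uniq F.
Proof. by have /andP[/allP /(_ _ F_faces) /and3P[]] := faces_shape. Qed.
Let F_lt x : x \in F -> (x < 21)%N.
Proof. by have /andP[/allP /(_ _ F_faces) /and3P[_ /allP h _] _] := faces_shape; exact: h. Qed.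

Definition face_rank (i : 'I_21) : option 'I_(2 * 3 + d) := insub (index (val i) F).
Definition face_coord (l : 'I_(2 * 3 + d)) : 'I_21 := inord (nth 0%N F l).

Lemma face_coordK : pcancel face_coord face_rank.
Proof.
move=> l; rewrite /face_rank /face_coord /= inordK; last by rewrite F_lt // mem_nth ?F_size.
by rewrite index_uniq ?F_size // valK.
Qed.

Lemma face_rankK : ocancel face_rank face_coord.
Proof.
move=> i; rewrite /face_rank; case: insubP => //= l + lE; rewrite -F_size index_mem => iF.
by rewrite /face_coord lE nth_index // inord_val.
Qed.

(** The face lists its coordinates in the order of those of the Segre cone, so setting the variables
    off the face to 0 turns one class into the other. *)
Lemma comp_class_face m : comp_class j.+1 m = obind (@segre_class d)
  (monomial_class (fun i => omap (fun l => U_(l)%MM) (face_rank i)) m).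
Proof.
apply: monomial_class_bind => i; rewrite /face_rank /comp_exponent /=.
rewrite -index_mem F_size; case: insubP => [l -> lE|/negbTE -> //] /=.
by rewrite monomial_classU lE.
Qed.

Lemma face_germ_iso (P : prime_idealr (local_ring C 21)) : (d <= 4)%N ->
  (forall x, x \in P <-> graded_kernel (comp_class j.+1) x) -> germ_iso P (segre_germ C d).
Proof.
rewrite (funext comp_class_face) => d4 PE.
have := @germ_iso_of_rmorphism C 21 (2 * 3 + d) P (segre_germ C d)
  (restrict_germ face_coordK face_rankK (C := C)).
apply=> [y|x|c].
- exact: restrict_germ_surj.
- apply/idP/idP => [/(segre_germP d4) xk|/PE xk]; [apply/PE|apply/(segre_germP d4)].
    exact/(graded_kernel_restrict face_coordK face_rankK).
  exact/(graded_kernel_restrict face_coordK face_rankK).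
- exact: restrict_germC.
Qed.

End FaceGerm.

Theorem proposition7p4 (R : realType) :
  [/\ reduced {ideal_quot (versal_base R[i])},
      [set x | x \in versal_base R[i]]
        = \bigcap_(Z in components (versal_base R[i])) Z,
      components (versal_base R[i]) #= `I_29,
      components (versal_base R[i]) (smoothing_component R[i])
    & forall P : prime_idealr (local_ring R[i] 21),
        minimal_prime_over (versal_base R[i]) P ->
        [set x | x \in P] <> smoothing_component R[i] ->
        germ_iso P (segre_germ R[i] 3) \/ germ_iso P (segre_germ R[i] 4)].
Proof.
split.
- by apply: radical_reduced => x; exact: versal_base_sqrt.
- exact: versal_intersection.
- exact: card_components.
- by rewrite componentsE smoothing_comp; exists ord0.
move=> P /minimal_comp[c PE] PS.
have PK x : x \in P <-> graded_kernel (comp_class c) x.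
  by rewrite PE; exact: comp_primeP.
case: c PE PK => [[|j] j29] PE PK.
  case: PS; rewrite smoothing_comp; apply/seteqP; split=> x /=; rewrite PE;
    by rewrite (_ : Ordinal j29 = ord0) //; exact: val_inj.
(* Beyond the six edges of the star there are 3 or 4 free ones, which give the affine factor. *)
have /andP[/allP /(_ (nth [::] faces j)) + _] := faces_shape.
rewrite mem_nth // => /(_ isT) /and3P[_ _ /orP[/eqP sz|/eqP sz]]; [left|right];
  exact: (face_germ_iso j29 sz).
Qed.
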